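(* For every rational (2-bridge) knot $K$, the second elementary ideal is trivial: $E_2(K)=\mathbb{Z}[t,t^{-1}]$.
   Context: Rational knots are the knots $L(p/q)$ ($p,q$ coprime integers) given by the standard four-strand plat-type (2-bridge) diagrams associated with a continued fraction expansion of $p/q$. For a knot $K\subset\mathbb{R}^3$ let $X=\mathbb{R}^3\setminus K$ and let $\tilde X\to X$ be the covering corresponding to the commutator subgroup of $\pi_1(X)$. The group $H_1(X)\cong\mathbb{Z}$ with generator $t$ acts on $\tilde X$ by deck transformations, making $M_K=H_1(\tilde X)$ a finitely presented $\mathbb{Z}[t,t^{-1}]$-module, the Alexander module of $K$. The second elementary (Alexander) ideal $E_2(K)\subseteq\mathbb{Z}[t,t^{-1}]$ is the ideal generated by all minors of order $n-1$ of any presentation matrix of $M_K$ with $n$ generators (the whole ring if $n\le 1$, and the zero ideal if $n-1$ exceeds the number of relations); it does not depend on the presentation matrix. *)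

(* Defs.v *)
From HB Require Import structures.
From mathcomp Require Import all_boot all_order all_algebra.
From mathcomp Require Import generic_quotient ring_quotient fraction freeg.
From mathcomp Require Import all_classical all_reals all_analysis.

Set Implicit Arguments.
Unset Strict Implicit.
Unset Printing Implicit Defensive.

Import Order.TTheory GRing.Theory Num.Theory numFieldNormedType.Exports.

Local Open Scope classical_set_scope.
Local Open Scope ring_scope.

(* Z[t,t^-1] is realised inside the field of fractions of Z['X]. *)

Local Notation "p %:F" := (@FracField.tofrac _ p).

Definition is_laurent : {pred {fraction {poly int}}} :=
  fun x => `[< exists (n : nat) (p : {poly int}), x * ('X^n)%:F = p%:F >].

Lemma is_laurent_subring : subring_closed is_laurent.
Proof.
split=> [|x y /asboolP[n [p xE]] /asboolP[m [q yE]]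
         |x y /asboolP[n [p xE]] /asboolP[m [q yE]]]; apply/asboolP.
- by exists 0, 1; rewrite expr0 mulr1.
- exists (n + m), (p * 'X^m - q * 'X^n).
  rewrite exprD tofracB !tofracM -xE -yE mulrBl !mulrA; congr (_ - _).
  by rewrite mulrAC.
- exists (n + m), (p * q).
  by rewrite exprD !tofracM -xE -yE mulrACA.
Qed.

HB.instance Definition _ :=
  GRing.isSubringClosed.Build {fraction {poly int}} is_laurent
    is_laurent_subring.

Record laurent := Laurent {
  laurent_val :> {fraction {poly int}};
  laurentP : laurent_val \in is_laurent }.

HB.instance Definition _ := [isSub for laurent_val].
HB.instance Definition _ := [Choice of laurent by <:].
HB.instance Definition _ := [SubChoice_isSubComNzRing of laurent by <:].

Lemma laurentX_subproof : ('X)%:F \in is_laurent.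
Proof. by apply/asboolP; exists 0, 'X; rewrite expr0 mulr1. Qed.

Definition laurentX : laurent := Laurent laurentX_subproof.

Section LaurentAction.
Variables (V : zmodType) (u u' : {additive V -> V}).
Hypotheses (uK : cancel u u') (u'K : cancel u' u).

Definition poly_act (p : {poly int}) (v : V) : V :=
  \sum_(i < size p) iter i u v *~ p`_i.

Definition laurent_repr (x : laurent) :
  {np : nat * {poly int} | val x * ('X^(np.1))%:F = np.2%:F}.
Proof.
apply: cid; have /asboolP[n [p E]] := laurentP x.
by exists (n, p).
Defined.

(* x = t^-n p(t) acts as u^-n p(u). *)
Definition laurent_act (x : laurent) (v : V) : V :=
  let np := sval (laurent_repr x) in iter np.1 u' (poly_act np.2 v).

Lemma poly_act_widen (p : {poly int}) n v : (size p <= n)%N ->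
  poly_act p v = \sum_(i < n) iter i u v *~ p`_i.
Proof.
move=> le; rewrite /poly_act (big_ord_widen n (fun i => iter i u v *~ p`_i) le) big_mkcond.
apply: eq_bigr => i _; case: ltnP => // lei.
by rewrite nth_default // mulr0z.
Qed.

Lemma poly_actDl p q v : poly_act (p + q) v = poly_act p v + poly_act q v.
Proof.
pose n := maxn (size p) (size q).
rewrite (@poly_act_widen _ n) ?size_polyD // (@poly_act_widen p n) ?leq_maxl //.
rewrite (@poly_act_widen q n) ?leq_maxr // -big_split /=.
by apply: eq_bigr => i _; rewrite coefD mulrzDr.
Qed.

Lemma iter_addl n v w : iter n u (v + w) = iter n u v + iter n u w.
Proof. by elim: n => //= n ->; rewrite raddfD. Qed.

Lemma iter_addl' n v w : iter n u' (v + w) = iter n u' v + iter n u' w.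
Proof. by elim: n => //= n ->; rewrite raddfD. Qed.

Lemma poly_actDr p v w : poly_act p (v + w) = poly_act p v + poly_act p w.
Proof.
by rewrite -big_split; apply: eq_bigr => i _ /=; rewrite iter_addl mulrzDl.
Qed.

Lemma poly_act0 v : poly_act 0 v = 0.
Proof. by rewrite /poly_act size_poly0 big_ord0. Qed.

Lemma poly_actC c v : poly_act c%:P v = v *~ c.
Proof.
by rewrite (@poly_act_widen _ 1) ?size_polyC_leq1 // big_ord1 coefC.
Qed.

Lemma poly_act_u p v : poly_act p (u v) = u (poly_act p v).
Proof.
rewrite raddf_sum; apply: eq_bigr => i _ /=.
by rewrite raddfMz -iterSr.
Qed.

Lemma poly_actMX p v : poly_act (p * 'X) v = u (poly_act p v).
Proof.
have [->|p0] := eqVneq p 0; first by rewrite mul0r !poly_act0 raddf0.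
rewrite /poly_act size_mulX // big_ord_recl coefMX /= mulr0z add0r.
rewrite raddf_sum; apply: eq_bigr => i _ /=.
by rewrite coefMX /= raddfMz.
Qed.

Lemma poly_actMz p v (c : int) : poly_act p (v *~ c) = poly_act p v *~ c.
Proof.
have fD : {morph poly_act p : x y / x + y} by move=> x y; rewrite poly_actDr.
have f0 : poly_act p 0 = 0 by apply: (@addrI _ (poly_act p 0)); rewrite -fD !addr0.
have fN x : poly_act p (- x) = - poly_act p x.
  by apply: (@addrI _ (poly_act p x)); rewrite -fD !subrr.
have fn (n : nat) : poly_act p (v *+ n) = poly_act p v *+ n.
  by elim: n => [|n IH]; rewrite ?mulr0n // !mulrS fD IH.
by case: c => n; rewrite ?NegzE ?mulrNz -?pmulrn ?fN fn.
Qed.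

Lemma poly_actM p q v : poly_act (p * q) v = poly_act p (poly_act q v).
Proof.
elim/poly_ind: p => [|p c IH]; first by rewrite mul0r !poly_act0.
rewrite mulrDl !poly_actDl mulrAC !poly_actMX IH; congr (_ + _).
rewrite poly_actC mulrC.
elim/poly_ind: q {IH} => [|q d IH]; first by rewrite mul0r !poly_act0 mul0rz.
rewrite mulrDl !poly_actDl mulrAC !poly_actMX IH mulrzDl raddfMz; congr (_ + _).
by rewrite -polyCM !poly_actC mulrzA.
Qed.

Lemma poly_actXn n v : poly_act 'X^n v = iter n u v.
Proof.
elim: n => [|n IH]; first by rewrite expr0 -[1]/(1%:P) poly_actC mulr1z.
by rewrite exprSr poly_actMX IH.
Qed.

Lemma iterK n : cancel (iter n u) (iter n u').
Proof. by elim: n => // n IH v; rewrite iterSr /= uK IH. Qed.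

Lemma iterK' n : cancel (iter n u') (iter n u).
Proof. by elim: n => // n IH v; rewrite iterSr /= u'K IH. Qed.

Lemma laurent_actE x n p v : val x * ('X^n)%:F = p%:F ->
  iter n u (laurent_act x v) = poly_act p v.
Proof.
rewrite /laurent_act; case: (laurent_repr x) => -[m q] /= E1 E2.
apply: (can_inj (@iterK m)).
have -> : iter m u (iter n u (iter m u' (poly_act q v))) =
          iter n u (poly_act q v).
  by rewrite -iterD addnC iterD iterK'.
rewrite -!poly_actXn -!poly_actM; congr poly_act.
apply/eqP; rewrite -tofrac_eq !tofracM -E1 -E2; apply/eqP.
by rewrite mulrC mulrAC [RHS]mulrC.
Qed.

Lemma laurent_act_uniq x n p v w : val x * ('X^n)%:F = p%:F ->
  iter n u w = poly_act p v -> laurent_act x v = w.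
Proof. by move=> xE wE; apply: (can_inj (@iterK n)); rewrite (laurent_actE _ xE). Qed.

Lemma laurent_actA x y v :
  laurent_act x (laurent_act y v) = laurent_act (x * y) v.
Proof.
have [[n p] xE] := laurent_repr x; have [[m q] yE] := laurent_repr y.
rewrite /= in xE yE; apply/esym/(@laurent_act_uniq _ (m + n) (p * q)).
  by rewrite exprD !tofracM -xE -yE rmorphM /= [('X^m)%:F * _]mulrC mulrACA.
rewrite iterD (laurent_actE _ xE) -(poly_actXn m) -poly_actM [_ * p]mulrC.
by rewrite 2!poly_actM poly_actXn (laurent_actE _ yE).
Qed.

Lemma laurent_act1 : left_id 1 laurent_act.
Proof.
move=> v; apply: (@laurent_act_uniq _ 0 1); first by rewrite mul1r.
by rewrite -[1]/(1%:P) poly_actC mulr1z.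
Qed.

Lemma laurent_actDr : right_distributive laurent_act +%R.
Proof.
move=> x v w; have [[n p] /= xE] := laurent_repr x.
apply: (laurent_act_uniq xE).
by rewrite iter_addl !(laurent_actE _ xE) poly_actDr.
Qed.

Lemma laurent_actDl v : {morph laurent_act^~ v : x y / x + y}.
Proof.
move=> x y; have [[n p] /= xE] := laurent_repr x.
have [[m q] /= yE] := laurent_repr y.
apply: (@laurent_act_uniq _ (n + m) (p * 'X^m + q * 'X^n)).
  by rewrite exprD tofracD !tofracM -xE -yE rmorphD /= mulrDl !mulrA; congr +%R;
     rewrite mulrAC.
rewrite iter_addl {1}addnC !iterD (laurent_actE _ xE) (laurent_actE _ yE).
by rewrite poly_actDl ![_ * 'X^_]mulrC !poly_actM !poly_actXn.
Qed.
End LaurentAction.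

Section Simplex.
Variable R : realType.

Definition simplex n : set 'rV[R]_n.+1 :=
  [set v | (forall i, 0 <= v 0 i) /\ \sum_i v 0 i = 1].
Arguments simplex : clear implicits.

(* The i-th face inserts a zero barycentric coordinate in position i. *)
Definition insert0 n (i : 'I_n.+2) (v : 'rV[R]_n.+1) : 'rV[R]_n.+2 :=
  \row_j (if unlift i j is Some k then v 0 k else 0).

Lemma insert0_simplex n (i : 'I_n.+2) v :
  simplex n v -> simplex n.+1 (insert0 i v).
Proof.
move=> [v0 v1]; split=> [j|]; first by rewrite mxE; case: unlift.
rewrite (bigD1_ord i) //= mxE unlift_none add0r -v1.
by apply: eq_bigr => j _; rewrite mxE liftK.
Qed.

Definition face n (i : 'I_n.+2) (v : simplex n) : simplex n.+1 :=
  SigSub (mem_set (insert0_simplex i (set_mem (valP v)))).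

Lemma insert0_continuous n (i : 'I_n.+2) : continuous (@insert0 n i).
Proof.
move=> v A /nbhs_ballP[e e0 eA]; apply/nbhs_ballP; exists e => // w [_ vw].
apply: eA; split=> // a b; rewrite !mxE.
by case: unlift => [k|]; [exact: vw | exact: ballxx].
Qed.

Lemma face_continuous n (i : 'I_n.+2) : continuous (@face n i).
Proof.
apply: continuous_comp_initial.
have -> : set_val \o @face n i = @insert0 n i \o (set_val : simplex n -> _).
  by apply/funext.
move=> v; apply: continuous_comp; first exact: initial_continuous.
exact: insert0_continuous.
Qed.

HB.instance Definition _ n (i : 'I_n.+2) :=
  @isContinuous.Build (simplex n) (simplex n.+1) (@face n i)
    (@face_continuous n i).

End Simplex.

Arguments simplex : clear implicits.

Section SingularChains.
Implicit Types E F : topologicalType.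
Variable R : realType.

Definition singular_simplex n (E : topologicalType) :=
  continuousType (simplex R n) E.

Definition chain n (E : topologicalType) :=
  {freeg (singular_simplex n E) / int}.

Definition boundary n (E : topologicalType) : chain n.+1 E -> chain n E :=
  fglift (fun s : singular_simplex n.+1 E =>
    \sum_(i < n.+2) (-1) ^+ i *:
      (<< (s \o @face R n i : singular_simplex n E) >> : chain n E)).

Definition chain_map n (E F : topologicalType) (f : continuousType E F) :
    chain n E -> chain n F :=
  fglift (fun s : singular_simplex n E =>
    << (f \o s : singular_simplex n F) >> : chain n F).

HB.instance Definition _ n E :=
  GRing.isZmodMorphism.Build (chain n.+1 E) (chain n E) (@boundary n E)
    (lift_is_additive _).
HB.instance Definition _ n E F f :=
  GRing.isZmodMorphism.Build (chain n E) (chain n F) (@chain_map n E F f)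
    (lift_is_additive _).

Lemma additive_chain_ext n E (V : zmodType) (f g : {additive chain n E -> V}) :
  (forall s : singular_simplex n E, f << s >> = g << s >>) -> f =1 g.
Proof.
move=> fg c; rewrite -(freeg_sumE c) !raddf_sum; apply: eq_bigr => s _.
by rewrite -[coeff _ _]intz -freegU_mulz !raddfMz fg.
Qed.

Lemma chain_mapU n E F (f : continuousType E F) (s : singular_simplex n E) :
  chain_map f << s >> = << (f \o s : singular_simplex n F) >>.
Proof. by rewrite /chain_map liftU scale1r. Qed.

Lemma boundaryU n E (s : singular_simplex n.+1 E) :
  boundary << s >> = \sum_(i < n.+2) (-1) ^+ i *:
      (<< (s \o @face R n i : singular_simplex n E) >> : chain n E).
Proof. by rewrite /boundary liftU scale1r. Qed.

Lemma boundary_chain_map n E F (f : continuousType E F) (c : chain n.+1 E) :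
  boundary (chain_map f c) = chain_map f (boundary c).
Proof.
move: c; apply: (@additive_chain_ext _ _ _ (@boundary n F \o chain_map f)
  (chain_map f \o @boundary n E)) => s /=.
rewrite chain_mapU !boundaryU raddf_sum; apply: eq_bigr => i _.
have Z (k : int) (c : chain n E) : chain_map f (k *: c) = k *: chain_map f c.
  have M (V : lmodType int) (v : V) : k *: v = v *~ k by rewrite -scaler_int intz.
  by rewrite !M raddfMz.
rewrite [LHS]/= [RHS]/= Z chain_mapU; congr (_ *: << _ >>).
exact/continuousEP.
Qed.

Lemma chain_mapK n E F (f : continuousType E F) (g : continuousType F E) :
  cancel f g -> cancel (@chain_map n E F f) (@chain_map n F E g).
Proof.
move=> fK; apply: (@additive_chain_ext _ _ _ (chain_map g \o chain_map f)
  idfun) => s /=.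
rewrite !chain_mapU; congr << _ >>; apply/continuousEP => x /=; exact: fK.
Qed.

Section H1.
Variable E : topologicalType.

Definition is_cycle : {pred chain 1 E} := fun c => boundary c == 0.

Lemma is_cycle_zmod : zmod_closed is_cycle.
Proof.
split=> [|x y /eqP x0 /eqP y0]; apply/eqP; first exact: raddf0.
by rewrite raddfB /= x0 y0 subrr.
Qed.

HB.instance Definition _ := GRing.isZmodClosed.Build (chain 1 E) is_cycle
  is_cycle_zmod.

Record cycles := Cycle {
  cycle_val :> chain 1 E;
  cycleP : cycle_val \in is_cycle }.

HB.instance Definition _ := [isSub for cycle_val].
HB.instance Definition _ := [Choice of cycles by <:].
HB.instance Definition _ := [SubChoice_isSubZmodule of cycles by <:].

Definition is_boundary : {pred cycles} :=
  fun c => `[< exists d : chain 2 E, boundary d = val c >].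

Lemma is_boundary_zmod : zmod_closed is_boundary.
Proof.
split=> [|x y /asboolP[c cE] /asboolP[d dE]]; apply/asboolP.
  by exists 0; rewrite !raddf0.
by exists (c - d); rewrite !raddfB /= cE dE.
Qed.

HB.instance Definition _ := GRing.isZmodClosed.Build cycles is_boundary
  is_boundary_zmod.

Definition H1 := Quotient.quot is_boundary.

HB.instance Definition _ := GRing.Zmodule.on H1.

Definition homology_class (c : cycles) : H1 := (\pi_(Quotient.quot is_boundary) c)%qT.

Definition representative (x : H1) : cycles := repr x.

Lemma representativeK : cancel representative homology_class.
Proof. exact: reprK. Qed.

Lemma homology_class_eqP (c d : cycles) :
  homology_class c = homology_class d <->
  exists b : chain 2 E, boundary b = val c - val d.
Proof.
split=> [/eqP|[b bE]]; last apply/eqP.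
  by rewrite -Quotient.idealrBE => /asboolP[b bE]; exists b; rewrite bE raddfB.
by rewrite -Quotient.idealrBE; apply/asboolP; exists b; rewrite bE raddfB.
Qed.

Lemma homology_class_additive : zmod_morphism homology_class.
Proof. exact: raddfB. Qed.

HB.instance Definition _ :=
  GRing.isZmodMorphism.Build cycles H1 homology_class homology_class_additive.
End H1.

Section H1Map.
Variables E F : topologicalType.
Variable f : continuousType E F.

Lemma cycle_map_subproof (c : cycles E) : chain_map f c \in @is_cycle F.
Proof.
apply/eqP; rewrite boundary_chain_map.
by have /eqP-> := cycleP c; rewrite raddf0.
Qed.

Definition cycle_map (c : cycles E) : cycles F :=
  Cycle (cycle_map_subproof c).

Lemma cycle_map_additive : zmod_morphism cycle_map.
Proof. by move=> c d; apply: val_inj; rewrite /= !raddfB. Qed.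

HB.instance Definition _ :=
  GRing.isZmodMorphism.Build (cycles E) (cycles F) cycle_map
    cycle_map_additive.

Definition H1_map (x : H1 E) : H1 F :=
  homology_class (cycle_map (representative x)).

Lemma H1_map_class (c : cycles E) :
  H1_map (homology_class c) = homology_class (cycle_map c).
Proof.
have [b bE] := (homology_class_eqP _ _).1 (representativeK (homology_class c)).
apply/homology_class_eqP; exists (chain_map f b).
by rewrite boundary_chain_map bE raddfB.
Qed.

Lemma H1_map_additive : zmod_morphism H1_map.
Proof.
move=> x y; rewrite -[x]representativeK -[y]representativeK -raddfB.
by rewrite !H1_map_class !raddfB.
Qed.

HB.instance Definition _ :=
  GRing.isZmodMorphism.Build (H1 E) (H1 F) H1_map H1_map_additive.
End H1Map.

Lemma H1_mapK E F (f : continuousType E F) (g : continuousType F E) :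
  cancel f g -> cancel (H1_map f) (H1_map g).
Proof.
move=> fK x; rewrite -[x]representativeK !H1_map_class; congr homology_class.
by apply: val_inj; rewrite /= (chain_mapK fK).
Qed.
End SingularChains.

Record homeomorphism (E F : topologicalType) := Homeomorphism {
  homeo_fun :> continuousType E F;
  homeo_inv : continuousType F E;
  homeoK : cancel homeo_fun homeo_inv;
  homeo_invK : cancel homeo_inv homeo_fun }.

(* H_1 of E with the Z[t,t^-1]-module structure in which the variable acts     *)
(* through the self-homeomorphism t, which the carrier does not depend on.     *)
Definition alexander_module (R : realType) (E : topologicalType)
  (t : homeomorphism E E) := H1 R E.

Section AlexanderModule.
Variables (R : realType) (E : topologicalType) (t : homeomorphism E E).

HB.instance Definition _ := GRing.Zmodule.on (alexander_module R t).

Definition alexander_scale (a : laurent) (x : alexander_module R t) :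
    alexander_module R t :=
  laurent_act (V := H1 R E) (H1_map t) (H1_map (homeo_inv t)) a x.

Lemma H1_homeoK : cancel (H1_map (R := R) t) (H1_map (homeo_inv t)).
Proof. exact/H1_mapK/homeoK. Qed.

Lemma H1_homeo_invK : cancel (H1_map (R := R) (homeo_inv t)) (H1_map t).
Proof. exact/H1_mapK/homeo_invK. Qed.

HB.instance Definition _ :=
  GRing.Zmodule_isLmodule.Build laurent (alexander_module R t)
    (scale := alexander_scale)
    (laurent_actA H1_homeoK H1_homeo_invK) (laurent_act1 H1_homeoK H1_homeo_invK)
    (laurent_actDr H1_homeoK H1_homeo_invK)
    (laurent_actDl H1_homeoK H1_homeo_invK).

Lemma alexander_scaleX (x : alexander_module R t) : laurentX *: x = H1_map t x.
Proof.
apply: (laurent_act_uniq H1_homeoK H1_homeo_invK (n := 0) (p := 'X)).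
  by rewrite expr0 mulr1.
by rewrite -['X]/('X^1) poly_actXn.
Qed.
End AlexanderModule.

(* Rows of A are relations between n generators g of M. *)
Definition presents (A0 : comNzRingType) (M : lmodType A0) m n
    (A : 'M[A0]_(m, n)) : Prop :=
  exists g : 'I_n -> M,
    (forall x : M, exists c : 'rV[A0]_n, x = \sum_j c 0 j *: g j) /\
    (forall c : 'rV[A0]_n,
       \sum_j c 0 j *: g j = 0 <-> exists b : 'rV[A0]_m, c = b *m A).

(* The ideal generated by the k x k minors of A. The row and column selections *)
(* range over all functions: a repeated index only adds the minor 0, and a     *)
(* reordering only changes the sign.                                           *)
Definition minors_ideal (A0 : comNzRingType) m n k (A : 'M[A0]_(m, n)) :
    set A0 :=
  [set x | exists c : {ffun 'I_k -> 'I_m} -> {ffun 'I_k -> 'I_n} -> A0,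
     x = \sum_f \sum_g c f g * \det (mxsub f g A)].

Definition is_second_elementary_ideal (A0 : comNzRingType) (M : lmodType A0)
    (I : set A0) : Prop :=
  (exists m n (A : 'M[A0]_(m, n)), presents M A) /\
  (forall m n (A : 'M[A0]_(m, n)), presents M A -> I = minors_ideal n.-1 A).

(* A path is a function on R of which only the restriction to [0, 1] matters. *)

Section Loops.
Variables (R : realType) (T : topologicalType).
Implicit Types (X : set T) (x y : T) (f g : R -> T).

Definition is_path X x y f : Prop :=
  [/\ {within `[0, 1], continuous f}, f 0 = x, f 1 = y
    & forall s, s \in `[0, 1] -> X (f s)].

Definition is_loop X x f : Prop := is_path X x x f.

Definition path_homotopic X x y f g : Prop :=
  exists H : R * R -> T,
    [/\ {within `[0, 1] `*` `[0, 1], continuous H},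
        forall s, s \in `[0, 1] -> H (0, s) = f s /\ H (1, s) = g s,
        forall r, r \in `[0, 1] -> H (r, 0) = x /\ H (r, 1) = y
      & forall r s, r \in `[0, 1] -> s \in `[0, 1] -> X (H (r, s))].

Definition concat f g : R -> T :=
  fun s => if s <= 2^-1 then f (2 * s) else g (2 * s - 1).

Definition reverse f : R -> T := fun s => f (1 - s).

Definition loop_commutator f g : R -> T :=
  concat (concat f g) (concat (reverse f) (reverse g)).

Definition loop_exp x f (n : int) : R -> T :=
  match n with
  | Posz k => iter k (concat f) (cst x)
  | Negz k => iter k.+1 (concat (reverse f)) (cst x)
  end.

(* Loops at x whose class lies in the commutator subgroup of pi_1(X, x). *)
Inductive in_commutator_subgroup X x : (R -> T) -> Prop :=
| commutator_one : in_commutator_subgroup X x (cst x)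
| commutator_mul f g h : is_loop X x f -> is_loop X x g ->
    in_commutator_subgroup X x h ->
    in_commutator_subgroup X x (concat (loop_commutator f g) h)
| commutator_homotopic f g : in_commutator_subgroup X x f ->
    path_homotopic X x x f g -> in_commutator_subgroup X x g.

(* The class of g generates the abelianization of pi_1(X, x), which is H_1(X)  *)
(* when X is path connected.                                                  *)
Definition generates_abelianization X x g : Prop :=
  is_loop X x g /\
  forall f, is_loop X x f ->
    exists n, in_commutator_subgroup X x (concat f (reverse (loop_exp x g n))).

Definition path_connected X : Prop :=
  forall x y, X x -> X y -> exists f, is_path X x y f.
End Loops.

Section Coverings.
Variables (R : realType) (B E : topologicalType).
Implicit Types (X : set B) (p : E -> B) (t : homeomorphism E E).

(* For an open subset X of B. *)
Definition is_covering X p : Prop :=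
  [/\ continuous p, range p = X
    & forall x, X x -> exists U : set B, [/\ open U, U x, U `<=` X
      & exists (I : Type) (V : I -> set E),
        [/\ forall i, open (V i), trivIset setT V, p @^-1` U = \bigcup_i V i
          & forall i, exists s : B -> E,
            [/\ {within U, continuous s},
                forall u, U u -> V i (s u) /\ p (s u) = u
              & forall v, V i v -> s (p v) = v]]]].

Definition is_commutator_covering X p : Prop :=
  [/\ is_covering X p, path_connected R [set: E]
    & forall e (c : R -> B), is_loop X (p e) c ->
        (in_commutator_subgroup X (p e) c <->
         exists2 d : R -> E, is_loop setT e d
           & path_homotopic X (p e) (p e) (p \o d) c)].

(* A generator of H_1(X), the class of a loop g, acts on the covering by the    *)
(* deck transformation t that moves the origin of every lift of g to its end.   *)
Definition is_deck_generator X p t : Prop :=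
  (forall e, p (t e) = p e) /\
  exists x (g : R -> B),
    [/\ X x, generates_abelianization X x g
      & forall e e' (d : R -> E), is_path setT e e' d ->
          (forall s, s \in `[0, 1] -> p (d s) = g s) -> t e = e'].
End Coverings.

Section RationalKnots.
Variable R : realType.

Definition R3 : topologicalType := (R * R * R)%type.

Definition is_knot (K : set R3) : Prop :=
  exists f : R -> R3,
    [/\ {within `[0, 1], continuous f}, f 0 = f 1,
        {in `[0, 1[ &, injective f} & K = f @` `[0, 1]].

Definition ambient_isotopic (L K : set R3) : Prop :=
  exists F : R * R3 -> R3,
    [/\ {within `[0, 1] `*` setT, continuous F},
        forall s, s \in `[0, 1] ->
          exists h : homeomorphism R3 R3, forall x, h x = F (s, x),
        forall x, F (0, x) = x
      & (fun x => F (1, x)) @` L = K].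

(* A geometric braid on four strands, which are at (0,0), ..., (3,0) in every  *)
(* integral level z. The letter (i, e) exchanges the strands at i and i+1 by   *)
(* half a turn, in the direction given by the sign (-1)^e; the other strands   *)
(* are vertical.                                                               *)
Definition half_twist (i : nat) (e : bool) (k : nat) : set R3 :=
  [set u : R * R * R | let: (x, y, z) := u in k%:R <= z <= k.+1%:R /\
     ((exists j : nat, [/\ (j < 4)%N, j != i, j != i.+1, x = j%:R & y = 0]) \/
      (exists d : bool,
         x = i%:R + 2^-1 - (-1) ^+ d * (cos (pi * (z - k%:R)) / 2) /\
         y = - ((-1) ^+ d * (-1) ^+ e * (sin (pi * (z - k%:R)) / 2))))].

Fixpoint braid (k : nat) (w : seq (nat * bool)) : set R3 :=
  if w is (i, e) :: w' then half_twist i e k `|` braid k.+1 w' else set0.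

Definition bottom_caps : set R3 :=
  [set u : R * R * R | let: (x, y, z) := u in [/\ y = 0, z <= 0
     & (x - 2^-1) ^+ 2 + z ^+ 2 = 4^-1 \/
       (x - (2 + 2^-1)) ^+ 2 + z ^+ 2 = 4^-1]].

Definition top_caps (n : nat) : set R3 :=
  [set u : R * R * R | let: (x, y, z) := u in [/\ y = 0, n%:R <= z
     & (x - 2^-1) ^+ 2 + (z - n%:R) ^+ 2 = 4^-1 \/
       (x - (2 + 2^-1)) ^+ 2 + (z - n%:R) ^+ 2 = 4^-1]].

Definition plat (w : seq (nat * bool)) : set R3 :=
  bottom_caps `|` braid 0 w `|` top_caps (size w).

(* The word sigma_2^a1 sigma_1^-a2 sigma_2^a3 ..., where sigma_1 exchanges the *)
(* strands 0 and 1 and sigma_2 the strands 1 and 2. The Boolean tells whether  *)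
(* the next syllable is a power of sigma_2.                                    *)
Fixpoint rational_word (middle : bool) (a : seq int) : seq (nat * bool) :=
  if a is c :: a' then
    nseq `|c|%N (nat_of_bool middle, (c < 0) (+) ~~ middle)
      ++ rational_word (~~ middle) a'
  else [::].

(* Numerator and denominator of a1 + 1/(a2 + 1/(... + 1/an)). *)
Fixpoint continued_fraction (a : seq int) : int * int :=
  if a is c :: a' then
    let: (p, q) := continued_fraction a' in (c * p + q, p)
  else (1, 0).

(* The 4-plat of a continued fraction a = [a1, ..., an] of p/q. With these     *)
(* caps n has to be odd: a final power of sigma_1 could be untwisted.          *)
Definition rational_diagram (p q : int) (L : set R3) : Prop :=
  exists a : seq int,
    [/\ odd (size a),
        p * (continued_fraction a).2 = (continued_fraction a).1 * q
      & L = plat (rational_word true a)].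

Definition is_rational_knot (K : set R3) : Prop :=
  is_knot K /\
  exists (p q : int) (L : set R3),
    [/\ coprimez p q, rational_diagram p q L & ambient_isotopic L K].
End RationalKnots.

(* Main.v *)
(* The fundamental group of the complement of a 4-plat is generated by two     *)
(* loops: after the braid has been straightened, the complement is covered by  *)
(* the part above the bottom caps minus two vertical discs hanging from the    *)
(* top caps, the part below minus two discs spanning the bottom caps, and      *)
(* convex neighbourhoods of these discs. All these sets are simply connected,  *)
(* and only the crossings of the two upper discs contribute generators.        *)
(* A loop f lifts to the covering E, and f is sent to the affine map           *)
(* w |-> u + t^n w, where u is the class of the lift in the 1-chains of E      *)
(* modulo boundaries and t^n moves the origin of the lift to its end. The      *)
(* images of the two generators can be reduced by Nielsen moves to a pair in   *)
(* which one is a translation by a cycle d. Modulo the multiples of d the      *)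
(* image is then cyclic, so that commutators, which are the loops lifting to   *)
(* loops, become multiples of d. Hence d generates the Alexander module, a     *)
(* quotient of the Noetherian ring Z[t,t^-1]; and if the module has one        *)
(* generator, then in any presentation with n generators the minors of order   *)
(* n - 1 generate the unit ideal.                                              *)

Require Import Defs.
From HB Require Import structures.
From mathcomp Require Import generic_quotient ring_quotient fraction freeg.
From mathcomp Require Import all_boot all_order all_algebra.
From mathcomp Require Import all_classical all_reals all_analysis.
From mathcomp Require Import ring lra zify.

Set Implicit Arguments.
Unset Strict Implicit.
Unset Printing Implicit Defensive.

Import Order.TTheory GRing.Theory Num.Theory numFieldNormedType.Exports.

Local Open Scope classical_set_scope.
Local Open Scope ring_scope.

(** * Cyclic modules and their presentations *)

(** The complement of a 2-bridge link has a fundamental group with two generators, and this forces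
    the Alexander module of the knot to be cyclic.

    For a cyclic module the second elementary ideal is trivial. Let [g0] generate it, let the
    presenting generators be [d_j g0], and let [g0] be their combination with coefficients [c]. Then
    the identity matrix factors through the relation matrix [A] bordered by the single row [c], and
    expanding its determinant writes 1 as a combination of minors of order n - 1 of [A]
    ([cyclic_minors_ideal]). A finite presentation exists because Z[X] is Noetherian
    ([cyclic_presents]).

    The fundamental group enters only through maps [nu] from paths to a group that respect homotopy
    and concatenation. For every such [nu], the values on loops lie in the subgroup generated by the
    values on two loops. This is the generating half of van Kampen's theorem ([tame_add]), applied
    to a cover by simply connected pieces ([two_generators]) after the braid of the plat has been
    straightened ([braid_straight], [plat_two_generators]).

    The functor used is [monodromy]. It takes values in the affine bijections w |-> u + t^n w of the
    module of 1-chains modulo boundaries of the covering, a geometric form of Fox calculus. Euclid's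
    algorithm on the two exponents ([nielsen_reduction]) produces one affine map and one translation
    by [d], the class of a loop upstairs, such that both generators are powers of the former up to
    multiples of [d]. The exponents of these powers cancel in commutators, which therefore give
    multiples of [d] ([commutator_coset]). In the commutator covering every loop projects into the
    commutator subgroup, so [d] generates H_1 ([covering_loops_cyclic], [alexander_cyclic]). *)

Section Fitting.
Variable A0 : comNzRingType.

(** Cauchy-Binet without collecting terms: the sum runs over all row selections, in accordance with
    the form of [minors_ideal]. *)
Lemma det_mulmx_rect m k (B : 'M[A0]_(k, m)) (A : 'M[A0]_(m, k)) :
  \det (B *m A) =
  \sum_(h : {ffun 'I_k -> 'I_m}) (\prod_i B i (h i)) * \det (rowsub h A).
Proof.
rewrite /determinant.
under eq_bigr => s _.
  under eq_bigr => i _ do rewrite mxE.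
  rewrite bigA_distr_bigA mulr_sumr.
  over.
rewrite exchange_big; apply: eq_bigr => h _ /=.
rewrite mulr_sumr; apply: eq_bigr => s _.
rewrite big_split /= mulrCA; congr (_ * (_ * _)).
by apply: eq_bigr => i _; rewrite !mxE.
Qed.

Section Minors.
Variables (m n k : nat) (A : 'M[A0]_(m, n)).

Lemma minors_idealM a x : minors_ideal k A x -> minors_ideal k A (a * x).
Proof.
move=> [c ->]; exists (fun f g => a * c f g).
by rewrite mulr_sumr; apply: eq_bigr => f _; rewrite mulr_sumr;
   apply: eq_bigr => g _; rewrite mulrA.
Qed.

Lemma minors_ideal_sum (I : finType) (x : I -> A0) :
  (forall i, minors_ideal k A (x i)) -> minors_ideal k A (\sum_i x i).
Proof.
move=> H; pose c i := sval (cid (H i)).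
exists (fun f g => \sum_i c i f g).
under eq_bigr => i _ do rewrite (svalP (cid (H i))).
rewrite exchange_big; apply: eq_bigr => f _; rewrite exchange_big.
by apply: eq_bigr => g _; rewrite mulr_suml.
Qed.

Lemma minors_ideal_det (f : 'I_k -> 'I_m) (g : 'I_k -> 'I_n) :
  minors_ideal k A (\det (mxsub f g A)).
Proof.
exists (fun f' g' => ((f' == finfun f) && (g' == finfun g))%:R).
rewrite (bigD1 (finfun f)) //= (bigD1 (finfun g)) //= !eqxx mul1r.
rewrite !big1 ?addr0.
- congr (\det _); apply/matrixP => i j; by rewrite !mxE !ffunE.
- by move=> f' /negPf ff'; rewrite big1 // => g' _; rewrite ff' mul0r.
- by move=> g' /negPf gg'; rewrite gg' mul0r.
Qed.
End Minors.

(** If the row [c] is selected twice, the determinant vanishes; otherwise expansion along the place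
    of [c] leaves cofactors that involve only rows of [A]. *)
Lemma minors_ideal_col_mx m n (A : 'M[A0]_(m, n)) (c : 'rV_n) (h : 'I_n -> 'I_(1 + m)) :
  minors_ideal n.-1 A (\det (rowsub h (col_mx c A))).
Proof.
case: n A c h => [|n] A c h.
  have f : 'I_0 -> 'I_m by case=> i; rewrite ltn0.
  have -> : rowsub h (col_mx c A) = mxsub f id A by apply/matrixP => -[].
  exact: minors_ideal_det.
(* When [c] is not selected at all, [i0] is the default [ord0]; expanding along any row is then good
   enough. *)
pose i0 := odflt ord0 [pick i | h i == lshift m ord0].
have [/existsP[i1 /andP[i1i0 /eqP hi1]]|/existsPn nex] :=
  boolP [exists i, (i != i0) && (h i == lshift m ord0)].
  have hi0 : h i0 = lshift m ord0.
    by rewrite /i0; case: pickP => /= [i /eqP//|/(_ i1)]; rewrite hi1 eqxx.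
  rewrite (determinant_alternate i1i0); last by move=> j; rewrite !mxE hi1 hi0.
  exists (fun _ _ => 0); rewrite big1 // => f _; rewrite big1 // => g _.
  by rewrite mul0r.
have hP i : i != i0 -> {f : 'I_m | h i = rshift 1 f}.
  move=> ii0; case: (splitP (h i)) => [j hj|j hj]; last by exists j; apply/val_inj.
  exfalso; have := nex i; rewrite ii0 /= => /eqP; apply; apply/val_inj.
  by rewrite /= hj (ord1 j).
have lN k : lift i0 k != i0 by rewrite eq_sym neq_lift.
pose f' k : 'I_m := sval (hP (lift i0 k) (lN k)).
have f'E k : h (lift i0 k) = rshift 1 (f' k) := svalP (hP _ (lN k)).
rewrite (expand_det_row _ i0); apply: minors_ideal_sum => j.
apply/minors_idealM/minors_idealM.
have -> : row' i0 (col' j (rowsub h (col_mx c A))) = mxsub f' (lift j) A.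
  apply/matrixP => a b; by rewrite !mxE f'E (unsplitK (inr _)).
exact: minors_ideal_det.
Qed.

Lemma cyclic_minors_ideal (M : lmodType A0) (g0 : M) m n (A : 'M[A0]_(m, n)) :
  (forall x, exists a, x = a *: g0) -> presents M A ->
  [set: A0] = minors_ideal n.-1 A.
Proof.
move=> cyc [g [gen rel]].
pose d j := sval (cid (cyc (g j))).
have dE j : g j = d j *: g0 := svalP (cid (cyc (g j))).
have [c cE] := gen g0.
have relj (j : 'I_n) : exists b : 'rV_m, delta_mx 0 j - d j *: c = b *m A.
  apply/rel; under eq_bigr => k _ do rewrite !mxE scalerBl -scalerA.
  rewrite sumrB -scaler_sumr -cE -dE (bigD1 j) //= !eqxx scale1r big1 ?addr0 ?subrr //.
  by move=> k /negPf kj; rewrite kj scale0r.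
pose b j := sval (cid (relj j)).
have bE j : delta_mx 0 j - d j *: c = b j *m A := svalP (cid (relj j)).
pose D : 'cV[A0]_n := \col_j d j.
pose B : 'M[A0]_(n, m) := \matrix_(j, i) b j 0 i.
(* The relations [e_j - d_j c = b_j A] say that the identity matrix is D c + B A. *)
have E : row_mx D B *m col_mx c A = 1%:M.
  rewrite mul_row_col; apply/row_matrixP => j.
  rewrite row1 raddfD /= !row_mul.
  have -> : row j B = b j by apply/rowP => i; rewrite !mxE.
  rewrite -bE addrC; apply/rowP => k; rewrite !mxE big_ord1 !mxE.
  by rewrite subrK.
apply/seteqP; split=> // x _; rewrite -[x]mulr1; apply: minors_idealM.
rewrite -(det1 A0 n) -E det_mulmx_rect; apply: minors_ideal_sum => h.
exact/minors_idealM/minors_ideal_col_mx.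
Qed.

End Fitting.

(** * Hilbert's basis theorem for Z[X] *)

Section Noetherian.

Lemma int_subgroup_principal (P : int -> Prop) : P 0 ->
  (forall a b, P a -> P b -> P (a - b)) ->
  exists2 c, P c & forall a, P a -> exists k, a = k * c.
Proof.
move=> P0 PB.
have PN a : P a -> P (- a) by move=> /(PB _ _ P0); rewrite sub0r.
have PD a b : P a -> P b -> P (a + b) by move=> Pa /PN Pb; rewrite -[b]opprK; apply: PB.
have PM (k : int) a : P a -> P (k * a).
  move=> Pa; elim/int_ind: k => [|n IH|n IH]; rewrite ?mul0r //.
    by rewrite -addn1 PoszD mulrDl mul1r; apply: PD.
  by rewrite -addn1 PoszD opprD mulrDl mulN1r; apply: PB.
have [[n [n0 Pn]]|none] := pselect (exists n : nat, (0 < n)%N /\ P n%:Z); last first.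
  exists 0 => // a Pa; exists 0; rewrite mul0r; apply: contrapT => a0; apply: none.
  exists `|a|%N; split; first by rewrite absz_gt0; apply/eqP.
  by case: (intP a) Pa => // k /PN; rewrite ?opprK.
have ex : exists n, (0 < n)%N && `[< P n%:Z >] by exists n; rewrite n0; apply/asboolP.
case: (ex_minnP ex) => c /andP[c0 /asboolP Pc] cmin.
exists c%:Z => // a Pa; exists (a %/ c%:Z)%Z.
have cN0 : c%:Z != 0 by rewrite eqz_nat -lt0n.
have E := divz_eq a c%:Z.
have r0 := modz_ge0 a cN0; have rc := ltz_pmod a (c0 : (0 < c%:Z)).
rewrite {1}E; suff -> : (a %% c%:Z)%Z = 0 by rewrite addr0.
apply/eqP; apply: contraPT r0 => rN0.
have Pr : P (a %% c%:Z)%Z.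
  have -> : (a %% c%:Z)%Z = a - (a %/ c%:Z)%Z * c%:Z by rewrite {2}E addrAC subrr add0r.
  by apply: PB => //; apply: PM.
move=> r0; have [r rE] : exists r : nat, (a %% c%:Z)%Z = r by case: (a %% c%:Z)%Z r0 => // r _; exists r.
rewrite rE in Pr rc rN0.
have /cmin : (0 < r)%N && `[< P r%:Z >] by apply/andP; split; [rewrite lt0n | apply/asboolP].
by move: rc; rewrite ltz_nat ltnNge => /negP.
Qed.

Variable I : {poly int} -> Prop.
Hypotheses (I0 : I 0) (IB : forall p q, I p -> I q -> I (p - q)).
Hypothesis IM : forall q p, I p -> I (q * p).

(** The coefficients in degree d of members of degree at most d form a subgroup [L d] of Z,
    increasing with d because of multiplication by X. The union of all [L d] is principal, and its
    generator is attained by some [f] in degree [D]. In degrees below [D] one polynomial [g d] per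
    degree suffices, and from [D] on a multiple of [f] cancels the leading term. *)
Lemma poly_int_noetherian : exists m (s : 'I_m -> {poly int}),
  (forall i, I (s i)) /\
  forall p, I p -> exists q : 'I_m -> {poly int}, p = \sum_i q i * s i.
Proof.
pose L d a := exists p, [/\ I p, (size p <= d.+1)%N & p`_d = a].
have L0 d : L d 0 by exists 0; rewrite size_poly0 coef0.
have LB d a b : L d a -> L d b -> L d (a - b).
  move=> [p [Ip sp <-]] [q [Iq sq <-]]; exists (p - q); split; rewrite ?coefB //.
    exact: IB.
  by rewrite (leq_trans (size_polyD _ _)) // geq_max size_polyN sp.
have LS d e a : (d <= e)%N -> L d a -> L e a.
  move=> de [p [Ip sp <-]]; exists ('X^(e - d) * p); split; first exact: IM.
    have [->|p0] := eqVneq p 0; first by rewrite mulr0 size_poly0.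
    by rewrite mulrC size_mulXn //; lia.
  by rewrite mulrC coefMXn ltnNge leq_subr /= subKn.
have [c [D [f [If sf fD]]] cP] : exists2 c, (exists d, L d c) &
    forall a, (exists d, L d a) -> exists k, a = k * c.
  apply: int_subgroup_principal; first by exists 0%N.
  move=> a b [d da] [e eb]; exists (maxn d e); apply: LB.
    by apply: LS da; rewrite leq_maxl.
  by apply: LS eb; rewrite leq_maxr.
have prin d : exists p, [/\ I p, (size p <= d.+1)%N & forall a, L d a -> exists k, a = k * p`_d].
  have [c' [p [Ip sp <-]] pP] := int_subgroup_principal (L0 d) (LB d).
  by exists p.
pose g d := sval (cid (prin d)).
have gP d : [/\ I (g d), (size (g d) <= d.+1)%N & forall a, L d a -> exists k, a = k * (g d)`_d].
  by rewrite /g; case: cid.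
pose s (i : 'I_D.+1) := if i == ord_max then f else g i.
exists D.+1, s; split=> [i|p].
  by rewrite /s; case: eqP => // _; case: (gP i).
have [n] := ubnP (size p); elim: n p => // n IH p; rewrite ltnS => sp Ip.
have step (i : 'I_D.+1) (r : {poly int}) : (size (p - r * s i)%R < n)%N -> I (s i) ->
    exists q : 'I_D.+1 -> {poly int}, p = \sum_i q i * s i.
  move=> rp Is; have [q qE] := IH _ rp (IB Ip (IM r Is)).
  exists (fun j => q j + (if j == i then r else 0)).
  under eq_bigr => j _ do rewrite mulrDl.
  rewrite big_split -qE /= [X in _ + X](bigD1 i) //= eqxx big1 ?addr0 ?subrK //.
  by move=> j /negPf ->; rewrite mul0r.
have [->|p0] := eqVneq p 0; first by exists (fun=> 0); rewrite big1 // => j _; rewrite mul0r.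
case: n => [|n] in sp IH step *; first by move: p0; rewrite -size_poly_leq0 sp.
have low (q r : {poly int}) : (size q <= n.+1)%N -> (size (r * q)%R <= n.+1)%N ->
    p`_n = (r * q)`_n -> (size (p - r * q)%R < n.+1)%N.
  move=> sq srq E; rewrite ltnS; apply/leq_sizeP => j; rewrite leq_eqVlt => /predU1P[<-|nj].
    by rewrite coefB E subrr.
  by rewrite coefB !nth_default ?subrr // (leq_trans _ nj).
have [nD|Dn] := ltnP n D.
  have [_ sg /(_ p`_n)[|k kE]] := gP n; first by exists p.
  have nD' : (n < D.+1)%N by rewrite ltnW.
  have sE : s (Ordinal nD') = g n.
    by rewrite /s; case: eqP => // /(congr1 val) /= nE; move: nD; rewrite nE ltnn.
  apply: (step (Ordinal nD') k%:P); rewrite sE; last by case: (gP n).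
  apply: low => //; last by rewrite coefCM.
  by rewrite mul_polyC (leq_trans (size_scale_leq _ _)).
have [|k kE] := cP p`_n; first by exists n, p.
have sE : s ord_max = f by rewrite /s eqxx.
have sX : (size (k%:P * 'X^(n - D) * f)%R <= n.+1)%N.
  rewrite -mulrA mul_polyC (leq_trans (size_scale_leq _ _)) //.
  have [->|f0] := eqVneq f 0; first by rewrite mulr0 size_poly0.
  by rewrite mulrC size_mulXn //; lia.
apply: (step ord_max (k%:P * 'X^(n - D))); rewrite sE //.
apply: low => //; first by lia.
by rewrite -mulrA coefCM ['X^_ * _]mulrC coefMXn ltnNge leq_subr /= subKn // fD.
Qed.
End Noetherian.

(** * Presentations of cyclic modules over the Laurent polynomials *)

Section CyclicPresentation.
Local Notation "p %:F" := (@FracField.tofrac _ p).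

Lemma laurent_of_poly_subproof p : p%:F \in is_laurent.
Proof. by apply/asboolP; exists 0, p; rewrite expr0 mulr1. Qed.

Definition laurent_of_poly p : laurent := Laurent (laurent_of_poly_subproof p).

Lemma Xfrac_neq0 : ('X : {poly int})%:F != 0.
Proof. by rewrite tofrac_eq0 polyX_eq0. Qed.

Lemma laurentVX_subproof : ('X)%:F^-1 \in is_laurent.
Proof. by apply/asboolP; exists 1, 1; rewrite expr1 mulVf // Xfrac_neq0. Qed.

Definition laurentVX : laurent := Laurent laurentVX_subproof.

Lemma laurentXV : laurentX * laurentVX = 1.
Proof. by apply/val_inj; rewrite /= mulfV // Xfrac_neq0. Qed.

Lemma laurent_decomp (x : laurent) : exists n p,
  x * laurentX ^+ n = laurent_of_poly p.
Proof.
have /asboolP[n [p E]] := laurentP x; exists n, p; apply/val_inj.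
by rewrite rmorphM rmorphXn /= -E; rewrite tofracXn.
Qed.

(** Every Laurent polynomial becomes a polynomial after multiplication by the unit t^n, so
    generators of the annihilator of [g0] in Z[X] also generate its annihilator in Z[t,t^-1]. *)
Lemma cyclic_presents (M : lmodType laurent) (g0 : M) :
  (forall x, exists a, x = a *: g0) ->
  exists m (A : 'M[laurent]_(m, 1)), presents M A.
Proof.
move=> cyc; pose I p := laurent_of_poly p *: g0 = 0.
have lopB p q : laurent_of_poly (p - q) = laurent_of_poly p - laurent_of_poly q.
  by apply/val_inj; rewrite rmorphB /= tofracB.
have lopM p q : laurent_of_poly (p * q) = laurent_of_poly p * laurent_of_poly q.
  by apply/val_inj; rewrite rmorphM /= tofracM.
have lop0 : laurent_of_poly 0 = 0 by apply/val_inj; rewrite rmorph0 /= tofrac0.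
have lopD p q : laurent_of_poly (p + q) = laurent_of_poly p + laurent_of_poly q.
  by apply/val_inj; rewrite rmorphD /= tofracD.
have [||q p Ip|m [s [Is sP]]] := @poly_int_noetherian I.
- by rewrite /I lop0 scale0r.
- by move=> p q Ip Iq; rewrite /I lopB scalerBl Ip Iq subrr.
- by rewrite /I lopM -scalerA Ip scaler0.
exists m, (\matrix_(i, j) laurent_of_poly (s i)), (fun=> g0); split=> [x|c].
  by have [a ->] := cyc x; exists (const_mx a); rewrite big_ord1 mxE.
rewrite big_ord1; split=> [c0|[b ->]]; last first.
  rewrite mxE scaler_suml big1 // => i _; rewrite mxE -scalerA.
  by have /= := Is i; rewrite /I => ->; rewrite scaler0.
have [n [p cE]] := laurent_decomp (c 0 0).
have [|q qE] := sP p; first by rewrite /I -cE mulrC -scalerA c0 scaler0.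
exists (\row_i (laurentVX ^+ n * laurent_of_poly (q i))).
apply/rowP => j; rewrite ord1 mxE.
transitivity (laurentVX ^+ n * laurent_of_poly p).
  by rewrite -cE mulrCA -exprMn mulrC [laurentVX * _]mulrC laurentXV expr1n mul1r.
rewrite qE (big_morph _ lopD lop0) mulr_sumr; apply: eq_bigr => i _.
by rewrite !mxE lopM mulrA.
Qed.

Lemma cyclic_second_elementary_ideal (M : lmodType laurent) (g0 : M) :
  (forall x, exists a, x = a *: g0) ->
  is_second_elementary_ideal M [set: laurent].
Proof.
move=> cyc; split; first by have [m [A]] := cyclic_presents cyc; exists m, 1%N, A.
by move=> m n A; apply: cyclic_minors_ideal.
Qed.
End CyclicPresentation.

(** * Paths and homotopies *)

Lemma within_continuous_comp_in (T U V : topologicalType) (A : set T) (B : set U)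
    (f : T -> U) (g : U -> V) :
  {within A, continuous f} -> (forall a, A a -> B (f a)) ->
  {within B, continuous g} -> {within A, continuous (g \o f)}.
Proof.
move=> /subspace_continuousP cf fAB /subspace_continuousP cg.
apply/subspace_continuousP => x Ax W /(cg _ (fAB _ Ax)) /= /(cf x Ax) /= H.
rewrite !nbhs_simpl /within /= in H *.
by apply: filterS (H) => y Hy Ay; apply: Hy => //; apply: fAB.
Qed.

Lemma within_continuousS (T U V : topologicalType) (A : set T)
    (f : T -> U) (g : U -> V) :
  {within A, continuous f} -> continuous g -> {within A, continuous (g \o f)}.
Proof.
move=> /subspace_continuousP cf cg; apply/subspace_continuousP => x Ax.
by apply: cvg_comp (cf _ Ax) _; apply: cg.
Qed.

Lemma eq_within_continuous (T U : topologicalType) (A : set T) (f g : T -> U) :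
  {in A, f =1 g} -> {within A, continuous f} -> {within A, continuous g}.
Proof. exact: subspace_eq_continuous. Qed.

Lemma continuous_pair (T U V : topologicalType) (f : T -> U) (g : T -> V) :
  continuous f -> continuous g -> continuous (fun x => (f x, g x)).
Proof. move=> cf cg x; exact: (cvg_pair (cf x) (cg x)). Qed.

Section Interval.
Variable R : realType.

Lemma in01 (s : R) : (s \in `[0, 1]) = (0 <= s <= 1).
Proof. by rewrite in_itv. Qed.

(** Compactness of an interval in the form used for all subdivision arguments: what holds on small
    intervals near each point and passes to adjacent unions holds on the whole. The proof takes the
    supremum of the right ends reached from [l]. *)
Lemma interval_induction (P : R -> R -> Prop) (l r : R) : l <= r ->
  (forall x, l <= x <= r -> exists2 e, 0 < e &
     forall a b, l <= a -> a <= b -> b <= r -> `|a - x| < e -> `|b - x| < e -> P a b) ->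
  (forall a b c, l <= a -> a <= b -> b <= c -> c <= r -> P a b -> P b c -> P a c) ->
  P l r.
Proof.
move=> lr loc glue.
pose E := [set b | l <= b <= r /\ P l b].
have El : E l.
  split; first by rewrite lexx.
  by have [|e e0 H] := loc l; [rewrite lexx | apply: H; rewrite ?subrr ?normr0].
have ubE : ubound E r by move=> b [/andP[]].
have supE : has_sup E by split; [exists l | exists r].
set s := sup E.
have ls : l <= s by apply: ub_le_sup El; exists r.
have sr : s <= r by apply: sup_le_ub => //; exists l.
have [|e e0 He] := loc s; first by rewrite ls sr.
have [b [/andP[lb br] Pb] sb] := sup_adherent e0 supE.
have bs : b <= s by apply: ub_le_sup; [exists r | split; rewrite ?lb].
have key c : s <= c -> c <= r -> c < s + e -> P l c.
  move=> sc cr ce; apply: (glue _ b) => //; first exact: le_trans sc.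
  apply: He => //; first exact: le_trans sc.
    by rewrite ler0_norm ?subr_le0 // opprB; move: sb; rewrite -/s; lra.
  by rewrite ger0_norm ?subr_ge0 //; lra.
have [se|se] := leP r (s + e / 2); first by apply: key => //; lra.
have : s + e / 2 <= s; last by lra.
apply: ub_le_sup; first by exists r.
by split; [lra | apply: key; lra].
Qed.

End Interval.

Section Paths.
Variable R : realType.
Implicit Types (T U : topologicalType).

Lemma line_continuous (a b : R) : continuous (fun s : R => a + (b - a) * s).
Proof.
by move=> s; apply: cvgD; [exact: cvg_cst | apply: cvgMr; exact: cvg_id].
Qed.

Lemma is_path_sub T (X Y : set T) x y (f : R -> T) : X `<=` Y -> is_path X x y f -> is_path Y x y f.
Proof. by move=> XY [cf f0 f1 Xf]; split=> // s /Xf/XY. Qed.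

Lemma is_path_cst T (X : set T) x : X x -> is_path X x x (cst x : R -> T).
Proof. by move=> Xx; split=> //; apply: continuous_subspaceT => s; apply: cvg_cst. Qed.

Lemma is_path_reverse T (X : set T) x y (f : R -> T) : is_path X x y f -> is_path X y x (reverse f).
Proof.
move=> [cf f0 f1 Xf]; split; rewrite /reverse ?subr0 ?subrr //.
  apply: (@within_continuous_comp_in R R T [set` `[0, 1]] [set` `[0, 1]] (fun s : R => 1 - s) f _ _ cf).
    apply: continuous_subspaceT => s; apply: cvgB; [exact: cvg_cst|exact: cvg_id].
  by move=> a /=; rewrite !in_itv /=; lra.
by move=> s; rewrite in01 => s01; apply: Xf; rewrite in01; lra.
Qed.

Lemma is_path_concat T (X : set T) x y z (f g : R -> T) :
  is_path X x y f -> is_path X y z g -> is_path X x z (concat f g).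
Proof.
move=> [cf f0 f1 Xf] [cg g0 g1 Xg]; split; rewrite /concat.
- have -> : [set` `[0, 1]] = [set` `[0, 2^-1]] `|` [set` `[2^-1, (1 : R)]].
    by apply/seteqP; split=> s /=; rewrite !in_itv /=; lra.
  apply: withinU_continuous; [exact: interval_closed..| |].
    apply: (@eq_within_continuous _ _ _ (f \o (fun s => 2 * s))).
      by move=> s; rewrite inE /= in_itv /= => /andP[_ ->].
    apply: (@within_continuous_comp_in R R T _ [set` `[0, 1]] (fun s => 2 * s) f _ _ cf).
      apply: continuous_subspaceT => s; apply: cvgMr; exact: cvg_id.
    by move=> s /=; rewrite !in_itv /=; lra.
  apply: (@eq_within_continuous _ _ _ (g \o (fun s => 2 * s - 1))).
    move=> s; rewrite inE /= in_itv /= => /andP[s2 _]; case: ifP => // s2'.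
    have -> : s = 2^-1 by apply/eqP; rewrite eq_le s2 s2'.
    by rewrite divff // subrr g0 f1.
  apply: (@within_continuous_comp_in R R T _ [set` `[0, 1]] (fun s => 2 * s - 1) g _ _ cg).
    apply: continuous_subspaceT => s; apply: cvgB; last exact: cvg_cst.
    by apply: cvgMr; exact: cvg_id.
  by move=> s /=; rewrite !in_itv /=; lra.
- by rewrite mulr0 invr_ge0 ler0n.
- rewrite ifF; last by apply/negbTE; rewrite -ltNge; lra.
  by have -> : 2 * 1 - 1 = 1 :> R by lra.
- move=> s; rewrite in01 => s01; case: ifPn => s2; [apply: Xf|apply: Xg]; rewrite in01; lra.
Qed.

Lemma is_path_comp T U (X : set T) (Y : set U) x y (f : R -> T) (g : T -> U) :
  {within X, continuous g} -> (forall a, X a -> Y (g a)) ->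
  is_path X x y f -> is_path Y (g x) (g y) (g \o f).
Proof.
move=> cg gXY [cf f0 f1 Xf]; split=> /=; rewrite ?f0 ?f1 //; last by move=> s /Xf/gXY.
by apply: within_continuous_comp_in cg => // a; apply: Xf.
Qed.

Lemma path_homotopic_comp T U (X : set T) (Y : set U) x y (f f' : R -> T) (g : T -> U) :
  {within X, continuous g} -> (forall a, X a -> Y (g a)) ->
  path_homotopic X x y f f' -> path_homotopic Y (g x) (g y) (g \o f) (g \o f').
Proof.
move=> cg gXY [H [cH Hf Hx XH]]; exists (g \o H); split.
- by apply: within_continuous_comp_in cg => // -[a b] [/= a1 b1]; apply: XH.
- by move=> s /Hf[/= -> ->].
- by move=> r /Hx[/= -> ->].
- by move=> r s r1 s1; apply/gXY/XH.
Qed.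

Lemma path_homotopic_path T (X : set T) x y (f g : R -> T) :
  path_homotopic X x y f g -> is_path X x y f /\ is_path X x y g.
Proof.
move=> [H [cH Hf Hx XH]].
have mem0 : (0 : R) \in `[0, 1] by rewrite in01 lexx ler01.
have mem1 : (1 : R) \in `[0, 1] by rewrite in01 lexx ler01.
have [H00 H01] := Hx 0 mem0; have [H10 H11] := Hx 1 mem1.
have [F00 F10] := Hf 0 mem0; have [F01 F11] := Hf 1 mem1.
have key (r : R) : r \in `[0, 1] -> {within `[0, 1], continuous (fun s => H (r, s))}.
  move=> r1; apply: (@within_continuous_comp_in R (R * R)%type T _ _ (fun s => (r, s)) H _ _ cH);
    last by move=> s.
  apply: continuous_subspaceT; apply: continuous_pair => s; [exact: cvg_cst|exact: cvg_id].
split; split.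
- by apply: eq_within_continuous (key 0 mem0) => s; rewrite inE => /Hf[].
- by rewrite -F00.
- by rewrite -F01.
- by move=> s s1; have [<- _] := Hf s s1; apply: XH.
- by apply: eq_within_continuous (key 1 mem1) => s; rewrite inE => /Hf[].
- by rewrite -F10.
- by rewrite -F11.
- by move=> s s1; have [_ <-] := Hf s s1; apply: XH.
Qed.

Definition convex (V : normedModType R) (C : set V) :=
  forall p q (s : R), C p -> C q -> 0 <= s <= 1 -> C ((1 - s) *: p + s *: q).

(** The straight-line homotopy in [C], followed by [F]. It serves for reparametrizations ([C] an
    interval), for boundaries of squares, and for convex pieces of space. *)
Lemma convex_homotopy (V : normedModType R) T (C : set V) (X : set T) (F : V -> T)
    (P Q : R -> V) :
  convex C -> {within C, continuous F} -> (forall v, C v -> X (F v)) ->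
  {within `[0, 1], continuous P} -> {within `[0, 1], continuous Q} ->
  (forall s, 0 <= s <= 1 -> C (P s)) -> (forall s, 0 <= s <= 1 -> C (Q s)) ->
  P 0 = Q 0 -> P 1 = Q 1 ->
  path_homotopic X (F (P 0)) (F (P 1)) (F \o P) (F \o Q).
Proof.
move=> cvC cF CX cP cQ CP CQ PQ0 PQ1.
exists (F \o (fun z : R * R => (1 - z.1) *: P z.2 + z.1 *: Q z.2)); split.
- apply: within_continuous_comp_in cF; last first.
    by move=> [r s] [/=]; rewrite !in_itv /= => r1 s1; apply: cvC => //; [exact: CP|exact: CQ].
  have c1 : {within `[0, 1] `*` `[0, 1], continuous (fst : R * R -> R)}.
    by apply: continuous_subspaceT => z; apply: cvg_fst.
  have c2 : {within `[0, 1] `*` `[0, 1], continuous (snd : R * R -> R)}.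
    by apply: continuous_subspaceT => z; apply: cvg_snd.
  have h2 : forall a : R * R, ([set` `[0, 1]] `*` [set` `[0, 1]]) a -> [set` `[0, 1]] a.2 by move=> a [].
  have /subspace_continuousP kP := within_continuous_comp_in c2 h2 cP.
  have /subspace_continuousP kQ := within_continuous_comp_in c2 h2 cQ.
  move/subspace_continuousP : c1 => c1.
  apply/subspace_continuousP => z Az; apply: cvgD; apply: cvgZ.
  + by apply: cvgB; [exact: cvg_cst | exact: c1].
  + exact: kP.
  + exact: c1.
  + exact: kQ.
- by move=> s _ /=; rewrite subr0 subrr !scale1r !scale0r addr0 add0r.
- by move=> r _ /=; rewrite -PQ0 -PQ1 -!scalerDl subrK !scale1r.
- move=> r s; rewrite !in01 => r1 s1; apply/CX/cvC => //; [exact: CP|exact: CQ].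
Qed.

Lemma convex01 : convex ([set` `[0, 1]] : set R).
Proof.
move=> p q s /=; rewrite !in_itv /= => p1 q1 s1.
by rewrite /GRing.scale /=; nra.
Qed.

Lemma convex01X2 : convex ([set` `[0, 1]] `*` [set` `[0, 1]] : set (R * R)).
Proof.
move=> p q s [p1 p2] [q1 q2] s1; split=> /=.
  exact: (convex01 p1 q1 s1).
exact: (convex01 p2 q2 s1).
Qed.

(** The case [b < a] is meaningful and makes reversed paths subpaths. *)
Definition subpath T (f : R -> T) (a b : R) : R -> T := fun s => f (a + (b - a) * s).

Lemma subpath01 T (f : R -> T) : subpath f 0 1 = f.
Proof. by apply/funext => s; rewrite /subpath subr0 mul1r add0r. Qed.

Lemma line01 (a b s : R) : 0 <= a <= 1 -> 0 <= b <= 1 -> 0 <= s <= 1 ->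
  0 <= a + (b - a) * s <= 1.
Proof. nra. Qed.

Lemma is_path_line (a b : R) : 0 <= a <= 1 -> 0 <= b <= 1 ->
  is_path ([set` `[0, 1]] : set R) a b (fun s => a + (b - a) * s).
Proof.
move=> a1 b1; split; rewrite ?mulr0 ?addr0 ?mulr1 ?subrKC //.
  by apply: continuous_subspaceT; apply: line_continuous.
by move=> s; rewrite in01 => s1; rewrite /= in_itv /=; apply: line01.
Qed.

Lemma is_path_subpath T (X : set T) x y (f : R -> T) a b :
  0 <= a <= 1 -> 0 <= b <= 1 -> is_path X x y f -> is_path X (f a) (f b) (subpath f a b).
Proof.
move=> a1 b1 [cf f0 f1 Xf].
by apply: (is_path_comp cf) (is_path_line a1 b1) => s; apply: Xf.
Qed.

End Paths.

(** * Generators of a fundamental group from an open cover *)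

Section PathFunctor.
Variables (R : realType) (T : topologicalType) (X : set T) (G : groupType).
Variable nu : (R -> T) -> G.

(** A functor from the fundamental groupoid of [X] to the group [G], expressed on representing
    paths. *)
Definition path_functor : Prop :=
  (forall x y f g, path_homotopic X x y f g -> nu f = nu g) /\
  (forall x y z f g, is_path X x y f -> is_path X y z g ->
     nu (concat f g) = (nu f * nu g)%g).

Hypothesis nuF : path_functor.

Lemma functor_homotopic x y f g : path_homotopic X x y f g -> nu f = nu g.
Proof. exact: nuF.1. Qed.

Lemma functor_concat x y z f g : is_path X x y f -> is_path X y z g ->
  nu (concat f g) = (nu f * nu g)%g.
Proof. exact: nuF.2. Qed.

Lemma functor_cst x : X x -> nu (cst x) = 1%g.
Proof.
move=> Xx; apply: (mulgI (nu (cst x))); rewrite mulg1.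
rewrite -(functor_concat (is_path_cst R Xx) (is_path_cst R Xx)); congr nu.
by apply/funext => s; rewrite /concat; case: ifP.
Qed.

Lemma functor_reparam x y (f : R -> T) (phi psi : R -> R) a b :
  is_path X x y f -> is_path (`[0, 1]%classic : set R) a b phi -> is_path (`[0, 1]%classic : set R) a b psi ->
  nu (f \o phi) = nu (f \o psi).
Proof.
move=> [cf _ _ Xf] [cp p0 p1 p01] [cq q0 q1 q01].
apply: (@functor_homotopic (f (phi 0)) (f (phi 1))).
apply: (convex_homotopy (@convex01 R) cf Xf cp cq); rewrite ?p0 ?q0 ?p1 ?q1 //.
Qed.

(** Both sides come from paths in the convex set [0, 1] with the same ends; the three points may
    come in any order, and the case [c = a] yields inverses. *)
Lemma functor_subpath x y f a b c : is_path X x y f ->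
  0 <= a <= 1 -> 0 <= b <= 1 -> 0 <= c <= 1 ->
  nu (subpath f a c) = (nu (subpath f a b) * nu (subpath f b c))%g.
Proof.
move=> Pf a1 b1 c1.
rewrite -(functor_concat (is_path_subpath a1 b1 Pf) (is_path_subpath b1 c1 Pf)).
have -> : concat (subpath f a b) (subpath f b c) =
    f \o concat (fun s => a + (b - a) * s) (fun s => b + (c - b) * s).
  by apply/funext => s; rewrite /concat /=; case: ifP.
apply: (functor_reparam Pf (is_path_line a1 c1)).
exact: is_path_concat (is_path_line a1 b1) (is_path_line b1 c1).
Qed.

Lemma is_path_in01 x y f (s : R) : is_path X x y f -> 0 <= s <= 1 -> X (f s).
Proof. by move=> [_ _ _ Xf] s1; apply: Xf; rewrite in01. Qed.

Lemma functor_reverse x y f : is_path X x y f -> nu (reverse f) = (nu f)^-1%g.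
Proof.
move=> Pf; have z1 : 0 <= (0 : R) <= 1 by rewrite lexx ler01.
have o1 : 0 <= (1 : R) <= 1 by rewrite lexx ler01.
have := functor_subpath Pf z1 o1 z1; rewrite subpath01.
have -> : subpath f 0 0 = cst (f 0) by apply/funext => s; rewrite /subpath subrr mul0r addr0.
have -> : subpath f 1 0 = reverse f.
  by apply/funext => s; rewrite /subpath /reverse sub0r mulN1r.
rewrite functor_cst; last exact: is_path_in01 Pf z1.
by move=> E; apply: (mulgI (nu f)); rewrite -E mulgV.
Qed.

Lemma is_path_ends (W : set T) x y (f : R -> T) : is_path W x y f -> W x /\ W y.
Proof. by move=> [_ <- <- H]; split; apply: H; rewrite in01 lexx ler01. Qed.

Variables (x0 : T) (S : G -> Prop).
Hypotheses (S1 : S 1%g) (SM : forall a b, S a -> S b -> S (a * b)%g).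
Hypothesis SV : forall a, S a -> S a^-1%g.

(* The class of f after both endpoints have been joined to the base point by   *)
(* the paths c.                                                                *)
Definition transport (c : T -> R -> T) q q' f : G :=
  (nu (c q) * nu f * (nu (c q'))^-1)%g.

(** The connecting paths [c q] run in [X] and may leave [W]; only the tested paths stay in [W].
    Tameness says that [W] contributes nothing outside [S]. *)
Definition tame (W : set T) (c : T -> R -> T) : Prop :=
  (forall q, W q -> is_path X x0 q (c q)) /\
  (forall q q' f, is_path W q q' f -> S (transport c q q' f)).

(** A path is cut into small pieces; in the product of their transports the connecting paths to the
    cut points cancel. *)
Lemma tame_local W c : W `<=` X ->
  (forall q, W q -> is_path X x0 q (c q)) ->
  (forall w, W w -> exists U, [/\ open U, U w &
    forall q q' f, is_path (W `&` U) q q' f -> S (transport c q q' f)]) ->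
  tame W c.
Proof.
move=> WX cP loc; split=> // q q' f Pf; have [cf f0 f1 Wf] := Pf.
have PX := is_path_sub WX Pf.
have : S (transport c (f 0) (f 1) (subpath f 0 1)); last by rewrite f0 f1 subpath01.
apply: (@interval_induction R (fun a b => S (transport c (f a) (f b) (subpath f a b)))).
- exact: ler01.
- move=> s s1; have Ws : W (f s) by apply: Wf; rewrite in01.
  have [U [oU Us HU]] := loc _ Ws.
  move/subspace_continuousP : cf => /(_ s).
  rewrite /= in_itv /= => /(_ s1 U) H.
  have /H : nbhs (f s) U by exact: open_nbhs_nbhs.
  rewrite /= nbhs_simpl /within /= => /nbhs_ballP[e e0 He].
  exists e => // a b a0 ab b1 ae be.
  have near t : 0 <= t <= 1 -> `|t - s| < e -> U (f t).
    by move=> t1 te; apply: He; rewrite /= ?in_itv //= -ball_normE /= distrC.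
  have a1 : 0 <= a <= 1 by rewrite a0 (le_trans ab).
  have b1' : 0 <= b <= 1 by rewrite b1 (le_trans a0).
  apply: HU; have [g0 g1 g2 g3] := is_path_subpath a1 b1' Pf; split=> //.
  move=> t t1; split; first exact: g3.
  rewrite in01 in t1; apply: near; first exact: line01.
  move: ae be; rewrite !ltr_norml => /andP[? ?] /andP[? ?].
  by apply/andP; split; nra.
- move=> a b d a0 ab bd d1 Sab Sbd.
  have a1 : 0 <= a <= 1 by lra.
  have b1 : 0 <= b <= 1 by lra.
  have d1' : 0 <= d <= 1 by lra.
  have := SM Sab Sbd; rewrite /transport (functor_subpath PX a1 b1 d1').
  by rewrite !mulgA mulgVK.
Qed.

Definition functor_simple (U : set T) : Prop :=
  forall q q' f g, is_path U q q' f -> is_path U q q' g -> nu f = nu g.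

(** The generating half of van Kampen's theorem, allowing a disconnected intersection. New points
    are connected through [w0] inside [U]. Since [U] is simple, a path in it may be replaced by one
    that returns to [w0] and leaves again, so only the paths from [w0] to the components of the
    intersection can bring new values, and these are assumed to lie in [S]. *)
Lemma tame_add W U w0 c : open W -> open U -> W `<=` X -> U `<=` X ->
  tame W c -> functor_simple U -> W w0 -> U w0 ->
  (forall q, U q -> exists f : R -> T, is_path U w0 q f) ->
  (forall q, W q -> U q -> exists f : R -> T, is_path U w0 q f /\ S (transport c w0 q f)) ->
  exists2 c', tame (W `|` U) c' & forall q, W q -> c' q = c q.
Proof.
move=> oW oU WX UX [cP cS] simU Ww0 Uw0 conU WU.
pose c' q := if pselect (W q) then c q else
  if pselect (U q) is left Uq then concat (c w0) (sval (cid (conU q Uq))) else c q.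
have c'W q : W q -> c' q = c q by rewrite /c'; case: pselect.
have c'P q : (W `|` U) q -> is_path X x0 q (c' q).
  rewrite /c'; case: pselect => [Wq _|nW [//|Uq]]; first exact: cP.
  case: pselect => // Uq'; case: cid => f /= Pf.
  by apply: is_path_concat (cP _ Ww0) _; apply: is_path_sub Pf.
have star q : U q -> exists f : R -> T, is_path U w0 q f /\ S (transport c' w0 q f).
  move=> Uq; have [Wq|nW] := pselect (W q).
    by have [f [Pf Sf]] := WU _ Wq Uq; exists f; split; rewrite // /transport !c'W.
  have [f Pf c'E] : exists2 f : R -> T, is_path U w0 q f & c' q = concat (c w0) f.
    rewrite /c'; case: (pselect (W q)) => [//|nW']; case: (pselect (U q)) => // Uq'.
    by exists (sval (cid (conU q Uq'))) => //; apply: (svalP (cid (conU q Uq'))).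
  exists f; split=> //; rewrite /transport (c'W w0) // c'E.
  by rewrite (functor_concat (cP _ Ww0) (is_path_sub UX Pf)) mulgV.
exists c' => //; apply: tame_local => // [q [/WX|/UX]//|w [Ww|Uw]].
  exists W; split=> // q q' f Pf.
  have Pf' : is_path W q q' f by apply: is_path_sub Pf; apply: subIsetr.
  have [Wq Wq'] := is_path_ends Pf'.
  by rewrite /transport !c'W //; apply: cS.
exists U; split=> // q q' f Pf.
have Pf' : is_path U q q' f by apply: is_path_sub Pf; apply: subIsetr.
have [Uq Uq'] := is_path_ends Pf'.
have [g [Pg Sg]] := star q Uq; have [h [Ph Sh]] := star q' Uq'.
rewrite /transport; have -> : nu f = ((nu g)^-1 * nu h)%g.
  rewrite -(functor_reverse (is_path_sub UX Pg)).
  rewrite -(functor_concat (is_path_reverse (is_path_sub UX Pg)) (is_path_sub UX Ph)).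
  exact: simU Pf' (is_path_concat (is_path_reverse Pg) Ph).
have := SM (SV Sg) Sh; rewrite /transport !invgM invgK !mulgA.
by rewrite mulgVK.
Qed.

Lemma tame_add_connected W U w0 c : open W -> open U -> W `<=` X -> U `<=` X ->
  tame W c -> functor_simple U -> W w0 -> U w0 ->
  (forall q, U q -> exists f : R -> T, is_path U w0 q f) ->
  (forall q, W q -> U q -> exists f : R -> T, is_path (W `&` U) w0 q f) ->
  exists2 c', tame (W `|` U) c' & forall q, W q -> c' q = c q.
Proof.
move=> oW oU WX UX tW sU Ww Uw cU WU; apply: (tame_add oW oU WX UX tW sU Ww Uw cU) => q Wq Uq.
have [f Pf] := WU q Wq Uq; exists f; split; first exact: is_path_sub Pf.
by apply: tW.2; apply: is_path_sub Pf; exact: subIsetl.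
Qed.

End PathFunctor.

Inductive generated (G : groupType) (a b : G) : G -> Prop :=
| generated1 : generated a b 1%g
| generated_a : generated a b a
| generated_b : generated a b b
| generatedM x y : generated a b x -> generated a b y -> generated a b (x * y)%g
| generatedV x : generated a b x -> generated a b (x^-1)%g.

(** * Path-connected pieces, convex pieces, and pieces that can be pushed into convex ones *)

Section Connected.
Variables (R : realType) (T : topologicalType).
Implicit Types (W : set T).

Definition joined W p q := exists f : R -> T, is_path W p q f.

Lemma joined_trans W p q r : joined W p q -> joined W q r -> joined W p r.
Proof. by move=> [f Pf] [g Pg]; exists (concat f g); apply: is_path_concat Pf Pg. Qed.

Lemma joined_sym W p q : joined W p q -> joined W q p.
Proof. by move=> [f Pf]; exists (reverse f); apply: is_path_reverse. Qed.

Lemma joined_sub W W' p q : W `<=` W' -> joined W p q -> joined W' p q.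
Proof. by move=> WW' [f Pf]; exists f; apply: is_path_sub Pf. Qed.
End Connected.

Section Charts.
Variables (R : realType) (V : normedModType R) (T : topologicalType).
Variables (X : set T) (G : groupType) (nu : (R -> T) -> G).
Hypothesis nuF : path_functor X nu.
(* A chart identifying T with V, through which convexity is understood.        *)
Variables (th : T -> V) (thi : V -> T).
Hypotheses (cth : continuous th) (cthi : continuous thi) (thK : cancel th thi).
Hypothesis thiK : cancel thi th.

Lemma within_chart (A : set R) (f : R -> T) : {within A, continuous f} ->
  {within A, continuous (th \o f)}.
Proof. by move=> cf; apply: within_continuousS. Qed.

Lemma segment_path (C : set V) p q : convex C -> C (th p) -> C (th q) ->
  is_path (th @^-1` C) p q (fun s : R => thi ((1 - s) *: th p + s *: th q)).
Proof.
move=> cvC Cp Cq; split.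
- apply: continuous_subspaceT => s; apply: continuous_comp; last exact: cthi.
  apply: cvgD; apply: cvgZr_tmp; last exact: cvg_id.
  by apply: cvgB; [exact: cvg_cst|exact: cvg_id].
- by rewrite subr0 scale1r scale0r addr0 thK.
- by rewrite subrr scale1r scale0r add0r thK.
- by move=> s; rewrite in01 /= thiK => s1; apply: cvC.
Qed.

Lemma convex_joined (C : set V) p q : convex C -> C (th p) -> C (th q) ->
  joined R (th @^-1` C) p q.
Proof. by move=> cvC Cp Cq; eexists; apply: segment_path. Qed.

Lemma convex_simple (C : set V) : convex C -> th @^-1` C `<=` X ->
  functor_simple nu (th @^-1` C).
Proof.
move=> cvC CX q q' f g [cf f0 f1 Cf] [cg g0 g1 Cg].
have E h : h = thi \o (th \o h) :> (R -> T) by apply/funext => s /=; rewrite thK.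
rewrite [f]E [g]E; apply: (functor_homotopic nuF).
have CX' v : C v -> X (thi v) by move=> Cv; apply: CX; rewrite /= thiK.
have cthi' : {within C, continuous thi} by apply: continuous_subspaceT.
apply: (convex_homotopy cvC cthi' CX' (within_chart cf) (within_chart cg)) => /=.
- by move=> s s1; apply: Cf; rewrite in01.
- by move=> s s1; apply: Cg; rewrite in01.
- by rewrite f0 g0.
- by rewrite f1 g1.
Qed.

(** In the convex square, one edge is homotopic to the way round the other three. *)
Lemma functor_square (F : R * R -> T) :
  {within [set` `[0, 1]] `*` [set` `[0, 1]], continuous F} ->
  (forall z, ([set` `[0, 1]] `*` [set` `[0, 1]]) z -> X (F z)) ->
  nu (fun s => F (0, s)) = (nu (fun s => F (s, 0%R)) * nu (fun s => F (1%R, s)) *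
    (nu (fun s => F (s, 1%R)))^-1)%g.
Proof.
move=> cF FX; set Sq := [set` `[0, 1]] `*` [set` `[0, 1]] in cF FX.
have m0 : [set` `[0, 1]] (0 : R) by rewrite /= in_itv /= lexx ler01.
have m1 : [set` `[0, 1]] (1 : R) by rewrite /= in_itv /= lexx ler01.
have P0 : is_path Sq (0, 0) (0, 1) (fun s : R => (0 : R, s)).
  by split=> //; apply: continuous_subspaceT; apply: continuous_pair => s; [exact: cvg_cst|exact: cvg_id].
have P1 : is_path Sq (1, 0) (1, 1) (fun s : R => (1 : R, s)).
  by split=> //; apply: continuous_subspaceT; apply: continuous_pair => s; [exact: cvg_cst|exact: cvg_id].
have Q0 : is_path Sq (0, 0) (1, 0) (fun s : R => (s, 0 : R)).
  by split=> //; apply: continuous_subspaceT; apply: continuous_pair => s; [exact: cvg_id|exact: cvg_cst].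
have Q1 : is_path Sq (0, 1) (1, 1) (fun s : R => (s, 1 : R)).
  by split=> //; apply: continuous_subspaceT; apply: continuous_pair => s; [exact: cvg_id|exact: cvg_cst].
have FP x y (f : R -> R * R) : is_path Sq x y f -> is_path X (F x) (F y) (F \o f) by apply: is_path_comp.
have Q := is_path_concat (is_path_concat Q0 P1) (is_path_reverse Q1).
rewrite -(functor_reverse nuF (FP _ _ _ Q1)) -(functor_concat nuF (FP _ _ _ Q0) (FP _ _ _ P1)).
rewrite -(functor_concat nuF (is_path_concat (FP _ _ _ Q0) (FP _ _ _ P1)) (is_path_reverse (FP _ _ _ Q1))).
have [cP0 P00 P01 SP0] := P0; have [cQ Q00 Q01 SQ] := Q.
rewrite (functor_homotopic nuF (convex_homotopy (@convex01X2 R) cF FX cP0 cQ _ _ _ _)).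
- by congr nu; apply/funext => s; rewrite /= /concat /=; case: ifP => // _; case: ifP.
- by move=> s s1; apply: SP0; rewrite in01.
- by move=> s s1; apply: SQ; rewrite in01.
- by rewrite Q00.
- by rewrite Q01.
Qed.

(** Translation along [w] moves [U] inside itself into the convex [C]. By [functor_square] a path
    has the value of its pushed copy, corrected by the tracks of its end points; two paths with
    common ends have the same tracks, and their copies are compared in [C]. *)
Lemma push_simple (U C : set V) w : convex C -> C `<=` U -> th @^-1` U `<=` X ->
  (forall v r, U v -> 0 <= r <= 1 -> U (v + r *: w)) ->
  (forall v, U v -> C (v + w)) ->
  functor_simple nu (th @^-1` U).
Proof.
move=> cvC CU UX Uw Cw q q' f g Pf Pg.
pose F h (z : R * R) := thi (th (h z.2) + z.1 *: w).
have main h : is_path (th @^-1` U) q q' h ->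
    {within [set` `[0, 1]] `*` [set` `[0, 1]], continuous (F h)} /\
    (forall z, ([set` `[0, 1]] `*` [set` `[0, 1]]) z -> X (F h z)).
  move=> [ch h0 h1 Uh]; split; last first.
    move=> [r s] [/= r1 s1]; apply: UX; rewrite /F /= thiK; apply: Uw; first exact: Uh.
    by move: r1; rewrite in_itv.
  apply: (within_continuousS (f := fun z : R * R => th (h z.2) + z.1 *: w)) => //.
  have c2 : {within `[0, 1] `*` `[0, 1], continuous (snd : R * R -> R)}.
    by apply: continuous_subspaceT => z; apply: cvg_snd.
  have h2 : forall a : R * R, ([set` `[0, 1]] `*` [set` `[0, 1]]) a -> [set` `[0, 1]] a.2 by move=> a [].
  have /subspace_continuousP kP := within_continuous_comp_in c2 h2 (within_chart ch).
  apply/subspace_continuousP => z Az; apply: cvgD; first exact: kP.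
  apply: cvgZr_tmp; apply: cvg_within_filter; exact: cvg_fst.
have top h : is_path (th @^-1` U) q q' h ->
    is_path (th @^-1` C) (F h (1, 0)) (F h (1, 1)) (fun s => F h (1, s)).
  move=> Ph; have [cF _] := main _ Ph; split=> // [|s s1].
    apply: (@within_continuous_comp_in _ _ _ _ _ (fun s : R => (1 : R, s)) _ _ _ cF).
      by apply: continuous_subspaceT; apply: continuous_pair => s; [exact: cvg_cst|exact: cvg_id].
    by move=> s s1; split=> //=; rewrite in_itv /= lexx ler01.
  by rewrite /F /= thiK scale1r; apply: Cw; case: Ph => _ _ _; apply.
have E h : is_path (th @^-1` U) q q' h -> nu h = nu (fun s => F h (0, s)).
  by move=> _; congr nu; apply/funext => s; rewrite /F /= scale0r addr0 thK.
have [cF XF] := main _ Pf; have [cF' XF'] := main _ Pg.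
rewrite (E f) // (E g) // !functor_square //.
have [_ f0 f1 _] := Pf; have [_ g0 g1 _] := Pg.
have -> : (fun s => F f (s, 0)) = (fun s => F g (s, 0)) by apply/funext => s; rewrite /F /= f0 g0.
have -> : (fun s => F f (s, 1)) = (fun s => F g (s, 1)) by apply/funext => s; rewrite /F /= f1 g1.
congr (_ * _ * _)%g.
have CX : th @^-1` C `<=` X by move=> v /CU/UX.
apply: (convex_simple cvC CX (top _ Pf)).
have := top _ Pg; rewrite /F /= f0 f1 g0 g1; exact.
Qed.

Lemma push_joined (U C : set V) w p q : convex C -> C `<=` U ->
  (forall v r, U v -> 0 <= r <= 1 -> U (v + r *: w)) ->
  (forall v, U v -> C (v + w)) ->
  U (th p) -> U (th q) -> joined R (th @^-1` U) p q.
Proof.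
move=> cvC CU Uw Cw Up Uq.
have up x : U (th x) -> joined R (th @^-1` U) x (thi (th x + w)).
  move=> Ux; exists (fun r => thi (th x + r *: w)); split.
  - apply: continuous_subspaceT => s; apply: continuous_comp; last exact: cthi.
    apply: cvgD; first exact: cvg_cst.
    by apply: cvgZr_tmp; exact: cvg_id.
  - by rewrite scale0r addr0 thK.
  - by rewrite scale1r.
  - by move=> s; rewrite in01 /= thiK => s1; apply: Uw.
apply: joined_trans (up p Up) _; apply: joined_trans _ (joined_sym (up q Uq)).
apply: (@joined_sub _ _ (th @^-1` C)) => [x /CU//|].
by apply: convex_joined; rewrite ?thiK; auto.
Qed.

End Charts.

(** * The complement of a two-bridge link *)

Section Space.
Variable R : realType.

Definition space3 : normedModType R := (R * R * R)%type.
Implicit Types (u p q : space3) (b : bool) (n : nat).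

Definition px (u : space3) : R := u.1.1.
Definition py (u : space3) : R := u.1.2.
Definition pz (u : space3) : R := u.2.

Lemma px_continuous : continuous px.
Proof. by move=> u; apply: cvg_comp (@cvg_fst _ _ _ _ _) _; apply: cvg_fst. Qed.

Lemma py_continuous : continuous py.
Proof. by move=> u; apply: cvg_comp (@cvg_fst _ _ _ _ _) _; apply: cvg_snd. Qed.

Lemma pz_continuous : continuous pz.
Proof. by move=> u; apply: cvg_snd. Qed.

Lemma open_fun_gt (f : space3 -> R) a : continuous f -> open [set u | a < f u].
Proof.
by move=> cf; apply: (@open_comp _ _ f [set x | a < x]) => [u _|]; [exact: cf|exact: open_gt].
Qed.

Lemma open_fun_lt (f : space3 -> R) a : continuous f -> open [set u | f u < a].
Proof.
by move=> cf; apply: (@open_comp _ _ f [set x | x < a]) => [u _|]; [exact: cf|exact: open_lt].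
Qed.

Lemma open_fun_neq (f : space3 -> R) a : continuous f -> open [set u | f u != a].
Proof.
by move=> cf; apply: (@open_comp _ _ f [set x | x != a]) => [u _|]; [exact: cf|exact: open_neq].
Qed.

(** The caps join strands 0 and 1, and strands 2 and 3; these are the midpoints. *)
Definition cap_center b : R := if b then 2 + 2^-1 else 2^-1.

(* Half a solid cylinder over a half-disc of radius 1/2, extended by a slab:   *)
(* for h = z - n the level 1/4 is a cap above the height n and its two legs.   *)
Definition bowl b (h : space3 -> R) u : R :=
  (px u - cap_center b) ^+ 2 + (Num.max 0 (h u)) ^+ 2.

Lemma bowl_continuous b h : continuous h -> continuous (bowl b h).
Proof.
move=> ch u.
have c1 : {for u, continuous (fun u => px u - cap_center b)}.
  by apply: cvgB; [exact: px_continuous|exact: cvg_cst].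
have c2 : {for u, continuous (fun u => Num.max 0 (h u))}.
  by apply: continuous_max; [exact: cvg_cst|exact: ch].
by apply: cvgD; [exact: (cvgM c1 c1)|exact: (cvgM c2 c2)].
Qed.

Definition affine (h : space3 -> R) :=
  forall p q (s : R), h ((1 - s) *: p + s *: q) = (1 - s) * h p + s * h q.

Lemma px_affine : affine px. Proof. by []. Qed.
Lemma py_affine : affine py. Proof. by []. Qed.
Lemma pz_affine : affine pz. Proof. by []. Qed.

Lemma convexI (A B : set space3) : convex A -> convex B -> convex (A `&` B).
Proof. by move=> cA cB p q s [Ap Bp] [Aq Bq] s1; split; [apply: cA|apply: cB]. Qed.

Lemma barycenter_lt (a b k s : R) : a < k -> b < k -> 0 <= s <= 1 ->
  (1 - s) * a + s * b < k.
Proof. by move=> ak bk s1; have [s2|s2] := leP s 2^-1; nra. Qed.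

Lemma convex_lt h a : affine h -> convex [set u | h u < a].
Proof. by move=> ah p q s /=; rewrite ah; apply: barycenter_lt. Qed.

Lemma convex_gt h a : affine h -> convex [set u | a < h u].
Proof.
move=> ah p q s /= ap aq s1; rewrite ah.
have := @barycenter_lt (- h p) (- h q) (- a) s; rewrite !ltrN2 => /(_ ap aq s1).
lra.
Qed.

Lemma convex_eq h a : affine h -> convex [set u | h u = a].
Proof. by move=> ah p q s /=; rewrite ah => -> ->; lra. Qed.

Lemma convex_sqr (a b s : R) : 0 <= s <= 1 ->
  ((1 - s) * a + s * b) ^+ 2 <= (1 - s) * a ^+ 2 + s * b ^+ 2.
Proof.
move=> /andP[s0 s1]; rewrite -subr_ge0.
have -> : (1 - s) * a ^+ 2 + s * b ^+ 2 - ((1 - s) * a + s * b) ^+ 2 = s * (1 - s) * (a - b) ^+ 2 by ring.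
by rewrite mulr_ge0 ?sqr_ge0 // mulr_ge0 // subr_ge0.
Qed.

(** [bowl b h] is a convex function: the maximum of 0 and an affine function is convex and
    nonnegative, where squaring is increasing and convex. *)
Lemma convex_bowl b h : affine h -> convex [set u | bowl b h u < 4^-1].
Proof.
move=> ah p q s; rewrite /= /bowl => Hp Hq s1; rewrite ah px_affine.
set a := px p in Hp *; set a' := px q in Hq *; set m := Num.max 0 (h p) in Hp *.
set m' := Num.max 0 (h q) in Hq *; set M := Num.max 0 _.
have -> : (1 - s) * a + s * a' - cap_center b = (1 - s) * (a - cap_center b) + s * (a' - cap_center b) by lra.
have M0 : 0 <= M by rewrite le_max lexx.
have m0 : 0 <= m by rewrite le_max lexx.
have m0' : 0 <= m' by rewrite le_max lexx.
have mh : h p <= m by rewrite le_max lexx orbT.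
have mh' : h q <= m' by rewrite le_max lexx orbT.
have Mm : M <= (1 - s) * m + s * m' by rewrite ge_max; apply/andP; split; nra.
have MM : M ^+ 2 <= ((1 - s) * m + s * m') ^+ 2 by rewrite ler_sqr ?nnegrE // (le_trans M0).
have := convex_sqr (a - cap_center b) (a' - cap_center b) s1.
have := convex_sqr m m' s1.
move: Hp Hq MM; set x := (a - cap_center b) ^+ 2; set x' := (a' - cap_center b) ^+ 2.
set y := m ^+ 2; set y' := m' ^+ 2 => Hp Hq MM H1 H2.
have := barycenter_lt Hp Hq s1.
lra.
Qed.

(** In the plane y = 0, the half-disc bounded by each cap together with the strip between its legs,
    where h is at most 0. *)
Definition below_caps (h : space3 -> R) : set space3 :=
  [set u | py u = 0 /\ exists b, bowl b h u <= 4^-1].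

Definition arcs (h : space3 -> R) : set space3 :=
  [set u | py u = 0 /\ exists b, bowl b h u = 4^-1].

Lemma open_not_below h : continuous h -> open (~` below_caps h).
Proof.
move=> ch; have -> : ~` below_caps h =
    [set u | py u != 0] `|` ([set u | 4^-1 < bowl false h u] `&` [set u | 4^-1 < bowl true h u]).
  apply/seteqP; split=> u /=.
    move=> nB; have [y0|] := eqVneq (py u) 0; last by left.
    by right; split; rewrite ltNge; apply/negP => ?; apply: nB; split=> //; eexists; eassumption.
  move=> [/eqP ny [y0 _]//|[b0 b1] [_ [[]]]]; by rewrite leNgt (b0, b1).
apply: openU; first exact/open_fun_neq/py_continuous.
by apply: openI; apply/open_fun_gt/bowl_continuous.
Qed.

Lemma bowl_width b h u : bowl b h u <= 4^-1 -> cap_center b - 2^-1 <= px u <= cap_center b + 2^-1.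
Proof.
rewrite /bowl => H; have := sqr_ge0 (Num.max 0 (h u)) => M0.
have {M0} H' : (px u - cap_center b) ^+ 2 <= 4^-1 by lra.
by rewrite expr2 in H'; apply/andP; split; nra.
Qed.

Lemma bowl_ltW b h u : bowl b h u < 4^-1 -> cap_center b - 2^-1 < px u < cap_center b + 2^-1.
Proof.
rewrite /bowl => H; have := sqr_ge0 (Num.max 0 (h u)) => M0.
have {M0} H' : (px u - cap_center b) ^+ 2 < 4^-1 by lra.
by rewrite expr2 in H'; apply/andP; split; nra.
Qed.

(** The bowls [false] and [true] lie over the x-ranges from 0 to 1 and from 2 to 3, whatever the
    height functions are. *)
Lemma bowl_disjoint b b' h h' u : bowl b h u < 4^-1 -> bowl b' h' u <= 4^-1 -> b = b'.
Proof.
by move=> /bowl_ltW + /bowl_width; case: b; case: b' => //=; rewrite /cap_center; lra.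
Qed.

End Space.

Section TwoBridge.
Variables (R : realType) (L : set (R3 R)) (n : nat).
Variables (th thi : R3 R -> R3 R).
Hypotheses (cth : continuous th) (cthi : continuous thi).
Hypotheses (thK : cancel th thi) (thiK : cancel thi th).
Hypothesis th_level : forall u : R3 R, pz (th u) = pz u.

Let top (u : space3 R) : R := pz u - n%:R.
Let bot (u : space3 R) : R := - pz u.
Let V : normedModType R := space3 R.

(** [L] models a plat whose braid has been straightened from below: it is already straight near the
    bottom, so the discs spanning the bottom caps are undisturbed, and in the coordinates [th] its
    part z > 0 consists of vertical legs with caps on top. *)
Hypothesis L_low : forall u : R3 R, L u -> pz u < 2^-1 -> below_caps bot u.
Hypothesis L_disc : forall b (u : R3 R), bowl b (@pz R) u < 4^-1 -> bowl b bot u < 4^-1 -> ~ L u.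
Hypothesis L_bot : forall u : R3 R, pz u <= 0 -> arcs bot u -> L u.
Hypothesis L_top : forall u : R3 R, 0 < pz u -> L u <-> arcs top (th u).

Variables (G : groupType) (nu : (R -> R3 R) -> G).
Hypothesis nuF : path_functor (~` L) nu.

Lemma top_affine : affine top.
Proof. by move=> p q s; rewrite /top pz_affine; lra. Qed.

Lemma bot_affine : affine bot.
Proof. by move=> p q s; rewrite /bot pz_affine; lra. Qed.

Lemma top_continuous : continuous top.
Proof. by move=> u; apply: cvgB; [exact: pz_continuous|exact: cvg_cst]. Qed.

Lemma bot_continuous : continuous bot.
Proof. by move=> u; apply: cvgN; exact: pz_continuous. Qed.

Lemma below_caps_gt (h : space3 R -> R) u : 2^-1 < h u -> ~ below_caps h u.
Proof.
move=> hu [_ [b]]; rewrite /bowl => H.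
have := sqr_ge0 (px u - cap_center _ b).
have : h u <= Num.max 0 (h u) by rewrite le_max lexx orbT.
by move: H; set m := Num.max _ _; rewrite [m ^+ 2]expr2; nra.
Qed.

Lemma below_caps_mono (h h' : space3 R -> R) (u v : space3 R) : px u = px v -> py u = py v ->
  h u <= h' v -> below_caps h' v -> below_caps h u.
Proof.
move=> xE yE huv [y0 [b vb]]; split; first by rewrite yE.
exists b; apply: le_trans vb; rewrite /bowl xE lerD2l.
have m : Num.max 0 (h u) <= Num.max 0 (h' v) by rewrite ge_max !le_max lexx huv orbT.
by rewrite ler_sqr // nnegrE le_max lexx.
Qed.

(** [upper] is a half-space minus two curtains hanging from the top caps; [lower] is a half-space
    minus the discs of the bottom caps, prolonged upwards. Both can be pushed away vertically from
    what was removed. The sets [upper_disc] and [lower_disc] are convex neighbourhoods of the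
    removed discs; the two bowls of the latter cut out the round cylinder (x - c)^2 + z^2 < 1/4. *)
Definition upper : set V := [set v | 0 < pz v] `&` ~` below_caps top.
Definition lower : set V := [set v | pz v < 2^-1] `&` ~` below_caps bot.
Definition upper_disc b : set V := [set v | 0 < pz v] `&` [set v | bowl b top v < 4^-1].
Definition lower_disc b : set V :=
  [set v | bowl b (@pz R) v < 4^-1] `&` [set v | bowl b bot v < 4^-1].

Let UT : set (R3 R) := th @^-1` upper.
Let VT b : set (R3 R) := th @^-1` upper_disc b.
Let UB : set (R3 R) := id @^-1` lower.
Let VB b : set (R3 R) := id @^-1` lower_disc b.
Let O : set (R3 R) := [set u | 0 < pz u] `\` L.

Lemma upperX : UT `<=` ~` L.
Proof.
move=> u [u0 nB] Lu; apply: nB; rewrite /= th_level in u0.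
by have [y0 [b bE]] := (L_top u0).1 Lu; split=> //; exists b; rewrite bE.
Qed.

Lemma upper_discX b : VT b `<=` ~` L.
Proof.
move=> u [u0 ub] Lu; rewrite /= th_level in u0.
have [y0 [b' bE]] := (L_top u0).1 Lu.
have bL : bowl b' top (th u) <= 4^-1 by rewrite bE.
have bb' := bowl_disjoint ub bL.
by move: ub; rewrite bb' /= bE ltxx.
Qed.

Lemma lowerX : UB `<=` ~` L.
Proof. by move=> u [u0 nB] Lu; apply/nB/L_low. Qed.

Lemma lower_discX b : VB b `<=` ~` L.
Proof. by move=> u [u0 nB]; apply: L_disc nB. Qed.

Lemma to_space3_continuous : continuous (id : R3 R -> space3 R).
Proof. by move=> u; apply: cvg_id. Qed.

Lemma of_space3_continuous : continuous (id : space3 R -> R3 R).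
Proof. by move=> u; apply: cvg_id. Qed.

Let Cup : set V := [set v | n%:R + 1 < pz v].
Let wup : V := ((0, 0), n%:R + 1).
Let Cdown : set V := [set v | pz v < - 2^-1].
Let wdown : V := ((0, 0), - 1).

Lemma Cup_convex : convex Cup. Proof. exact/convex_gt/pz_affine. Qed.
Lemma Cdown_convex : convex Cdown. Proof. exact/convex_lt/pz_affine. Qed.

Lemma Cup_upper : Cup `<=` upper.
Proof.
move=> v; rewrite /Cup /= => vn; have n0 : 0 <= n%:R :> R by [].
by split=> /=; [lra | apply: below_caps_gt; rewrite /top; lra].
Qed.

Lemma Cdown_lower : Cdown `<=` lower.
Proof.
move=> v; rewrite /Cdown /= => vn.
by split=> /=; [lra | apply: below_caps_gt; rewrite /bot; lra].
Qed.

Lemma push_upper v r : upper v -> 0 <= r <= 1 -> upper (v + r *: wup).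
Proof.
have n0 : 0 <= n%:R :> R by [].
move=> [/= v0 nB] r1.
split; first by suff : 0 < pz v + r * (n%:R + 1) by []; nra.
move=> H; apply: nB; apply: below_caps_mono H; rewrite /px /py /= ?scaler0 ?addr0 //.
by suff : pz v - n%:R <= pz v + r * (n%:R + 1) - n%:R by []; nra.
Qed.

Lemma push_lower v r : lower v -> 0 <= r <= 1 -> lower (v + r *: wdown).
Proof.
move=> [/= v0 nB] r1.
split; first by suff : pz v + r * - 1 < 2^-1 by []; nra.
move=> H; apply: nB; apply: below_caps_mono H; rewrite /px /py /= ?scaler0 ?addr0 //.
by suff : - pz v <= - (pz v + r * - 1) by []; nra.
Qed.

Lemma push_upper1 v : upper v -> Cup (v + wup).
Proof.
move=> [/= v0 _]; suff : n%:R + 1 < pz v + (n%:R + 1) by [].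
lra.
Qed.

Lemma push_lower1 v : lower v -> Cdown (v + wdown).
Proof.
move=> [/= v0 _]; suff : pz v - 1 < - 2^-1 by [].
lra.
Qed.

Lemma upper_simple : functor_simple nu UT.
Proof.
by apply: (push_simple nuF cth cthi thK thiK Cup_convex Cup_upper upperX push_upper push_upper1).
Qed.

Lemma lower_simple : functor_simple nu UB.
Proof.
by apply: (push_simple nuF to_space3_continuous of_space3_continuous (fun=> erefl) (fun=> erefl)
  Cdown_convex Cdown_lower lowerX push_lower push_lower1).
Qed.

Lemma upper_joined p q : UT p -> UT q -> joined R UT p q.
Proof. exact: (push_joined cthi thK thiK Cup_convex Cup_upper push_upper push_upper1). Qed.

Lemma lower_joined p q : UB p -> UB q -> joined R UB p q.
Proof.
exact: (push_joined of_space3_continuous (fun=> erefl) (fun=> erefl)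
  Cdown_convex Cdown_lower push_lower push_lower1).
Qed.

Lemma upper_disc_convex b : convex (upper_disc b).
Proof.
by apply: convexI; [exact/convex_gt/pz_affine|exact/convex_bowl/top_affine].
Qed.

Lemma lower_disc_convex b : convex (lower_disc b).
Proof.
by apply: convexI; [exact/convex_bowl/pz_affine|exact/convex_bowl/bot_affine].
Qed.

Lemma upper_disc_simple b : functor_simple nu (VT b).
Proof. exact: (convex_simple nuF cth cthi thK thiK (@upper_disc_convex b) (@upper_discX b)). Qed.

Lemma lower_disc_simple b : functor_simple nu (VB b).
Proof.
exact: (convex_simple nuF to_space3_continuous of_space3_continuous (fun=> erefl) (fun=> erefl)
  (@lower_disc_convex b) (@lower_discX b)).
Qed.

Lemma upper_disc_joined b p q : VT b p -> VT b q -> joined R (VT b) p q.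
Proof. exact: (convex_joined cthi thK thiK (@upper_disc_convex b)). Qed.

Lemma convex_id_joined (C : set V) (p q : R3 R) : convex C -> C p -> C q ->
  joined R (C : set (R3 R)) p q.
Proof. exact: (convex_joined of_space3_continuous (fun=> erefl) (fun=> erefl)). Qed.

Lemma open_preimage (A : set V) (f : R3 R -> V) : continuous f -> open A -> open (f @^-1` A).
Proof. by move=> cf oA; apply: open_comp oA => u _; apply: cf. Qed.

Lemma upper_open : open UT.
Proof.
apply: open_preimage => //; apply: openI; first exact/open_fun_gt/pz_continuous.
exact/open_not_below/top_continuous.
Qed.

Lemma lower_open : open UB.
Proof.
apply: open_preimage; first exact: to_space3_continuous.
apply: openI; first exact/open_fun_lt/pz_continuous.
exact/open_not_below/bot_continuous.
Qed.

Lemma upper_disc_open b : open (VT b).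
Proof.
apply: open_preimage => //; apply: openI; first exact/open_fun_gt/pz_continuous.
exact/open_fun_lt/bowl_continuous/top_continuous.
Qed.

Lemma lower_disc_open b : open (VB b).
Proof.
apply: open_preimage; first exact: to_space3_continuous.
apply: openI; apply/open_fun_lt/bowl_continuous; [exact: pz_continuous|exact: bot_continuous].
Qed.


Let S3 (x y z : R) : R3 R := ((x, y), z).

Lemma not_below_y (h : space3 R -> R) (u : space3 R) : py u != 0 -> ~ below_caps h u.
Proof. by move=> /eqP y0 []. Qed.

Lemma not_below_x (h : space3 R -> R) (u : space3 R) :
  (forall b, ~~ (cap_center R b - 2^-1 <= px u <= cap_center R b + 2^-1)) -> ~ below_caps h u.
Proof. by move=> xu [_ [b /bowl_width]]; apply/negP/xu. Qed.

(** At height 1/4 these points lie in both disc neighbourhoods, for every [y]; the sign of [y] tells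
    the side of the disc. *)
Definition corner b (y : R) : R3 R := S3 (cap_center R b) y 4^-1.

Lemma corner_upper_disc b y : upper_disc b (corner b y).
Proof.
split=> /=; first by rewrite /pz /=; lra.
rewrite /bowl /top /px /pz /= subrr expr0n add0r.
have n0 : 0 <= n%:R :> R by [].
have [h|h] := leP 0 (4^-1 - n%:R : R); rewrite ?expr0n ?expr2 /=; [nra | lra].
Qed.

Lemma corner_lower_disc b y : lower_disc b (corner b y).
Proof.
split=> /=; rewrite /bowl /bot /px /pz /= subrr expr0n add0r.
  by rewrite max_r ?expr2; lra.
by rewrite max_l ?expr0n /=; lra.
Qed.

Let half (h : space3 R -> R) (sg : bool) : set (space3 R) :=
  [set u | if sg then 0 < h u else h u < 0].

Lemma half_convex sg : convex (half (@py R) sg).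
Proof. by case: sg; [exact/convex_gt/py_affine|exact/convex_lt/py_affine]. Qed.

Let sgn (sg : bool) : R := if sg then 1 else -1.

Lemma py_sign (u : space3 R) : py u != 0 -> exists sg, half (@py R) sg u.
Proof. by rewrite neq_lt => /orP[y0|y0]; [exists false|exists true]. Qed.

Lemma half_neq0 sg (u : space3 R) : half (@py R) sg u -> py u != 0.
Proof. by case: sg => /= ?; rewrite neq_lt; apply/orP; [right|left]. Qed.

Lemma upper_disc_disjoint b b' : VT b `&` VT b' !=set0 -> b = b'.
Proof. by move=> [u [[_ ub] [_ ub']]]; apply: bowl_disjoint ub (ltW ub'). Qed.

Lemma lower_disc_disjoint b b' : VB b `&` VB b' !=set0 -> b = b'.
Proof. by move=> [u [[_ ub] [_ ub']]]; apply: bowl_disjoint ub (ltW ub'). Qed.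

Lemma corner_upper b sg : upper (corner b (sgn sg)).
Proof.
split; first by rewrite /= /pz /=; lra.
by apply: not_below_y; rewrite /py /=; case: sg => /=; rewrite ?oner_eq0 ?oppr_eq0 ?oner_eq0.
Qed.

(* A disc separates its neighbourhood into two convex sides contained in upper. *)
Lemma upper_side b q : UT q -> VT b q -> exists sg,
  joined R (UT `&` VT b) (thi (corner b (sgn sg))) q.
Proof.
move=> [q0 nB] [_ qb]; have yq : py (th q) != 0.
  by apply/eqP => y0; apply: nB; split=> //; exists b; apply: ltW.
have [sg sgq] := py_sign yq; exists sg.
apply: (@joined_sub _ _ (th @^-1` (upper_disc b `&` half (@py R) sg))).
  by move=> u [[u0 ub] /half_neq0 uy]; split; split=> //; apply: not_below_y.
apply: (convex_joined cthi thK thiK); rewrite ?thiK //.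
  by apply: convexI; [exact: upper_disc_convex|exact: half_convex].
split; first exact: corner_upper_disc.
by case: (sg); rewrite /half /py /sgn /= ?ltr01 ?ltrN10.
Qed.

Lemma upper_cover : UT `|` VT false `|` VT true = O.
Proof.
apply/seteqP; split=> u.
  have z0 (C : set V) : th u \in [set v | 0 < pz v] `&` C -> 0 < pz u.
    by rewrite inE => -[+ _]; rewrite /= th_level.
  move=> [[H|H]|H]; split.
  - by apply: z0; rewrite inE; exact: H.
  - exact: upperX.
  - by apply: z0; rewrite inE; exact: H.
  - exact: upper_discX H.
  - by apply: z0; rewrite inE; exact: H.
  - exact: upper_discX H.
move=> [/= u0 nL]; have [[y0 [b ub]]|nB] := pselect (below_caps top (th u)); last first.
  by left; left; split=> //=; rewrite th_level.
have {}ub : bowl b top (th u) < 4^-1.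
  rewrite lt_neqAle ub andbT; apply/eqP => bE; apply/nL/L_top => //; split=> //; by exists b.
have ub' : VT b u by split=> //=; rewrite th_level.
by case: b ub' {ub} => ?; [right|left; right].
Qed.

Lemma O_open : open O.
Proof.
rewrite -upper_cover; apply: openU; last exact: upper_disc_open.
by apply: openU; [exact: upper_open|exact: upper_disc_open].
Qed.

Let w0 : R3 R := S3 (1 + 2^-1) 0 4^-1.

Lemma strip_X : [set u : R3 R | 0 < pz u] `&` UB `<=` O `&` UB.
Proof. by move=> u [u0 uB]; split=> //; split=> //; apply: lowerX. Qed.

(** The plane x = 3/2 passes between the two discs and so connects the sides y > 0 and y < 0. A
    point with y = 0 outside the discs is first moved to y = 1. *)
Lemma strip_joined q : O q -> UB q -> joined R (O `&` UB) w0 q.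
Proof.
move=> [q0 _] [q2 nB]; rewrite /= in q0 q2.
pose Z : set (space3 R) := [set u | 0 < pz u] `&` [set u | pz u < 2^-1].
have cZ : convex Z by apply: convexI; [exact/convex_gt/pz_affine|exact/convex_lt/pz_affine].
have ZX (C : set (space3 R)) : (forall u, C u -> ~ below_caps bot u) -> Z `&` C `<=` O `&` UB.
  by move=> CB u [[u0 u2] Cu]; apply: strip_X; split=> //; split=> //; apply: CB.
have w0B : forall u : space3 R, px u = 1 + 2^-1 -> ~ below_caps bot u.
  by move=> u xu; apply: not_below_x => b; rewrite xu /cap_center; case: b; lra.
have step1 (q' : R3 R) : py q' != 0 -> 0 < pz q' -> pz q' < 2^-1 -> joined R (O `&` UB) w0 q'.
  move=> y0 z0 z2; have [sg sgq] := py_sign y0.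
  apply: (@joined_trans _ _ _ _ (S3 (1 + 2^-1) (py q') 4^-1)).
    apply: (joined_sub (ZX [set u | px u = 1 + 2^-1] _)) => //.
    apply: convex_id_joined; first by apply: convexI => //; apply/convex_eq/px_affine.
      by split=> //; split; rewrite /= /pz /=; lra.
    by split=> //; split; rewrite /= /pz /=; lra.
  apply: (joined_sub (ZX (half (@py R) sg) _)).
    by move=> u /half_neq0; apply: not_below_y.
  apply: convex_id_joined; first by apply: convexI => //; apply: half_convex.
    by split=> //; split; rewrite /= /pz /=; lra.
  by [].
have [y0|] := eqVneq (py q) 0; last by move=> y0; apply: step1.
have xq : forall b, 4^-1 < (px q - cap_center R b) ^+ 2.
  move=> b; rewrite ltNge; apply/negP => qb; apply: nB; split=> //; exists b.
  by rewrite /bowl max_l /bot ?expr0n ?addr0 // oppr_le0 ltW.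
apply: (@joined_trans _ _ _ _ (S3 (px q) 1 (pz q))).
  by apply: step1; rewrite /= /py /pz /= ?oner_eq0.
apply: (joined_sub (ZX [set u | px u = px q] _)).
  move=> u /= xu [_ [b]]; rewrite /bowl xu; have := xq b; have := sqr_ge0 (Num.max 0 (bot u)); lra.
by apply: convex_id_joined => //; apply: convexI => //; apply/convex_eq/px_affine.
Qed.

(** A bottom disc gives no new generator: the part z > 0 of its neighbourhood is convex, lies in
    [O], and connects the two sides of the disc. *)
Lemma lower_disc_side b q : (O `|` UB) q -> VB b q -> joined R ((O `|` UB) `&` VB b) (corner b 1) q.
Proof.
have cO : convex ([set u | 0 < pz u] `&` lower_disc b : set V).
  by apply: convexI; [exact/convex_gt/pz_affine|exact: lower_disc_convex].
have OX : [set u | 0 < pz u] `&` lower_disc b `<=` (O `|` UB) `&` VB b.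
  by move=> u [u0 ub]; split=> //; left; split=> //; apply: lower_discX ub.
have cor y : ([set u | 0 < pz u] `&` lower_disc b : set V) (corner b y).
  by split; [rewrite /= /pz /=; lra|exact: corner_lower_disc].
move=> H qb; have [z0|z0] := ltP 0 (pz q).
  by apply: (joined_sub OX); apply: convex_id_joined cO (cor 1) _.
have {}H : UB q by case: H => // -[/=]; lra.
have yq : py q != 0.
  by apply/eqP => y0; case: H => _; apply; split=> //; exists b; case: qb => _ /ltW.
have [sg sgq] := py_sign yq.
apply: (@joined_trans _ _ _ _ (corner b (py q))).
  by apply: (joined_sub OX); apply: convex_id_joined cO (cor 1) (cor _).
apply: (@joined_sub _ _ (half (@py R) sg `&` lower_disc b)).
  move=> u [/half_neq0 yu ub]; split=> //.
  have [u0|u0] := ltP 0 (pz u); first by left; split=> //; apply: lower_discX ub.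
  by right; split; [apply: le_lt_trans u0 _; lra | exact: not_below_y].
apply: convex_id_joined; first by apply: convexI; [exact: half_convex|exact: lower_disc_convex].
  by split=> //; apply: corner_lower_disc.
by split.
Qed.

Lemma lower_cover : O `|` UB `|` VB false `|` VB true = ~` L.
Proof.
apply/seteqP; split=> u.
  by move=> [[[[_ //]|/lowerX//]|/lower_discX//]|/lower_discX//].
move=> nL; have [z0|z0] := ltP 0 (pz u); first by left; left; left.
have [[y0 [b ub]]|nB] := pselect (below_caps bot u); last first.
  by left; left; right; split=> //; apply: le_lt_trans z0 _; lra.
have ub1 : bowl b bot u < 4^-1.
  rewrite lt_neqAle ub andbT; apply/eqP => bE; apply/nL/L_bot => //; split=> //; by exists b.
have ub2 : VB b u.
  split=> //=; apply: le_lt_trans ub1; rewrite /bowl max_l // expr0n addr0.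
  by rewrite lerDl sqr_ge0.
by case: b ub2 {ub ub1} => ?; [right|left; right].
Qed.


Let x0 : R3 R := thi (S3 0 0 (n%:R + 2)).

Lemma x0_upper : UT x0.
Proof.
have n0 : 0 <= n%:R :> R by [].
rewrite /UT /= /x0 thiK; split; first by rewrite /= /pz /=; lra.
by apply: below_caps_gt; rewrite /top /pz /=; lra.
Qed.

Let c0 (q : R3 R) : R -> R3 R :=
  if pselect (UT q) is left Uq then sval (cid (upper_joined x0_upper Uq)) else cst x0.

Lemma c0P q : UT q -> is_path UT x0 q (c0 q).
Proof. by rewrite /c0; case: pselect => // Uq _; case: cid. Qed.

Let v b sg : R3 R := thi (corner b (sgn sg)).

Lemma v_disc b sg : VT b (v b sg).
Proof. by rewrite /VT /v /= thiK; apply: corner_upper_disc. Qed.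

Lemma v_upper b sg : UT (v b sg).
Proof. by rewrite /UT /v /= thiK; apply: corner_upper. Qed.

Let cross b : R -> R3 R := sval (cid (upper_disc_joined (v_disc b true) (v_disc b false))).

Lemma crossP b : is_path (VT b) (v b true) (v b false) (cross b).
Proof. by rewrite /cross; case: cid. Qed.

Let loop b : R -> R3 R :=
  concat (concat (c0 (v b true)) (cross b)) (reverse (c0 (v b false))).

Lemma loopP b : is_loop (~` L) x0 (loop b).
Proof.
apply: is_path_concat; first apply: is_path_concat.
- exact: (is_path_sub upperX (c0P (v_upper b true))).
- exact: (is_path_sub (@upper_discX b) (crossP b)).
- exact: (is_path_reverse (is_path_sub upperX (c0P (v_upper b false)))).
Qed.

Let S : G -> Prop := generated (nu (loop false)) (nu (loop true)).

Lemma loop_transport b : transport nu c0 (v b true) (v b false) (cross b) = nu (loop b).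
Proof.
have P1 := is_path_sub upperX (c0P (v_upper b true)).
have P2 := is_path_sub (@upper_discX b) (crossP b).
have P3 := is_path_sub upperX (c0P (v_upper b false)).
rewrite /transport /loop (functor_concat nuF (is_path_concat P1 P2) (is_path_reverse P3)).
by rewrite (functor_concat nuF P1 P2) (functor_reverse nuF P3).
Qed.

Lemma loop_generated b : S (nu (loop b)).
Proof. by case: b; [exact: generated_b|exact: generated_a]. Qed.

Lemma upper_tame : tame (~` L) nu x0 S UT c0.
Proof.
split=> [q Uq|q q' f Pf]; first exact: is_path_sub upperX (c0P Uq).
have [Uq Uq'] := is_path_ends Pf.
have PX x y (g : R -> R3 R) : is_path UT x y g -> is_path (~` L) x y g := is_path_sub upperX.
rewrite /transport -(functor_concat nuF (PX _ _ _ (c0P Uq)) (PX _ _ _ Pf)).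
rewrite (upper_simple (is_path_concat (c0P Uq) Pf) (c0P Uq')) mulgV.
exact: generated1.
Qed.

(** The two sides of an upper disc are reached from [v b true], the far one only through [cross b];
    this passage costs exactly the generator [loop b]. *)
Lemma upper_disc_tame b (W : set (R3 R)) c : open W -> W `<=` ~` L -> UT `<=` W ->
  W `&` VT b `<=` UT -> tame (~` L) nu x0 S W c -> (forall q, UT q -> c q = c0 q) ->
  exists2 c', tame (~` L) nu x0 S (W `|` VT b) c' & forall q, UT q -> c' q = c0 q.
Proof.
move=> oW WX UW WU tW cc0.
have [|c' tc' c'c] := tame_add nuF (@generated1 _ _ _) (@generatedM _ _ _) (@generatedV _ _ _)
  oW (@upper_disc_open b) WX (@upper_discX b) tW (@upper_disc_simple b)
  (UW _ (v_upper b true)) (v_disc b true)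
  (fun q Vq => upper_disc_joined (v_disc b true) Vq); last first.
  by exists c' => // q Uq; rewrite c'c ?cc0 //; apply: UW.
move=> q Wq Vq; have Uq : UT q by apply: WU.
have [sg [g Pg]] := upper_side Uq Vq.
have PW : is_path W (v b sg) q g by apply: is_path_sub Pg => z [/UW].
have PV : is_path (VT b) (v b sg) q g by apply: is_path_sub Pg; exact: subIsetr.
have Sg := tW.2 _ _ _ PW.
case: sg => /= in Pg PW PV Sg *; first by exists g.
exists (concat (cross b) g); split; first exact: is_path_concat (crossP b) PV.
have -> : transport nu c (v b true) q (concat (cross b) g) =
    (transport nu c (v b true) (v b false) (cross b) * transport nu c (v b false) q g)%g.
  rewrite /transport (functor_concat nuF (is_path_sub (@upper_discX b) (crossP b)) (is_path_sub WX PW)).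
  by rewrite !mulgA mulgVK.
apply: generatedM => //.
suff -> : transport nu c (v b true) (v b false) (cross b) = nu (loop b) by exact: loop_generated.
by rewrite -loop_transport /transport !cc0 //; exact: v_upper.
Qed.

Theorem two_generators : exists x (f g : R -> R3 R),
  [/\ is_loop (~` L) x f, is_loop (~` L) x g &
   forall h, is_loop (~` L) x h -> generated (nu f) (nu g) (nu h)].
Proof.
exists x0, (loop false), (loop true); split; [exact: loopP|exact: loopP|].
have [|c1 t1 c1E] := @upper_disc_tame false UT c0 upper_open upperX (fun _ => id) _
  upper_tame (fun _ _ => erefl).
  by move=> q [].
have U1X : UT `|` VT false `<=` ~` L by move=> q [/upperX|/upper_discX].
have [||c2 t2 c2E] := @upper_disc_tame true _ c1 (openU upper_open (@upper_disc_open false)) U1X _ _ t1 c1E.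
- by move=> q; left.
- move=> q [[//|q0] q1]; suff : false = true by [].
  by apply: upper_disc_disjoint; exists q; split.
rewrite upper_cover in t2.
have OX : O `<=` ~` L by move=> q [].
have w0b : UB w0.
  split; first by rewrite /= /pz /=; lra.
  by apply: not_below_x => b; rewrite /px /w0 /cap_center /=; case: b; lra.
have w0O : O w0 by split; [rewrite /= /pz /=; lra | apply: lowerX].
have [|c3 t3 c3E] := tame_add_connected nuF (@generated1 _ _ _) (@generatedM _ _ _) (@generatedV _ _ _)
  O_open lower_open OX lowerX t2 lower_simple w0O w0b (fun q => lower_joined w0b).
  exact: strip_joined.
have O3 := openU O_open lower_open.
have X3 : O `|` UB `<=` ~` L by move=> q [/OX|/lowerX].
have cor b : (O `|` UB) (corner b 1).
  by left; split; [rewrite /= /pz /=; lra | apply: lower_discX; exact: corner_lower_disc].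
have [|c4 t4 c4E] := tame_add_connected nuF (@generated1 _ _ _) (@generatedM _ _ _) (@generatedV _ _ _)
  O3 (@lower_disc_open false) X3 (@lower_discX false) t3 (@lower_disc_simple false) (cor false)
  (corner_lower_disc false 1) (fun q => convex_id_joined (@lower_disc_convex false) (corner_lower_disc false 1)).
  by move=> q; apply: lower_disc_side.
have O4 := openU O3 (@lower_disc_open false).
have X4 : O `|` UB `|` VB false `<=` ~` L by move=> q [/X3|/lower_discX].
have [|c5 t5 c5E] := tame_add_connected nuF (@generated1 _ _ _) (@generatedM _ _ _) (@generatedV _ _ _)
  O4 (@lower_disc_open true) X4 (@lower_discX true) t4 (@lower_disc_simple true) (or_introl (cor true))
  (corner_lower_disc true 1) (fun q => convex_id_joined (@lower_disc_convex true) (corner_lower_disc true 1)).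
  move=> q [q3|qf] qt; last first.
    by suff : false = true by []; apply: lower_disc_disjoint; exists q; split.
  by apply: joined_sub (lower_disc_side q3 qt) => z [z3 zt]; split=> //; left.
rewrite lower_cover in t5.
have x0O : O x0 by rewrite -upper_cover; left; left; exact: x0_upper.
(* Each enlargement kept the earlier connecting paths, so the one at [x0] is still a loop in the
   simple set [UT], with trivial value. *)
have c5x : c5 x0 = c0 x0.
  by rewrite c5E ?c4E ?c3E ?c2E //; [exact: x0_upper|left|left; left].
have c0x : nu (c0 x0) = 1%g.
  rewrite (upper_simple (c0P x0_upper) (is_path_cst R x0_upper)).
  exact: (functor_cst nuF (upperX x0_upper)).
move=> h Ph; have := t5.2 _ _ _ Ph; rewrite /transport c5x c0x mul1g invg1 mulg1.
by [].
Qed.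

End TwoBridge.

(** * Straightening a braid *)

Section Straightening.
Variable R : realType.
Implicit Types (u v : R3 R) (i j k : nat) (e d : bool).

Definition clamp (s : R) : R := Num.max 0 (Num.min 1 s).

Lemma clamp_continuous : continuous clamp.
Proof.
move=> s; apply: continuous_max; first exact: cvg_cst.
by apply: continuous_min; [exact: cvg_cst|exact: cvg_id].
Qed.

Lemma clamp01 s : 0 <= clamp s <= 1.
Proof. by rewrite /clamp le_max lexx ge_max ler01 ge_min lexx. Qed.

Lemma clamp_id s : 0 <= s <= 1 -> clamp s = s.
Proof. by move=> /andP[s0 s1]; rewrite /clamp min_r // max_r. Qed.

Lemma clamp_le0 s : s <= 0 -> clamp s = 0.
Proof. by move=> s0; rewrite /clamp min_r ?max_l //; lra. Qed.

Lemma clamp_ge1 s : 1 <= s -> clamp s = 1.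
Proof. by move=> s1; rewrite /clamp min_l ?max_r //; lra. Qed.

Definition level_homeo (f g : R3 R -> R3 R) :=
  [/\ continuous f, continuous g, cancel f g, cancel g f & forall u, pz (f u) = pz u].

Lemma level_homeo_comp f g f' g' : level_homeo f g -> level_homeo f' g' ->
  level_homeo (f' \o f) (g \o g').
Proof.
move=> [cf cg fK gK fz] [cf' cg' fK' gK' fz']; split.
- by move=> u; apply: continuous_comp; [exact: cf|exact: cf'].
- by move=> u; apply: continuous_comp; [exact: cg'|exact: cg].
- by move=> u /=; rewrite fK' fK.
- by move=> u /=; rewrite gK gK'.
- by move=> u /=; rewrite fz' fz.
Qed.

Lemma level_homeo_id : level_homeo id id.
Proof. by split=> // u; apply: cvg_id. Qed.

(* Rotation about the axis through the midpoint of the strands i and i + 1, by *)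
(* the angle +- pi * sigma(z) at distance 1/2 from the axis, where those two   *)
(* strands are, fading to 0 at distance 3/2, where the other strands are.      *)
Section Rotation.
Variables (i : nat) (e : bool) (sigma : R -> R).
Hypothesis csigma : continuous sigma.

Definition rot_x u : R := px u - (i%:R + 2^-1).
Definition rot_angle u : R :=
  (-1) ^+ e * (pi * sigma (pz u) * clamp ((9 / 4 - (rot_x u ^+ 2 + py u ^+ 2)) / 2)).
Definition rot u : R3 R :=
  ((i%:R + 2^-1 + (rot_x u * cos (rot_angle u) - py u * sin (rot_angle u)),
    rot_x u * sin (rot_angle u) + py u * cos (rot_angle u)), pz u).

Lemma rot_continuous : continuous rot.
Proof.
have cx : continuous rot_x by move=> u; apply: cvgB; [exact: px_continuous|exact: cvg_cst].
have cy := @py_continuous R.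
have ca : continuous rot_angle.
  move=> u; apply: cvgM; first exact: cvg_cst.
  apply: cvgM.
    apply: cvgM; first exact: cvg_cst.
    by apply: (@continuous_comp _ _ _ (@pz R) sigma); [exact: pz_continuous|exact: csigma].
  apply: (@continuous_comp _ _ _ (fun u => (9 / 4 - (rot_x u ^+ 2 + py u ^+ 2)) / 2) clamp);
    last exact: clamp_continuous.
  apply: cvgM; last exact: cvg_cst.
  apply: cvgB; first exact: cvg_cst.
  by apply: cvgD; rewrite expr2; [exact: (cvgM (cx u) (cx u))|exact: (cvgM (cy u) (cy u))].
have cc : continuous (fun u => cos (rot_angle u)).
  by move=> u; apply: (@continuous_comp _ _ _ rot_angle cos); [exact: ca|exact: continuous_cos].
have cs : continuous (fun u => sin (rot_angle u)).
  by move=> u; apply: (@continuous_comp _ _ _ rot_angle sin); [exact: ca|exact: continuous_sin].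
have cX : continuous (fun u => i%:R + 2^-1 + (rot_x u * cos (rot_angle u) - py u * sin (rot_angle u))).
  move=> u; apply: cvgD; first exact: cvg_cst.
  by apply: cvgB; [exact: (cvgM (cx u) (cc u))|exact: (cvgM (cy u) (cs u))].
have cY : continuous (fun u => rot_x u * sin (rot_angle u) + py u * cos (rot_angle u)).
  by move=> u; apply: cvgD; [exact: (cvgM (cx u) (cs u))|exact: (cvgM (cy u) (cc u))].
exact: (continuous_pair (continuous_pair cX cY) (@pz_continuous R)).
Qed.

Lemma rot_level u : pz (rot u) = pz u. Proof. by []. Qed.

Lemma rot_fixed u : sigma (pz u) = 0 -> rot u = u.
Proof.
move=> s0; have a0 : rot_angle u = 0 by rewrite /rot_angle s0 mulr0 mul0r mulr0.
case: u s0 a0 => [[x y] z] s0 a0; rewrite /rot a0 cos0 sin0 !mulr1 !mulr0 subr0 add0r.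
by rewrite /rot_x addrC subrK.
Qed.

Lemma rot_outer j u : j != i -> j != i.+1 -> px u = j%:R -> rot u = u.
Proof.
move=> ji ji1 xu; have a0 : rot_angle u = 0.
  rewrite /rot_angle clamp_le0 ?mulr0 //.
  have := sqr_ge0 (py u); suff : 9 / 4 <= rot_x u ^+ 2 by lra.
  rewrite /rot_x xu.
  have [jlt|jge] := ltnP j i.
    have : (j.+1%:R : R) <= i%:R by rewrite ler_nat.
    by rewrite -natr1 expr2; nra.
  have : (i.+2%:R : R) <= j%:R by rewrite ler_nat; lia.
  by rewrite -natr1 -natr1 expr2; nra.
case: u xu a0 => [[x y] z] xu a0; rewrite /rot a0 cos0 sin0 !mulr1 !mulr0 subr0 add0r.
by rewrite /rot_x addrC subrK.
Qed.

Lemma rot_inner d z : rot ((i%:R + d%:R, 0), z) =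
  ((i%:R + 2^-1 - (-1) ^+ d * (cos (pi * sigma z) / 2),
   - ((-1) ^+ d * (-1) ^+ e * (sin (pi * sigma z) / 2))), z).
Proof.
have xE : rot_x ((i%:R + d%:R, 0), z) = - ((-1) ^+ d / 2).
  by rewrite /rot_x /px /=; case: d; rewrite ?expr1 ?expr0 /=; lra.
have aE : rot_angle ((i%:R + d%:R, 0), z) = (-1) ^+ e * (pi * sigma z).
  rewrite /rot_angle xE {1}/py /= expr0n addr0 clamp_ge1 ?mulr1 //.
  by rewrite sqrrN expr_div_n -exprM mulnC exprM sqrrN expr1n expr1n; lra.
rewrite /rot aE xE /py /pz /= !mul0r subr0 addr0.
have cE : cos ((-1) ^+ e * (pi * sigma z)) = cos (pi * sigma z).
  by case: (e); rewrite ?expr1 ?expr0 ?mulN1r ?mul1r // cosN.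
have sE : sin ((-1) ^+ e * (pi * sigma z)) = (-1) ^+ e * sin (pi * sigma z).
  by case: (e); rewrite ?expr1 ?expr0 ?mulN1r ?mul1r // sinN.
rewrite cE sE; congr ((_, _), _); first by rewrite mulNr; congr (_ - _); lra.
by rewrite mulNr; congr (- _); lra.
Qed.

End Rotation.

(** The angle depends only on the level and on the distance from the axis, both of which the
    rotation preserves; the opposite sign therefore undoes it. *)
Lemma rotK i e sigma : cancel (rot i e sigma) (rot i (~~ e) sigma).
Proof.
move=> u; set v := rot i e sigma u; set a := rot_angle i e sigma u.
have xE : rot_x i v = rot_x i u * cos a - py u * sin a.
  by rewrite {1}/rot_x /v /rot /px /= addrC addKr.
have yE : py v = rot_x i u * sin a + py u * cos a by [].
have rE : rot_x i v ^+ 2 + py v ^+ 2 = rot_x i u ^+ 2 + py u ^+ 2.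
  have := cos2Dsin2 a; rewrite xE yE.
  move: (cos a) (sin a) (rot_x i u) (py u) => c s x y cs.
  transitivity ((x ^+ 2 + y ^+ 2) * (c ^+ 2 + s ^+ 2)); first by ring.
  by rewrite cs mulr1.
have aE : rot_angle i (~~ e) sigma v = - a.
  by rewrite /rot_angle rE /a /rot_angle /v /=; case: (e); rewrite ?expr1 ?expr0 ?mulN1r ?mul1r ?opprK.
rewrite {1}/rot aE xE yE cosN sinN.
have cs := cos2Dsin2 a; move: (cos a) (sin a) cs => c s cs.
case: u @v @a xE yE rE aE => [[x y] z] v a _ _ _ _.
rewrite /rot_x /px /py /pz /=; congr ((_, _), _).
  transitivity (i%:R + 2^-1 + (x - (i%:R + 2^-1)) * (c ^+ 2 + s ^+ 2)); first by ring.
  by rewrite cs mulr1 addrC subrK.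
transitivity (y * (c ^+ 2 + s ^+ 2)); first by ring.
by rewrite cs mulr1.
Qed.

Lemma rot_homeo i e sigma : continuous sigma ->
  level_homeo (rot i e sigma) (rot i (~~ e) sigma).
Proof.
move=> cs; split=> //; [exact: rot_continuous..|exact: rotK|].
by move=> u; have := @rotK i (~~ e) sigma u; rewrite negbK.
Qed.

Definition strands : set (R3 R) := [set u | py u = 0 /\ exists2 j, (j < 4)%N & px u = j%:R].

Lemma strands_rot1 i e u : (i <= 2)%N -> strands u -> strands (rot i e (fun=> 1) u).
Proof.
move=> i2; case: u => [[x y] z] [y0 [j j4 xj]]; rewrite /py /px /= in y0 xj; subst x y.
have [ji|ji] := eqVneq j i; last have [ji1|ji1] := eqVneq j i.+1.
- have := @rot_inner i e (fun=> 1) false z; rewrite ji addr0 => ->.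
  split; rewrite /py /px /= mulr1 ?sinpi ?cospi ?mul0r ?mulr0 ?oppr0 //.
  by exists i.+1; [lia|rewrite -[i.+1%:R]natr1 /= expr0; lra].
- have := @rot_inner i e (fun=> 1) true z; rewrite ji1 -[i.+1%:R]natr1 => ->.
  split; rewrite /py /px /= mulr1 ?sinpi ?cospi ?mul0r ?mulr0 ?oppr0 //.
  by exists i; [lia|rewrite /= expr1; lra].
- by rewrite (@rot_outer i e _ j) //; split=> //; exists j.
Qed.

Lemma strands_rot1P i e u : (i <= 2)%N -> strands (rot i e (fun=> 1) u) <-> strands u.
Proof.
move=> i2; split; last exact: strands_rot1.
by move=> /(strands_rot1 (~~ e) i2); rewrite rotK.
Qed.

Definition ramp k (z : R) : R := clamp (z - k%:R).

Lemma ramp_continuous k : continuous (ramp k).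
Proof.
have cB : continuous (fun z : R => z - k%:R).
  by move=> z; apply: cvgB; [exact: cvg_id|exact: cvg_cst].
by move=> z; apply: (@continuous_comp _ _ _ (fun z : R => z - k%:R) clamp);
  [exact: cB|exact: clamp_continuous].
Qed.

Lemma half_twistP i e k u : (i <= 2)%N -> k%:R <= pz u <= k.+1%:R ->
  half_twist i e k (rot i e (ramp k) u) <-> strands u.
Proof.
move=> i2 zk; have zE z : k%:R <= z <= k.+1%:R -> ramp k z = z - k%:R.
  by move=> zk'; rewrite /ramp clamp_id //; move: zk'; rewrite -natr1; lra.
split.
  suff H v : half_twist i e k v -> exists2 u', strands u' & v = rot i e (ramp k) u'.
    move=> /H[u' su' /(can_inj (@rotK i e (ramp k)))->//].
  case: v => [[x y] z] [zk' [[j [j4 ji ji1 xj y0]]|[d [xE yE]]]].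
    exists ((x, y), z); first by split=> //; exists j.
    by rewrite (@rot_outer i e _ j).
  exists ((i%:R + d%:R, 0), z); last by rewrite rot_inner zE // xE yE.
  by split=> //; exists (i + d)%N; [case: (d); lia|rewrite natrD].
case: u zk => [[x y] z] zk [y0 [j j4 xj]]; rewrite /py /px /pz /= in y0 xj zk; subst x y.
have [ji|ji] := eqVneq j i; last have [ji1|ji1] := eqVneq j i.+1.
- have := @rot_inner i e (ramp k) false z; rewrite ji addr0 => ->.
  by rewrite zE //; split=> //; right; exists false.
- have := @rot_inner i e (ramp k) true z; rewrite ji1 -[i.+1%:R]natr1 => ->.
  by rewrite zE //; split=> //; right; exists true.
- by rewrite (@rot_outer i e _ j) //; split=> //; left; exists j.
Qed.

(** [psi] carries vertical strands to the braid. For one letter it is a rotation whose angle grows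
    to a half turn across the level of the letter and stays there above; the complete half turn
    permutes the strands, so the later letters again start from straight strands. Above the braid
    only the accumulated half turns [th] remain. For the empty word [th] must be the identity, since
    the top and bottom caps then meet directly, and the empty braid contains no strand points,
    whence [w != [::]]. *)
Lemma braid_straight (w : seq (nat * bool)) k : all (fun l => l.1 <= 2)%N w ->
  exists psi psi' th th',
  [/\ level_homeo psi psi', level_homeo th th',
      forall u, (pz u <= k%:R -> psi u = u) /\ ((k + size w)%:R <= pz u -> psi u = th u),
      (forall u, strands (th u) <-> strands u) /\ (w = [::] -> th = id) &
      forall u, braid k w (psi u) <->
        [/\ strands u, k%:R <= pz u <= (k + size w)%:R & w != [::]]].
Proof.
elim: w k => [|[i e] w IH] k /=.
  by exists id, id, id, id; split=> //; try exact: level_homeo_id; move=> u; split=> // -[].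
move=> /andP[i2 /(IH k.+1)[psi [psi' [th [th' [hpsi hth psiE [sth _] bE]]]]]].
have hr := rot_homeo i e (@ramp_continuous k).
have hr1 : level_homeo (rot i e (fun=> 1)) (rot i (~~ e) (fun=> 1)).
  by apply: rot_homeo => z; apply: cvg_cst.
have r1E u : k.+1%:R <= pz u -> rot i e (ramp k) u = rot i e (fun=> 1) u.
  move=> ku; have E : ramp k (pz u) = 1.
    by move: ku; rewrite -[k.+1%:R]natr1 => ku; rewrite /ramp clamp_ge1 //; lra.
  by rewrite /rot /rot_angle E.
have kw : ((k + (size w).+1)%:R : R) = (k.+1 + size w)%:R by rewrite addnS addSn.
have kk : (k%:R : R) <= k.+1%:R by rewrite ler_nat.
have kkw : (k.+1%:R : R) <= (k.+1 + size w)%:R by rewrite ler_nat leq_addr.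
exists (psi \o rot i e (ramp k)), (rot i (~~ e) (ramp k) \o psi').
exists (th \o rot i e (fun=> 1)), (rot i (~~ e) (fun=> 1) \o th'); split.
- exact: level_homeo_comp.
- exact: level_homeo_comp.
- move=> u; split=> uk /=.
    rewrite (psiE _).1; last by rewrite rot_level; apply: le_trans kk.
    by rewrite rot_fixed // /ramp clamp_le0 // subr_le0.
  rewrite kw in uk; rewrite (psiE _).2 ?rot_level // r1E //; exact: le_trans uk.
- split=> // u /=; rewrite sth; exact: strands_rot1P.
- move=> u /=; set v := rot i e (ramp k) u.
  have zv : pz v = pz u by [].
  split.
    move=> [H|/bE[sv]].
      have zk : k%:R <= pz u <= k.+1%:R.
        have [_ _ _ _ /(_ v)] := hpsi; rewrite zv => <-.
        by case: (psi v) H => [[? ?] ?] [].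
      move: H; rewrite (psiE v).1; last by rewrite zv; case/andP: zk.
      by move=> /(half_twistP e i2 zk) su; split=> //; rewrite kw; lra.
    rewrite zv => zk _; rewrite /v r1E in sv; last by case/andP: zk.
    move/(strands_rot1P e _ i2): sv => su; split=> //; rewrite kw; lra.
  move=> [su zk _]; rewrite kw in zk; have [z1|z1] := leP (pz u) k.+1%:R.
    left; rewrite (psiE v).1 //; apply/half_twistP => //; case/andP: zk => -> _; exact: z1.
  right; apply/bE; split; last by case: (w) zk z1 {IH bE psiE kw kkw} => //=; rewrite addn0; lra.
    by rewrite /v r1E ?ltW //; apply/strands_rot1P.
  by rewrite zv ltW //=; case/andP: zk.
Qed.

End Straightening.

(** * Plats as images of the straightened model *)

Section PlatComplement.
Variable R : realType.
Implicit Types (u v : R3 R).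

Lemma strandsP u : strands u <-> py u = 0 /\ exists b, (px u - cap_center R b) ^+ 2 = 4^-1.
Proof.
split=> [[y0 [j j4 xj]]|[y0 [b xb]]]; split=> //.
  rewrite xj; exists (1 < j)%N; rewrite /cap_center expr2.
  by case: j j4 {xj} => [|[|[|[|]]]] //= _; lra.
have : (px u - cap_center R b - 2^-1) * (px u - cap_center R b + 2^-1) = 0.
  by rewrite -subr_sqr xb expr2; lra.
move=> /eqP; rewrite mulf_eq0 => /orP[/eqP E|/eqP E].
  by case: b {xb} E; rewrite /cap_center => E; [exists 3%N|exists 1%N] => //; lra.
by case: b {xb} E; rewrite /cap_center => E; [exists 2%N|exists 0%N] => //; lra.
Qed.

Lemma bottom_capsP u : bottom_caps u <-> pz u <= 0 /\ arcs (fun v => - pz v) u.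
Proof.
case: u => [[x y] z]; split.
  move=> [y0 z0 H]; split=> //; split=> //.
  have m : Num.max 0 (- z) = - z by rewrite max_r // oppr_ge0.
  by case: H => H; [exists false|exists true]; rewrite /bowl /cap_center /px /pz /= m sqrrN.
move=> [z0 [y0 [b]]]; rewrite /bowl /cap_center.
have -> : Num.max 0 (- pz ((x, y), z)) = - z by rewrite max_r // oppr_ge0.
by rewrite sqrrN => H; split=> //; case: b H => H; [right|left].
Qed.

Lemma top_capsP n u : top_caps n u <-> n%:R <= pz u /\ arcs (fun v => pz v - n%:R) u.
Proof.
case: u => [[x y] z]; split.
  move=> [y0 z0 H]; split=> //; split=> //.
  have m : Num.max 0 (z - n%:R) = z - n%:R by rewrite max_r // subr_ge0.
  by case: H => H; [exists false|exists true]; rewrite /bowl /cap_center /px /pz /= m.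
move=> [z0 [y0 [b]]]; rewrite /bowl /cap_center.
have -> : Num.max 0 (pz ((x, y), z) - n%:R) = z - n%:R by rewrite max_r // subr_ge0.
by move=> H; split=> //; case: b H => H; [right|left].
Qed.

Lemma path_functor_comp (X Y : set (R3 R)) (G : groupType) (nu : (R -> R3 R) -> G)
    (f : R3 R -> R3 R) : continuous f -> (forall u, X u -> Y (f u)) ->
  path_functor Y nu -> path_functor X (fun h => nu (f \o h)).
Proof.
move=> cf XY [nuH nuM].
have cf' : {within X, continuous f} by apply: continuous_subspaceT.
split=> [x y h h' /(path_homotopic_comp cf' XY)/nuH//|x y z h h' Ph Ph'].
rewrite -(nuM _ _ _ _ _ (is_path_comp cf' XY Ph) (is_path_comp cf' XY Ph')).
by congr nu; apply/funext => s; rewrite /= /concat; case: ifP.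
Qed.

(** The functor is pulled back along [f \o psi], under which the preimage of [K] is the model [L] of
    [two_generators]. *)
Theorem plat_two_generators (w : seq (nat * bool)) (f g : R3 R -> R3 R)
    (G : groupType) (nu : (R -> R3 R) -> G) (K : set (R3 R)) :
  all (fun l => l.1 <= 2)%N w ->
  continuous f -> continuous g -> cancel f g -> cancel g f -> K = f @` plat w ->
  path_functor (~` K) nu ->
  exists x (a b : R -> R3 R), [/\ is_loop (~` K) x a, is_loop (~` K) x b &
   forall h, is_loop (~` K) x h -> generated (nu a) (nu b) (nu h)].
Proof.
move=> w2 cf cg fK gK KE nuF.
have [psi [psi' [th [th' [hpsi hth psiE [sth th_id] bE]]]]] := @braid_straight R w 0%N w2.
have [cpsi cpsi' psiK psiK' psiz] := hpsi.
have [cth cth' thK thK' thz] := hth.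
pose L : set (R3 R) := psi @^-1` plat w.
set n := (0 + size w)%N in bE psiE; have nE : n = size w by [].
have LE u : L u <-> [\/ bottom_caps u,
    [/\ strands u, 0 <= pz u <= n%:R & w != [::]] | top_caps n (th u)].
  rewrite /L /plat /=; split.
    move=> [[H|/bE//]|H]; last 1 first.
    - have [nz _] := (top_capsP _ _).1 H; rewrite psiz in nz.
      by apply: Or33; rewrite -(psiE u).2.
    - have [z0 _] := (bottom_capsP _).1 H; rewrite psiz in z0.
      by apply: Or31; rewrite -{1}((psiE u).1 z0).
    - by move=> H; apply: Or32.
  move=> [H|H|H]; last 1 first.
  - have [nz _] := (top_capsP _ _).1 H; rewrite thz in nz.
    by right; rewrite (psiE u).2.
  - have [z0 _] := (bottom_capsP _).1 H.
    by left; left; rewrite (psiE u).1.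
  - by left; right; apply/bE.
have w_neq u : 0 < pz u -> pz u <= n%:R -> w != [::].
  by move=> z0 zn; apply/eqP => w0; move: zn; rewrite nE w0 leNgt z0.
(* Since [n] is a natural number, top caps can reach below height 1/2 only when the braid is
   empty. *)
have low_w u : n%:R <= pz u -> pz u < 2^-1 -> w = [::].
  move=> nz z2; apply/eqP; rewrite -size_eq0 -nE -leqn0 -ltnS -(ltr_nat R).
  by apply: le_lt_trans nz _; lra.
have L_low u : L u -> pz u < 2^-1 -> below_caps (fun v => - pz v) u.
  move=> /LE[/bottom_capsP[_ [y0 [b bw]]]|[/strandsP[y0 [b xb]] /andP[z0 _] _]|/top_capsP[]] z2.
  - by split=> //; exists b; rewrite bw.
  - by split=> //; exists b; rewrite /bowl max_l ?oppr_le0 // expr0n addr0 xb.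
  - move: z2; rewrite thz => nz [y0 [b bw]] z2.
    have w0 := low_w u nz z2; rewrite th_id // in y0 bw.
    split=> //; exists b; have n0 : n = 0%N by rewrite nE w0.
    rewrite n0 in nz; rewrite -bw /bowl max_l ?oppr_le0 // expr0n addr0.
    by rewrite lerDl sqr_ge0.
have L_disc b u : bowl b (@pz R) u < 4^-1 -> bowl b (fun v => - pz v) u < 4^-1 -> ~ L u.
  move=> ub1 ub2.
  have circ : (px u - cap_center R b) ^+ 2 + pz u ^+ 2 < 4^-1.
    move: ub1 ub2; rewrite /bowl; have [z0|z0] := leP 0 (pz u).
      by move=> + _.
    by move=> _; rewrite max_r ?sqrrN // oppr_ge0 ltW.
  have z2 : pz u < 2^-1.
    by have := sqr_ge0 (px u - cap_center R b); rewrite [pz u ^+ 2]expr2 in circ; nra.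
  move=> /LE[/bottom_capsP[z0 [y0 [b' bw]]]|[/strandsP[y0 [b' xb]] _ _]|/top_capsP[]].
  - have le4 : bowl b' (fun v => - pz v) u <= 4^-1 by rewrite bw.
    have bb' := bowl_disjoint ub2 le4.
    by move: ub2; rewrite bb' bw ltxx.
  - have le4 : bowl b' (fun v => - `|pz v|) u <= 4^-1.
      by rewrite /bowl max_l ?oppr_le0 // expr0n addr0 xb.
    have bb' := bowl_disjoint ub2 le4.
    by move: circ (sqr_ge0 (pz u)); rewrite bb' xb; lra.
  - rewrite thz => nz [y0 [b' bw]].
    have w0 := low_w u nz z2; rewrite th_id // in y0 bw.
    have le4 : bowl b' (fun v => pz v - n%:R) u <= 4^-1 by rewrite bw.
    have bb' := bowl_disjoint ub2 le4.
    have n0 : n = 0%N by rewrite nE w0.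
    rewrite n0 in nz bw; move: circ bw; rewrite bb' /bowl subr0 max_r //; lra.
have L_bot u : pz u <= 0 -> arcs (fun v => - pz v) u -> L u.
  by move=> z0 Au; apply/LE; apply: Or31; apply/bottom_capsP.
have L_top u : 0 < pz u -> L u <-> arcs (fun v => pz v - n%:R) (th u).
  move=> z0; split.
    move=> /LE[/bottom_capsP[z0' _]|[su /andP[_ zn] _]|/top_capsP[]//]; first by rewrite ltNge z0' in z0.
    have /strandsP[y0 [b xb]] := (sth u).2 su.
    by split=> //; exists b; rewrite /bowl max_l ?thz ?subr_le0 // expr0n addr0.
  move=> Au; apply/LE; have [nz|zn] := leP n%:R (pz u).
    by apply: Or33; apply/top_capsP; rewrite thz.
  apply: Or32; split; last exact: w_neq (ltW zn).
    apply/sth/strandsP; case: Au => y0 [b bw]; split=> //; exists b; move: bw.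
    by rewrite /bowl max_l ?thz ?subr_le0 ?ltW // expr0n addr0.
  by rewrite !ltW.
have fgpsi u : (~` L) u -> (~` K) ((f \o psi) u).
  by move=> nL; rewrite KE => -[v Pv /(can_inj fK) vE]; apply: nL; rewrite /L /= -vE.
have KL v : (~` K) v -> (~` L) ((psi' \o g) v).
  by move=> nK Lv; apply: nK; rewrite KE; exists (g v); rewrite ?gK //; move: Lv; rewrite /L /= psiK'.
have cF : continuous (f \o psi).
  by move=> u; apply: continuous_comp; [exact: cpsi|exact: cf].
have cF' : continuous (psi' \o g).
  by move=> u; apply: continuous_comp; [exact: cg|exact: cpsi'].
have FK v : (f \o psi) ((psi' \o g) v) = v by rewrite /= psiK' gK.
have [x [a [b [Pa Pb gen]]]] := two_generators cth cth' thK thK' thz L_low L_disc L_bot L_top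
  (path_functor_comp cF fgpsi nuF).
exists ((f \o psi) x), ((f \o psi) \o a), ((f \o psi) \o b).
have cFL : {within ~` L, continuous (f \o psi)} by apply: continuous_subspaceT.
split; [exact: is_path_comp Pa|exact: is_path_comp Pb|].
move=> h Ph; have -> : h = (f \o psi) \o ((psi' \o g) \o h) by apply/funext => s; rewrite /= psiK' gK.
apply: gen; have cFK : {within ~` K, continuous (psi' \o g)} by apply: continuous_subspaceT.
have E : (psi' \o g) ((f \o psi) x) = x by rewrite /= fK psiK.
by have := is_path_comp cFK KL Ph; rewrite E.
Qed.

Lemma rational_word_letters m (a : seq int) : all (fun l => l.1 <= 2)%N (rational_word m a).
Proof.
elim: a m => //= c a IH m; rewrite all_cat IH andbT; apply/allP => l.
by move=> /nseqP[-> _] /=; case: m.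
Qed.

End PlatComplement.

(** * Lifting to a covering *)

Section Near.
Variables (R : realType) (T : topologicalType).

Lemma within_interval_near (l r s : R) (f : R -> T) (W : set T) :
  {within `[l, r], continuous f} -> l <= s <= r -> open W -> W (f s) ->
  exists2 e, 0 < e & forall t, l <= t <= r -> `|t - s| < e -> W (f t).
Proof.
move=> /subspace_continuousP /(_ s); rewrite /= in_itv /= => cf slr oW Ws.
have /(cf slr) : nbhs (f s) W by exact: open_nbhs_nbhs.
rewrite /= nbhs_simpl /within /= => /nbhs_ballP[e e0 He].
by exists e => // t t1 te; apply: He; rewrite /= ?in_itv //= -ball_normE /= distrC.
Qed.

Let square : set (R * R) := `[0, 1] `*` `[0, 1].

Lemma within_square_near (x y : R) (F : R * R -> T) (W : set T) :
  {within square, continuous F} -> 0 <= x <= 1 -> 0 <= y <= 1 -> open W -> W (F (x, y)) ->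
  exists2 e, 0 < e & forall a b, 0 <= a <= 1 -> 0 <= b <= 1 ->
    `|a - x| < e -> `|b - y| < e -> W (F (a, b)).
Proof.
move=> /subspace_continuousP /(_ (x, y)) cF x1 y1 oW Ws.
have sxy : square (x, y) by split; rewrite /= in_itv.
have /(cF sxy) : nbhs (F (x, y)) W by exact: open_nbhs_nbhs.
rewrite /= nbhs_simpl /within /= => /nbhs_ballP[e e0 He].
exists e => // a b a1 b1 ae be; apply: He; last by split; rewrite /= in_itv.
by split; rewrite /= -ball_normE /= distrC.
Qed.
End Near.

Section Gluing.
Variables (R : realType) (T U : topologicalType).

Lemma within_continuous_glue (A : set T) (h : T -> R) (m : R) (f g : T -> U) :
  continuous h ->
  {within A `&` [set x | h x <= m], continuous f} ->
  {within A `&` [set x | m <= h x], continuous g} ->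
  (forall x, A x -> h x = m -> f x = g x) ->
  {within A, continuous (fun x => if h x <= m then f x else g x)}.
Proof.
move=> ch /subspace_continuousP cf /subspace_continuousP cg fg.
apply/subspace_continuousP => x Ax W.
have nf : h x <= m -> nbhs (f x) W -> \forall y \near x, A y -> h y <= m -> W (f y).
  move=> hm Wx; have H : \forall y \near x, (A `&` [set x | h x <= m]) y -> W (f y) :=
    cf x (conj Ax hm) W Wx.
  by apply: filterS H => y Hy Ay hy; apply: Hy.
have ng : m <= h x -> nbhs (g x) W -> \forall y \near x, A y -> m <= h y -> W (g y).
  move=> hm Wx; have H : \forall y \near x, (A `&` [set x | m <= h x]) y -> W (g y) :=
    cg x (conj Ax hm) W Wx.
  by apply: filterS H => y Hy Ay hy; apply: Hy.
have nlt : h x < m -> \forall y \near x, h y < m.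
  by move=> hm; have /ch : nbhs (h x) [set z | z < m] by apply: open_nbhs_nbhs; split=> //; exact: open_lt.
have ngt : m < h x -> \forall y \near x, m < h y.
  by move=> hm; have /ch : nbhs (h x) [set z | m < z] by apply: open_nbhs_nbhs; split=> //; exact: open_gt.
move=> Wx; suff : \forall y \near x, A y -> W (if h y <= m then f y else g y) by [].
move: Wx; rewrite /from_subspace; have [hm|hm|hm] := ltgtP (h x) m => Wx.
- apply: filterS2 (nf (ltW hm) Wx) (nlt hm) => y Hf hy Ay.
  by rewrite (ltW hy); apply: Hf => //; exact: ltW.
- apply: filterS2 (ng (ltW hm) Wx) (ngt hm) => y Hg hy Ay.
  by rewrite leNgt hy /=; apply: Hg => //; exact: ltW.
- have Wx' : nbhs (g x) W by rewrite -fg.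
  have hle : h x <= m by rewrite hm.
  have hge : m <= h x by rewrite hm.
  apply: filterS2 (nf hle Wx) (ng hge Wx') => y Hf Hg Ay.
  by case: leP => hy; [apply: Hf|apply: Hg => //; exact: ltW].
Qed.
End Gluing.

Section Lifting.
Variables (R : realType) (B E : topologicalType) (X : set B) (p : E -> B).
Hypothesis cov : is_covering X p.

(** The last clause separates points of one fibre and takes the place of a Hausdorff property of [E]
    in the uniqueness of lifts. *)
Lemma covering_sheet e : exists (U : set B) (V : set E) (s : B -> E),
  [/\ open U /\ U (p e), open V /\ V e, {within U, continuous s},
      (forall u, U u -> V (s u) /\ p (s u) = u) /\ (forall v, V v -> s (p v) = v) &
      forall e', p e' = p e -> e' <> e -> exists V' : set E, [/\ open V', V' e' & V `&` V' = set0]].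
Proof.
have [cp rp loc] := cov.
have Xe : X (p e) by rewrite -rp; exists e.
have [U [oU Ue UX [I [V [oV tV UV sV]]]]] := loc _ Xe.
have mem e' : U (p e') -> exists i, V i e'.
  by move=> Ue'; have : (p @^-1` U) e' by []; rewrite UV => -[i _ Vi]; exists i.
have [i Vi] := mem _ Ue; have [s [cs sU sV']] := sV i.
exists U, (V i), s; split=> // e' pe' ee'.
have [j Vj] : exists j, V j e' by apply: mem; rewrite pe'.
exists (V j); split=> //; apply/seteqP; split=> // z [zi zj].
have ij : i = j by apply: tV => //; exists z.
by apply: ee'; rewrite -(sV' e' _) ?pe' ?sV' // ij.
Qed.

(** Near each parameter the two lifts either lie in a common sheet, where [p] determines them, or in
    disjoint sheets, where they cannot agree at a left end. *)
Lemma lift_unique (l r : R) (d d' : R -> E) : l <= r ->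
  {within `[l, r], continuous d} -> {within `[l, r], continuous d'} ->
  (forall s, l <= s <= r -> p (d s) = p (d' s)) -> d l = d' l ->
  forall s, l <= s <= r -> d s = d' s.
Proof.
move=> lr cd cd' pd dl.
suff : d l = d' l -> forall s, l <= s <= r -> d s = d' s by apply.
apply: (@interval_induction R (fun u v => d u = d' u -> forall s, u <= s <= v -> d s = d' s)) => //.
- move=> x xlr; have [U [V [s [[oU Ux] [oV Vx] cs [sU sV] sep]]]] := covering_sheet (d x).
  have [e1 e10 H1] := within_interval_near cd xlr oV Vx.
  have [dx|dx] := pselect (d' x = d x).
    rewrite -dx in Vx; have [e2 e20 H2] := within_interval_near cd' xlr oV Vx.
    exists (Num.min e1 e2); first by rewrite lt_min e10.
    move=> a b la ab br; rewrite !lt_min => /andP[a1 a2] /andP[b1 b2] _ t /andP[at' tb].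
    have tlr : l <= t <= r by rewrite (le_trans la) ?(le_trans tb).
    have t1 : `|t - x| < e1 by move: a1 b1; rewrite !ltr_norml; lra.
    have t2 : `|t - x| < e2 by move: a2 b2; rewrite !ltr_norml; lra.
    by rewrite -(sV _ (H1 _ tlr t1)) pd // sV //; apply: H2.
  have [|V' [oV' Vx' VV']] := sep (d' x) _ dx; first by rewrite pd.
  have [e2 e20 H2] := within_interval_near cd' xlr oV' Vx'.
  exists (Num.min e1 e2); first by rewrite lt_min e10.
  move=> a b la ab br; rewrite !lt_min => /andP[a1 a2] _ da.
  have alr : l <= a <= r by rewrite la (le_trans ab).
  have : (V `&` V') (d a) by split; [exact: H1|rewrite da; exact: H2].
  by rewrite VV'.
- move=> a b c la ab bc cr Pab Pbc da s /andP[as' sc].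
  have db : d b = d' b by apply: Pab => //; rewrite ab lexx.
  by have [sb|bs] := leP s b; [apply: Pab; rewrite ?as'|apply: Pbc; rewrite ?(ltW bs)].
Qed.

Let rect (a b c d : R) : set (R * R) := [set z | a <= z.1 <= b /\ c <= z.2 <= d].

Let liftable (F : R * R -> B) a b c d := forall e, p e = F (a, c) ->
  exists G : R * R -> E, [/\ {within rect a b c d, continuous G}, G (a, c) = e &
    forall z, rect a b c d z -> p (G z) = F z].

(** The second lift starts at the corner value of the first; uniqueness of path lifts makes them
    agree along the whole common edge. *)
Lemma liftable_glue2 F a b c m d : a <= b -> c <= m -> m <= d ->
  liftable F a b c m -> liftable F a b m d -> liftable F a b c d.
Proof.
move=> ab cm md L1 L2 e pe; have [G1 [c1 G1e pG1]] := L1 e pe.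
have [|G2 [c2 G2e pG2]] := L2 (G1 (a, m)).
  by apply: pG1; split; rewrite /= ?lexx ?ab ?cm.
have edge t : a <= t <= b -> G1 (t, m) = G2 (t, m).
  apply: (@lift_unique a b (fun t => G1 (t, m)) (fun t => G2 (t, m))) => //.
  - apply: (@within_continuous_comp_in _ _ _ _ _ (fun t : R => (t, m)) G1 _ _ c1).
      by apply: continuous_subspaceT; apply: continuous_pair => s; [exact: cvg_id|exact: cvg_cst].
    by move=> s; rewrite /= in_itv /= => s1; split; rewrite /= ?cm ?lexx.
  - apply: (@within_continuous_comp_in _ _ _ _ _ (fun t : R => (t, m)) G2 _ _ c2).
      by apply: continuous_subspaceT; apply: continuous_pair => s; [exact: cvg_id|exact: cvg_cst].
    by move=> s; rewrite /= in_itv /= => s1; split; rewrite /= ?md ?lexx.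
  - by move=> s s1; rewrite pG1 ?pG2 //; split; rewrite /= ?md ?cm ?lexx.
exists (fun z => if z.2 <= m then G1 z else G2 z); split.
- apply: within_continuous_glue; first by move=> z; apply: cvg_snd.
  + by apply: continuous_subspaceW c1 => z [[z1 z2] /= zm]; split=> //; rewrite zm; case/andP: z2 => ->.
  + by apply: continuous_subspaceW c2 => z [[z1 z2] /= zm]; split=> //; rewrite zm; case/andP: z2 => _ ->.
  + by move=> [t u] [/= z1 z2] ->; apply: edge.
- by rewrite /= cm.
- move=> z [z1 /andP[z2 z3]]; case: leP => zm.
    by apply: pG1; split; rewrite // z2.
  by apply: pG2; split; rewrite // z3 ltW.
Qed.

Lemma liftable_glue1 F a m b c d : c <= d -> a <= m -> m <= b ->
  liftable F a m c d -> liftable F m b c d -> liftable F a b c d.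
Proof.
move=> cd am mb L1 L2 e pe; have [G1 [c1 G1e pG1]] := L1 e pe.
have [|G2 [c2 G2e pG2]] := L2 (G1 (m, c)).
  by apply: pG1; split; rewrite /= ?lexx ?cd ?am.
have edge t : c <= t <= d -> G1 (m, t) = G2 (m, t).
  apply: (@lift_unique c d (fun t => G1 (m, t)) (fun t => G2 (m, t))) => //.
  - apply: (@within_continuous_comp_in _ _ _ _ _ (fun t : R => (m, t)) G1 _ _ c1).
      by apply: continuous_subspaceT; apply: continuous_pair => s; [exact: cvg_cst|exact: cvg_id].
    by move=> s; rewrite /= in_itv /= => s1; split; rewrite /= ?am ?lexx.
  - apply: (@within_continuous_comp_in _ _ _ _ _ (fun t : R => (m, t)) G2 _ _ c2).
      by apply: continuous_subspaceT; apply: continuous_pair => s; [exact: cvg_cst|exact: cvg_id].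
    by move=> s; rewrite /= in_itv /= => s1; split; rewrite /= ?mb ?lexx.
  - by move=> s s1; rewrite pG1 ?pG2 //; split; rewrite /= ?mb ?am ?lexx.
exists (fun z => if z.1 <= m then G1 z else G2 z); split.
- apply: within_continuous_glue; first by move=> z; apply: cvg_fst.
  + by apply: continuous_subspaceW c1 => z [[z1 z2] /= zm]; split=> //; rewrite zm; case/andP: z1 => ->.
  + by apply: continuous_subspaceW c2 => z [[z1 z2] /= zm]; split=> //; rewrite zm; case/andP: z1 => _ ->.
  + by move=> [t u] [/= z1 z2] tm; rewrite tm; apply: edge.
- by rewrite /= am.
- move=> z [/andP[z2 z3] z1]; case: leP => zm.
    by apply: pG1; split; rewrite // z2.
  by apply: pG2; split; rewrite // z3 ltW.
Qed.

Lemma square_lift (F : R * R -> B) e :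
  {within [set` `[0, 1]] `*` [set` `[0, 1]], continuous F} ->
  (forall x y, 0 <= x <= 1 -> 0 <= y <= 1 -> X (F (x, y))) -> p e = F (0, 0) ->
  exists G : R * R -> E, [/\ {within [set` `[0, 1]] `*` [set` `[0, 1]], continuous G}, G (0, 0) = e &
    forall x y, 0 <= x <= 1 -> 0 <= y <= 1 -> p (G (x, y)) = F (x, y)].
Proof.
move=> cF FX pe.
have sqE : [set` `[0, 1]] `*` [set` `[0, 1]] = rect 0 1 0 1.
  by apply/seteqP; split=> z [] /=; rewrite !in_itv.
have local x y : 0 <= x <= 1 -> 0 <= y <= 1 -> exists2 eps, 0 < eps &
    forall a b c d, 0 <= a -> a <= b -> b <= 1 -> 0 <= c -> c <= d -> d <= 1 ->
      `|a - x| < eps -> `|b - x| < eps -> `|c - y| < eps -> `|d - y| < eps -> liftable F a b c d.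
  move=> x1 y1; have [cp rp loc] := cov.
  have [U [oU Ux UX [I [V [oV tV UV sV]]]]] := loc _ (FX x y x1 y1).
  have [eps eps0 H] := within_square_near cF x1 y1 oU Ux.
  exists eps => // a b c d a0 ab b1 c0 cd d1 ax bx cy dy f pf.
  have FU z : rect a b c d z -> U (F z).
    case: z => u v [/= /andP[z1 z2] /andP[z3 z4]]; apply: H.
    - by rewrite (le_trans a0) //= (le_trans z2).
    - by rewrite (le_trans c0) //= (le_trans z4).
    - by move: ax bx; rewrite !ltr_norml; lra.
    - by move: cy dy; rewrite !ltr_norml; lra.
  have acr : rect a b c d (a, c) by split; rewrite /= lexx ?ab ?cd.
  have : (p @^-1` U) f by rewrite /= pf; apply: FU.
  rewrite UV => -[i _ Vi]; have [s [cs sU sV']] := sV i.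
  exists (s \o F); split.
  - apply: within_continuous_comp_in cs => //.
    apply: continuous_subspaceW cF; rewrite sqE => -[u v] [/= /andP[z1 z2] /andP[z3 z4]].
    by split; rewrite /= ?(le_trans a0 z1) ?(le_trans c0 z3) /= ?(le_trans z2) ?(le_trans z4).
  - by rewrite /= -pf sV'.
  - by move=> z /FU/sU[].
(* Subdivision in the second variable gives lifts over thin strips around each [x]; subdivision in
   the first variable then joins the strips. *)
have tube x : 0 <= x <= 1 -> exists2 eps, 0 < eps & forall a b, 0 <= a -> a <= b -> b <= 1 ->
    `|a - x| < eps -> `|b - x| < eps -> liftable F a b 0 1.
  move=> x1; apply: (@interval_induction R (fun c d => exists2 eps, 0 < eps &
    forall a b, 0 <= a -> a <= b -> b <= 1 ->
    `|a - x| < eps -> `|b - x| < eps -> liftable F a b c d)).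
  - exact: ler01.
  - move=> y y1; have [eps eps0 H] := local x y x1 y1; exists eps => // c d c0 cd d1 cy dy.
    by exists eps => // a b a0 ab b1 ax bx; apply: H.
  - move=> c m d c0 cm md d1 [e1 e10 H1] [e2 e20 H2].
    exists (Num.min e1 e2); first by rewrite lt_min e10.
    move=> a b a0 ab b1; rewrite !lt_min => /andP[a1 a2] /andP[b1' b2].
    by apply: (liftable_glue2 ab cm md); [apply: H1|apply: H2].
suff : liftable F 0 1 0 1.
  move=> /(_ e pe)[G [cG G0 pG]]; exists G; rewrite sqE; split=> // x y x1 y1.
  by apply: pG.
apply: (@interval_induction R (fun a b => liftable F a b 0 1)); first exact: ler01.
  by move=> x x1; have [eps eps0 H] := tube x x1; exists eps => // a b a0 ab b1 ax bx; apply: H.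
by move=> a m b a0 am mb b1; apply: liftable_glue1.
Qed.

Definition lifts (f : R -> B) (e : E) (d : R -> E) (e' : E) : Prop :=
  is_path setT e e' d /\ forall s, 0 <= s <= 1 -> p (d s) = f s.

Lemma path_lift x y (f : R -> B) e : is_path X x y f -> p e = x ->
  exists d e', lifts f e d e'.
Proof.
move=> [cf f0 f1 Xf] pe.
have [|||G [cG G0 pG]] := @square_lift (fun z => f z.2) e.
- apply: (@within_continuous_comp_in (R * R)%type R B ([set` `[0, 1]] `*` [set` `[0, 1]]) [set` `[0, 1]]
    snd f _ _ cf).
    by apply: continuous_subspaceT => z; apply: cvg_snd.
  by move=> z [].
- by move=> a b _ b1; apply: Xf; rewrite in01.
- by rewrite pe.
exists (fun s => G (0, s)), (G (0, 1)); split; last by move=> s s1; rewrite pG ?lexx ?ler01.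
split=> //; apply: (@within_continuous_comp_in _ _ _ _ _ (fun s : R => (0 : R, s)) G _ _ cG).
  by apply: continuous_subspaceT; apply: continuous_pair => s; [exact: cvg_cst|exact: cvg_id].
by move=> s s1; split; rewrite /= ?in_itv /= ?lexx ?ler01.
Qed.

Lemma lifts_unique f e d d' e1 e2 : lifts f e d e1 -> lifts f e d' e2 ->
  e1 = e2 /\ forall s, 0 <= s <= 1 -> d s = d' s.
Proof.
move=> [[cd d0 d1 _] pd] [[cd' d0' d1' _] pd'].
have H : forall s, 0 <= s <= 1 -> d s = d' s.
  apply: (@lift_unique 0 1); [exact: ler01|exact: cd|exact: cd'| |by rewrite d0 d0'].
  by move=> s s1; rewrite pd ?pd'.
by split=> //; rewrite -d1 -d1'; apply: H; rewrite lexx ler01.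
Qed.

(** In the lifted square the two edges over the fixed end points lift constant paths and are
    constant by uniqueness; the other two edges are the given lifts. *)
Lemma homotopy_lift x y f g e d e1 d' e2 : path_homotopic X x y f g ->
  lifts f e d e1 -> lifts g e d' e2 -> e1 = e2 /\ path_homotopic setT e e1 d d'.
Proof.
move=> [H [cH Hf Hx XH]] Ld Ld'.
have z1 : 0 <= (0 : R) <= 1 by rewrite lexx ler01.
have o1 : 0 <= (1 : R) <= 1 by rewrite lexx ler01.
have [[cd d0 d1 _] pd] := Ld; have [[cd' d0' d1' _] pd'] := Ld'.
have [||G [cG G0 pG]] := @square_lift H e cH.
- by move=> a b a1 b1; apply: XH; rewrite in01.
- by rewrite -d0 pd // -(Hf 0 _).1 ?in01.
have mk (q : R -> R * R) : continuous q ->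
    (forall s, 0 <= s <= 1 -> ([set` `[0, 1]] `*` [set` `[0, 1]]) (q s)) ->
    {within `[0, 1], continuous (G \o q)}.
  move=> cq Sq; apply: within_continuous_comp_in cG; first exact: continuous_subspaceT.
  by move=> s; rewrite /= in_itv; apply: Sq.
have sq a b : 0 <= a <= 1 -> 0 <= b <= 1 -> ([set` `[0, 1]] `*` [set` `[0, 1]]) (a : R, b : R).
  by move=> a1 b1; split; rewrite /= in_itv.
have cl (a : R) : continuous (fun s : R => (a, s)).
  by apply: continuous_pair => s; [exact: cvg_cst|exact: cvg_id].
have cr (a : R) : continuous (fun s : R => (s, a)).
  by apply: continuous_pair => s; [exact: cvg_id|exact: cvg_cst].
have Lbot : lifts (cst x) e (fun s => G (s, 0)) (G (1, 0)).
  split; first by split=> //; apply: (mk (fun s => (s, 0)) (cr 0)) => s s1; apply: sq.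
  by move=> s s1; rewrite pG //; case: (Hx s); rewrite ?in01.
have px : p e = x by rewrite -d0 pd // -(Hf 0 _).1 ?in01 // (Hx 0 _).1 // in01.
have Lcst w : lifts (cst (p w)) w (cst w) w.
  by split=> //; exact: is_path_cst.
have Lcst' : lifts (cst x) e (cst e) e by rewrite -px; exact: Lcst.
have [G10 Gb] := lifts_unique Lbot Lcst'.
have Lleft : lifts f e (fun s => G (0, s)) (G (0, 1)).
  split; first by split=> //; apply: (mk (fun s => (0, s)) (cl 0)) => s s1; apply: sq.
  by move=> s s1; rewrite pG //; case: (Hf s); rewrite ?in01.
have [E1 Gl] := lifts_unique Lleft Ld.
have Lright : lifts g e (fun s => G (1, s)) (G (1, 1)).
  split; first by split=> //; apply: (mk (fun s => (1, s)) (cl 1)) => s s1; apply: sq.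
  by move=> s s1; rewrite pG //; case: (Hf s); rewrite ?in01.
have [E2 Gr] := lifts_unique Lright Ld'.
have Ltop : lifts (cst y) (G (0, 1)) (fun s => G (s, 1)) (G (1, 1)).
  split; first by split=> //; apply: (mk (fun s => (s, 1)) (cr 1)) => s s1; apply: sq.
  by move=> s s1; rewrite pG //; case: (Hx s); rewrite ?in01.
have py : p (G (0, 1)) = y by rewrite pG //; case: (Hx 0); rewrite ?in01.
have Lcst1 : lifts (cst y) (G (0, 1)) (cst (G (0, 1))) (G (0, 1)) by rewrite -py; exact: Lcst.
have [E3 Gt] := lifts_unique Ltop Lcst1.
split; first by rewrite -E1 -E2 E3.
exists G; split=> //.
- by move=> s; rewrite in01 => s1; rewrite Gl // Gr.
- by move=> r; rewrite in01 => r1; rewrite Gb // Gt // E1.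
Qed.

End Lifting.

(** * First homology in terms of paths *)

Section SimplexMaps.
Variables (R : realType) (E : topologicalType).

Definition simplex_map n (F : 'rV[R]_n.+1 -> E) (cF : continuous F) (v : simplex R n) : E :=
  F (set_val v).

Lemma simplex_map_continuous n (F : 'rV[R]_n.+1 -> E) (cF : continuous F) :
  continuous (simplex_map cF).
Proof.
move=> v; apply: (@continuous_comp _ _ _ (set_val : simplex R n -> _) F).
  exact: initial_continuous.
exact: cF.
Qed.

HB.instance Definition _ n F cF :=
  @isContinuous.Build (simplex R n) E (@simplex_map n F cF)
    (@simplex_map_continuous n F cF).

Definition singular_of n (F : 'rV[R]_n.+1 -> E) (cF : continuous F) : singular_simplex R n E :=
  simplex_map cF.

Definition chain_boundary : {pred chain R 1 E} :=
  fun c => `[< exists d : chain R 2 E, boundary d = c >].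

Lemma chain_boundary_zmod : zmod_closed chain_boundary.
Proof.
split=> [|x y /asboolP[c cE] /asboolP[d dE]]; apply/asboolP.
  by exists 0; rewrite raddf0.
by exists (c - d); rewrite raddfB /= cE dE.
Qed.

HB.instance Definition _ := GRing.isZmodClosed.Build (chain R 1 E) chain_boundary
  chain_boundary_zmod.

(* Chains of paths that need not be closed, up to homology.                    *)
Definition path_classes := Quotient.quot chain_boundary.

HB.instance Definition _ := GRing.Zmodule.on path_classes.

Definition chain_class (c : chain R 1 E) : path_classes :=
  (\pi_(Quotient.quot chain_boundary) c)%qT.

Lemma chain_class_additive : zmod_morphism chain_class.
Proof. exact: raddfB. Qed.

HB.instance Definition _ :=
  GRing.isZmodMorphism.Build (chain R 1 E) path_classes chain_class chain_class_additive.

Lemma chain_classP (c : chain R 1 E) :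
  chain_class c = 0 <-> exists d : chain R 2 E, boundary d = c.
Proof.
split=> [/eqP|[d dE]].
  rewrite -[0](raddf0 chain_class) -Quotient.idealrBE subr0 => /asboolP[d dE].
  by exists d.
apply/eqP; rewrite -[0](raddf0 chain_class) -Quotient.idealrBE subr0.
by apply/asboolP; exists d.
Qed.

Lemma chain_class_surj (x : path_classes) : exists c, chain_class c = x.
Proof. by exists (repr x); exact: reprK. Qed.

(** The last barycentric coordinate is the parameter; clamping extends a path on [0, 1] to a
    function on all row vectors. *)
Definition path_fun (f : R -> E) (v : 'rV[R]_2) : E := f (clamp (v 0 1)).

Lemma clamp_path_continuous (f : R -> E) : {within `[0, 1], continuous f} ->
  continuous (f \o @clamp R).
Proof.
move=> /subspace_continuousP cf v.
have h1 (w : R) : [set` `[0, 1]] (clamp w) by rewrite /= in_itv /= clamp01.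
move=> W /(cf _ (h1 v)) H.
have {}H : \forall y \near clamp v, [set` `[0, 1]] y -> W (f y) := H.
have H' : \forall w \near v, [set` `[0, 1]] (clamp w) -> W (f (clamp w)) :=
  @clamp_continuous R v _ H.
by apply: filterS H' => w; apply; exact: h1.
Qed.

Lemma path_fun_continuous (f : R -> E) : {within `[0, 1], continuous f} -> continuous (path_fun f).
Proof.
move=> /clamp_path_continuous cf v.
have cv : continuous (fun v : 'rV[R]_2 => v 0 1) by exact: coord_continuous.
exact: (cvg_comp _ _ (cv v) (cf _)).
Qed.

(** The value 0 is a default for functions that do not give a continuous simplex. *)
Definition path_class (f : R -> E) : path_classes :=
  if pselect (continuous (path_fun f)) is left cf then chain_class << singular_of cf >> else 0.

Lemma path_class_eq f g : (forall s, 0 <= s <= 1 -> f s = g s) -> path_class f = path_class g.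
Proof.
move=> fg; rewrite /path_class; have -> // : path_fun f = path_fun g.
by apply/funext => v; rewrite /path_fun fg // clamp01.
Qed.

Lemma path_classE f (cf : continuous (path_fun f)) :
  path_class f = chain_class << singular_of cf >>.
Proof.
rewrite /path_class; case: pselect => // cf'.
by congr (chain_class << _ >>); apply/continuousEP.
Qed.

Definition segment (F : R * R -> E) (A B : R * R) : R -> E :=
  fun s => F ((1 - s) * A.1 + s * B.1, (1 - s) * A.2 + s * B.2).

Lemma segment_continuous F A B : continuous F -> continuous (segment F A B).
Proof.
move=> cF s; apply: (@continuous_comp _ _ _ (fun s : R => ((1 - s) * A.1 + s * B.1, (1 - s) * A.2 + s * B.2)) F);
  last exact: cF.
have cl (a b : R) : continuous (fun s : R => (1 - s) * a + s * b).
  move=> r; apply: cvgD; apply: cvgM; [|exact: cvg_cst|exact: cvg_id|exact: cvg_cst].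
  by apply: cvgB; [exact: cvg_cst|exact: cvg_id].
exact: (continuous_pair (cl _ _) (cl _ _)).
Qed.


Lemma path_class_continuous f : continuous f ->
  exists cf : continuous (path_fun f), path_class f = chain_class << singular_of cf >>.
Proof.
move=> cf; have cf' := path_fun_continuous (continuous_subspaceT cf).
by exists cf'; apply: path_classE.
Qed.

Definition triangle (F : R * R -> E) (A B C : R * R) (v : 'rV[R]_3) : E :=
  F (v 0 0 * A.1 + v 0 1 * B.1 + v 0 ord_max * C.1,
     v 0 0 * A.2 + v 0 1 * B.2 + v 0 ord_max * C.2).

Lemma triangle_continuous F A B C : continuous F -> continuous (triangle F A B C).
Proof.
move=> cF v.
have cl (a b c : R) : continuous (fun v : 'rV[R]_3 => v 0 0 * a + v 0 1 * b + v 0 ord_max * c).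
  have cv i k : continuous (fun v : 'rV[R]_3 => v 0 i * k).
    move=> w; have ci : continuous (fun v : 'rV[R]_3 => v 0 i) by exact: coord_continuous.
    exact: (cvgM (ci w) (cvg_cst k)).
  move=> w; exact: (cvgD (cvgD (cv 0 a w) (cv 1 b w)) (cv ord_max c w)).
have cp := continuous_pair (cl A.1 B.1 C.1) (cl A.2 B.2 C.2).
exact: (cvg_comp _ _ (cp v) (cF _)).
Qed.

Lemma simplex1P (v : simplex R 1) :
  (set_val v : 'rV[R]_2) 0 0 = 1 - (set_val v : 'rV[R]_2) 0 1 /\
  0 <= (set_val v : 'rV[R]_2) 0 1 <= 1.
Proof.
have [v0 v1] := set_mem (valP v); move: v1; rewrite big_ord_recl big_ord1.
have -> : fintype.lift ord0 ord0 = 1 :> 'I_2 by apply/val_inj.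
have := v0 0; have := v0 1; rewrite /set_val /=.
move: (_ 0 0) (_ 0 1) => a b b0 a0 ab; split; lra.
Qed.

Lemma insert0_lift n (i : 'I_n.+2) (k : 'I_n.+1) (j : 'I_n.+2) (w : 'rV[R]_n.+1) :
  j = fintype.lift i k -> insert0 i w 0 j = w 0 k.
Proof. by move=> ->; rewrite mxE liftK. Qed.

Lemma insert0_same n (i j : 'I_n.+2) (w : 'rV[R]_n.+1) : j = i -> insert0 i w 0 j = 0.
Proof. by move=> ->; rewrite mxE unlift_none. Qed.

(** This is the boundary of the singular simplex [triangle F A B C]. Degenerate triangles give the
    rules for constants, concatenations and reversals. *)
Lemma path_class_triangle F A B C : continuous F ->
  path_class (segment F A C) = path_class (segment F A B) + path_class (segment F B C).
Proof.
move=> cF; have [cAC ->] := path_class_continuous (@segment_continuous F A C cF).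
have [cAB ->] := path_class_continuous (@segment_continuous F A B cF).
have [cBC ->] := path_class_continuous (@segment_continuous F B C cF).
pose s : singular_simplex R 2 E := singular_of (@triangle_continuous F A B C cF).
have fE (X Y : R * R) (cXY : continuous (path_fun (segment F X Y))) (i : 'I_3) :
    (forall v : simplex R 1, triangle F A B C (insert0 i (set_val v)) = F (
      (set_val v : 'rV[R]_2) 0 0 * X.1 + (set_val v : 'rV[R]_2) 0 1 * Y.1,
      (set_val v : 'rV[R]_2) 0 0 * X.2 + (set_val v : 'rV[R]_2) 0 1 * Y.2)) ->
    (s \o @face R 1 i : singular_simplex R 1 E) = singular_of cXY.
  move=> H; apply/continuousEP => v.
  have [v0 v1] := simplex1P v.
  transitivity (triangle F A B C (insert0 i (set_val v))); first by [].
  by rewrite H /= /simplex_map /path_fun /segment clamp_id // v0.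
suff H : chain_class (boundary << s >>) = 0.
  move: H; rewrite boundaryU big_ord_recl big_ord_recl big_ord1.
  set i1 := fintype.lift ord0 ord0; set i2 := fintype.lift ord0 (fintype.lift ord0 ord0).
  have -> : (-1) ^+ i1 = -1 :> int by [].
  have -> : (-1) ^+ i2 = 1 :> int by [].
  rewrite expr0 !scale1r scaleN1r (fE B C cBC) 1?(fE A C cAC) 1?(fE A B cAB).
  - rewrite !raddfD /= raddfN /=.
    set x := chain_class << singular_of cAC >>; set y := chain_class << singular_of cAB >>.
    set z := chain_class << singular_of cBC >> => H.
    by apply: (addIr (- x)); rewrite subrr -H [y + z]addrC -addrA [y - x]addrC.
  - move=> v; rewrite /triangle (@insert0_same _ i2 ord_max); last by apply/val_inj.
    rewrite (@insert0_lift _ i2 0 0) ?(@insert0_lift _ i2 1 1); try by apply/val_inj.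
    by rewrite !mul0r !addr0.
  - move=> v; rewrite /triangle (@insert0_same _ i1 1); last by apply/val_inj.
    rewrite (@insert0_lift _ i1 0 0) ?(@insert0_lift _ i1 1 ord_max); try by apply/val_inj.
    by rewrite !mul0r !addr0.
  - move=> v; rewrite /triangle (@insert0_same _ ord0 0) //.
    rewrite (@insert0_lift _ ord0 0 1) ?(@insert0_lift _ ord0 1 ord_max); try by apply/val_inj.
    by rewrite !mul0r !add0r.
by apply/chain_classP; exists << s >>.
Qed.

Lemma path_class_cst e : path_class (cst e) = 0.
Proof.
have c : continuous (fun _ : R * R => e) by move=> z; apply: cvg_cst.
have := @path_class_triangle (fun _ => e) 0 0 0 c.
by rewrite -[X in X = _]addr0 => /addrI.
Qed.

Let clamp2 (z : R * R) : R * R := (clamp z.1, clamp z.2).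

Lemma path_class_homotopic X x y f g : path_homotopic X x y f g ->
  path_class f = path_class g.
Proof.
move=> [H [cH Hf Hx _]].
have m (s : R) : 0 <= s <= 1 -> s \in `[0, 1] by rewrite in01.
have c1 : continuous (fun z : R * R => clamp z.1).
  by move=> z; apply: cvg_comp (@cvg_fst _ _ _ _ _) _; apply: clamp_continuous.
have c2 : continuous (fun z : R * R => clamp z.2).
  by move=> z; apply: cvg_comp (@cvg_snd _ _ _ _ _) _; apply: clamp_continuous.
have cc : continuous clamp2 by exact: (continuous_pair c1 c2).
have cF : continuous (H \o clamp2).
  rewrite continuous_subspace_setT.
  apply: (@within_continuous_comp_in _ _ _ _ _ clamp2 H _ _ cH).
    exact: continuous_subspaceT.
  by move=> z _; split; rewrite /= in_itv /= clamp01.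
(* The diagonal divides the square into two triangles; of the four sides two are constant paths with
   class 0. *)
have T1 := @path_class_triangle _ (0, 0) (0, 1) (1, 1) cF.
have T2 := @path_class_triangle _ (0, 0) (1, 0) (1, 1) cF.
have E1 : path_class (segment (H \o clamp2) (0, 0) (0, 1)) = path_class f.
  apply: path_class_eq => s s1; rewrite /segment /clamp2 /= !mulr0 !mulr1 !add0r.
  by rewrite clamp_id ?lexx ?ler01 // clamp_id //; case: (Hf s (m s s1)).
have E2 : path_class (segment (H \o clamp2) (1, 0) (1, 1)) = path_class g.
  apply: path_class_eq => s s1; rewrite /segment /clamp2 /= !mulr0 !mulr1 !add0r subrK.
  by rewrite clamp_id ?lexx ?ler01 // clamp_id //; case: (Hf s (m s s1)).
have E3 : path_class (segment (H \o clamp2) (0, 1) (1, 1)) = 0.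
  rewrite -(path_class_cst y); apply: path_class_eq => s s1.
  rewrite /segment /clamp2 /= !mulr0 !mulr1 !add0r subrK.
  by rewrite clamp_id // clamp_id ?lexx ?ler01 //; case: (Hx s (m s s1)).
have E4 : path_class (segment (H \o clamp2) (0, 0) (1, 0)) = 0.
  rewrite -(path_class_cst x); apply: path_class_eq => s s1.
  rewrite /segment /clamp2 /= !mulr0 !mulr1 !add0r.
  by rewrite clamp_id // clamp_id ?lexx ?ler01 //; case: (Hx s (m s s1)).
by rewrite -E1 -E2 -[LHS]addr0 -E3 -T1 T2 E4 add0r.
Qed.

Lemma path_class_concat X x y z f g : is_path X x y f -> is_path X y z g ->
  path_class (concat f g) = path_class f + path_class g.
Proof.
move=> Pf Pg; have [cc _ _ _] := is_path_concat Pf Pg.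
have cF : continuous (fun z : R * R => (concat f g \o @clamp R) z.1).
  by move=> w; apply: cvg_comp (@cvg_fst _ _ _ _ _) _; exact: (clamp_path_continuous cc).
have := @path_class_triangle _ (0, 0) (2^-1, 0) (1, 0) cF.
have -> : path_class (segment (fun z => (concat f g \o @clamp R) z.1) (0, 0) (1, 0)) = path_class (concat f g).
  by apply: path_class_eq => s s1; rewrite /segment /= mulr0 add0r mulr1 clamp_id.
have -> : path_class (segment (fun z => (concat f g \o @clamp R) z.1) (0, 0) (2^-1, 0)) = path_class f.
  apply: path_class_eq => s s1; rewrite /segment /= mulr0 add0r clamp_id /concat; last by lra.
  rewrite ifT; last by lra.
  by rewrite mulrC divfK.
have -> // : path_class (segment (fun z => (concat f g \o @clamp R) z.1) (2^-1, 0) (1, 0)) = path_class g.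
apply: path_class_eq => s s1; rewrite /segment /= mulr1 clamp_id; last by lra.
have -> : (1 - s) * 2^-1 + s = (1 + s) / 2 by lra.
rewrite /concat; case: ifPn => s2.
  have s0 : s = 0 by lra.
  by rewrite s0 addr0 mul1r divff //; case: Pf => _ _ -> _; case: Pg => _ -> _ _.
by congr g; lra.
Qed.

Lemma path_class_reverse X x y f : is_path X x y f ->
  path_class (reverse f) = - path_class f.
Proof.
move=> [cc _ _ _].
have cF : continuous (fun z : R * R => (f \o @clamp R) z.1).
  by move=> w; apply: cvg_comp (@cvg_fst _ _ _ _ _) _; exact: (clamp_path_continuous cc).
have := @path_class_triangle _ (0, 0) (1, 0) (0, 0) cF.
have -> : path_class (segment (fun z => (f \o @clamp R) z.1) (0, 0) (0, 0)) = 0.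
  by rewrite -(path_class_cst (f 0)); apply: path_class_eq => s s1;
    rewrite /segment /= !mulr0 add0r clamp_id ?lexx ?ler01.
have -> : path_class (segment (fun z => (f \o @clamp R) z.1) (0, 0) (1, 0)) = path_class f.
  by apply: path_class_eq => s s1; rewrite /segment /= mulr0 add0r mulr1 clamp_id.
have -> : path_class (segment (fun z => (f \o @clamp R) z.1) (1, 0) (0, 0)) = path_class (reverse f).
  apply: path_class_eq => s s1; rewrite /segment /reverse /= mulr0 addr0 mulr1 clamp_id //; lra.
by move=> /eqP; rewrite eq_sym addrC addr_eq0 => /eqP.
Qed.

Definition edge_point (r : R) : 'rV[R]_2 := \row_j (if j == 0 then 1 - clamp r else clamp r).

Lemma edge_point_simplex r : simplex R 1 (edge_point r).
Proof.
have := clamp01 r => cr.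
split=> [i|]; first by rewrite mxE; case: ifP => _; lra.
by rewrite big_ord_recl big_ord1 !mxE /= subrK.
Qed.

Definition simplex_path (s : singular_simplex R 1 E) (r : R) : E :=
  s (SigSub (mem_set (edge_point_simplex r))).

Lemma edge_point_continuous : continuous edge_point.
Proof.
move=> r A /nbhs_ballP[e e0 eA].
have H : \forall w \near r, ball (clamp r) e (clamp w) :=
  @clamp_continuous R r _ (nbhsx_ballx (clamp r) e e0).
have : \forall w \near r, A (edge_point w); last by [].
apply: filterS H => w; rewrite -ball_normE /= => rw; apply: eA; split=> // i j.
rewrite -ball_normE /= !mxE; case: ifP => // _.
by rewrite opprB addrC addrA subrK distrC.
Qed.

Lemma simplex_path_continuous (s : singular_simplex R 1 E) : continuous (simplex_path s).
Proof.
pose g r : simplex R 1 := SigSub (mem_set (edge_point_simplex r)).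
have cg : continuous g.
  by apply: continuous_comp_initial; exact: edge_point_continuous.
by move=> r; apply: (@continuous_comp _ _ _ g s); [exact: cg|exact: cts_fun].
Qed.

Lemma simplex_path_path (s : singular_simplex R 1 E) :
  is_path setT (simplex_path s 0) (simplex_path s 1) (simplex_path s).
Proof. by split=> //; apply: continuous_subspaceT; exact: simplex_path_continuous. Qed.

Lemma chain_class_simplex (s : singular_simplex R 1 E) :
  chain_class << s >> = path_class (simplex_path s).
Proof.
have [c01 _ _ _] := simplex_path_path s; have cs := path_fun_continuous c01.
rewrite (path_classE cs); congr (chain_class << _ >>); apply/continuousEP => v.
rewrite /= /simplex_map /path_fun /simplex_path; congr (s _); apply/val_inj => /=.
have [v0 v1] := simplex1P v.
apply/rowP => j; rewrite mxE (clamp_id (clamp01 _)) (clamp_id v1).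
by case: ifPn => [/eqP->//|]; case: j => [[|[|]]] //= jlt _; congr (_ _ _); apply/val_inj.
Qed.

Lemma chain_ind n (P : chain R n E -> Prop) : P 0 ->
  (forall x y, P x -> P y -> P (x - y)) ->
  (forall s : singular_simplex R n E, P << s >>) -> forall c, P c.
Proof.
move=> P0 PB Ps c.
have PN x : P x -> P (- x) by move=> /(PB _ _ P0); rewrite sub0r.
have PD x y : P x -> P y -> P (x + y) by move=> Px /PN Py; rewrite -[y]opprK; apply: PB.
rewrite -(freeg_sumE c); elim/big_ind: _ => // s _.
rewrite -[coeff _ _]intz -freegU_mulz.
have Pn (k : nat) : P (<< s >> *+ k).
  by elim: k => [|k IH]; rewrite ?mulr0n // mulrS; apply: PD.
by case: (coeff s c) => k; [exact: Pn|rewrite NegzE mulrNz; apply/PN/Pn].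
Qed.

Lemma path_class_ind (P : path_classes -> Prop) : P 0 ->
  (forall x y, P x -> P y -> P (x - y)) ->
  (forall x y f, is_path setT x y f -> P (path_class f)) -> forall w, P w.
Proof.
move=> P0 PB Pf w; have [c <-] := chain_class_surj w.
elim/chain_ind: c => [|x y Px Py|s]; first by rewrite raddf0.
  by rewrite raddfB; apply: PB.
by rewrite chain_class_simplex; apply: Pf (simplex_path_path s).
Qed.

(* When T joins a base point to each vertex, subtracting cone T (boundary c)   *)
(* from c closes up every simplex of c into a loop at the base point.          *)
Definition cone (T : singular_simplex R 0 E -> singular_simplex R 1 E) :
    chain R 0 E -> chain R 1 E :=
  fglift (fun s => << T s >> : chain R 1 E).

HB.instance Definition _ T :=
  GRing.isZmodMorphism.Build (chain R 0 E) (chain R 1 E) (@cone T) (lift_is_additive _).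

Lemma coneU T s : cone T << s >> = << T s >>.
Proof. by rewrite /cone liftU scale1r. Qed.

Lemma simplex0_subproof : simplex R 0 (const_mx 1).
Proof. by split=> [i|]; rewrite ?big_ord1 mxE. Qed.

Definition simplex0_point : simplex R 0 := SigSub (mem_set simplex0_subproof).

Definition vertex (s : singular_simplex R 0 E) : E := s simplex0_point.

(** A face omits the vertex of its own index, so face 0 is the end of the path, at parameter 1. *)
Lemma face_simplex0 (i : 'I_2) (r : R) : r = (if i == 0 then 1 else 0) ->
  @face R 0 i simplex0_point = SigSub (mem_set (edge_point_simplex r)).
Proof.
move=> rE; apply/val_inj => /=; apply/rowP => j; rewrite [RHS]mxE rE clamp_id; last first.
  by case: ifP; rewrite ?lexx ?ler01.
have [ij|ij] := eqVneq j i.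
  by rewrite (insert0_same _ ij) ij; case: eqP => //; rewrite subrr.
rewrite eq_sym in ij; have [k jk _] := unlift_some ij.
rewrite (insert0_lift _ jk) mxE => {rE jk}.
have [j0|j0] := eqVneq j 0; have [i0|i0] := eqVneq i 0; rewrite ?subr0 //.
  by move: ij; rewrite i0 j0 eqxx.
case/negP: ij; apply/eqP/val_inj => /=.
by case: i j i0 j0 => -[|[|i]] // il [[|[|j]]].
Qed.

End SimplexMaps.

(** * The deck action on path classes *)

Section PathClassMap.
Variables (R : realType) (E : topologicalType).
Variable f : continuousType E E.

Definition path_class_map (x : path_classes R E) : path_classes R E :=
  chain_class (chain_map f (repr x)).

Lemma path_class_map_chain (c : chain R 1 E) :
  path_class_map (chain_class c) = chain_class (chain_map f c).
Proof.
have : chain_class (repr (chain_class c) - c) = 0.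
  by rewrite raddfB /= [chain_class (repr _)]reprK subrr.
move=> /chain_classP[d dE]; apply/eqP; rewrite -subr_eq0 -raddfB /= -raddfB; apply/eqP.
by apply/chain_classP; exists (chain_map f d); rewrite boundary_chain_map dE.
Qed.

Lemma path_class_map_additive : zmod_morphism path_class_map.
Proof.
move=> x y; have [c <-] := chain_class_surj x; have [d <-] := chain_class_surj y.
by rewrite -raddfB !path_class_map_chain !raddfB.
Qed.

HB.instance Definition _ := GRing.isZmodMorphism.Build (path_classes R E) (path_classes R E)
  path_class_map path_class_map_additive.

Lemma path_class_map_path x y (g : R -> E) : is_path setT x y g ->
  path_class_map (path_class g) = path_class (f \o g).
Proof.
move=> Pg; have [cg _ _ _] := Pg.
have cf : continuous f by exact: cts_fun.
have cfg : {within `[0, 1], continuous (f \o g)} by apply: within_continuousS.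
rewrite (path_classE (path_fun_continuous cg)) (path_classE (path_fun_continuous cfg)).
rewrite path_class_map_chain chain_mapU; congr (chain_class << _ >>).
exact/continuousEP.
Qed.
End PathClassMap.

Lemma path_class_mapK (R : realType) (E : topologicalType) (f g : continuousType E E) :
  cancel f g -> cancel (@path_class_map R E f) (@path_class_map R E g).
Proof.
move=> fK x; have [c <-] := chain_class_surj x.
by rewrite !path_class_map_chain (chain_mapK fK).
Qed.

Definition path_module (R : realType) (E : topologicalType) (t : homeomorphism E E) :=
  path_classes R E.

Section PathModule.
Variables (R : realType) (E : topologicalType) (t : homeomorphism E E).

HB.instance Definition _ := GRing.Zmodule.on (path_module R t).

Let tK := @path_class_mapK R E _ _ (homeoK t).
Let tK' := @path_class_mapK R E _ _ (homeo_invK t).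

Definition path_scale (a : laurent) (x : path_module R t) : path_module R t :=
  laurent_act (V := path_classes R E) (path_class_map t) (path_class_map (homeo_inv t)) a x.

HB.instance Definition _ :=
  GRing.Zmodule_isLmodule.Build laurent (path_module R t) (scale := path_scale)
    (laurent_actA tK tK') (laurent_act1 tK tK') (laurent_actDr tK tK') (laurent_actDl tK tK').

Lemma path_scaleX (x : path_module R t) : laurentX *: x = path_class_map t x.
Proof.
apply: (laurent_act_uniq tK tK' (n := 0) (p := 'X)); first by rewrite expr0 mulr1.
by rewrite -['X]/('X^1) poly_actXn.
Qed.

(** The inclusion of cycles modulo boundaries into chains modulo boundaries; being injective and
    linear, it allows computing in H_1 with classes of open paths. *)
Definition loop_class (x : alexander_module R t) : path_module R t :=
  chain_class (val (representative x)).

Lemma loop_class_cycle (c : cycles R E) : loop_class (homology_class c) = chain_class (val c).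
Proof.
have [b bE] := (homology_class_eqP _ _).1 (representativeK (homology_class c)).
by apply/eqP; rewrite -subr_eq0 /loop_class -raddfB; apply/eqP/chain_classP; exists b.
Qed.

Lemma loop_class_inj : injective loop_class.
Proof.
move=> x y; rewrite -[x]representativeK -[y]representativeK !loop_class_cycle.
move=> /eqP; rewrite -subr_eq0 -raddfB => /eqP/chain_classP[b bE].
by apply/homology_class_eqP; exists b.
Qed.

Lemma loop_class_additive : zmod_morphism loop_class.
Proof.
move=> x y; rewrite -[x]representativeK -[y]representativeK -raddfB.
by rewrite !loop_class_cycle raddfB.
Qed.

HB.instance Definition _ := GRing.isZmodMorphism.Build (alexander_module R t) (path_module R t)
  loop_class loop_class_additive.

Lemma loop_class_map (x : alexander_module R t) : loop_class (H1_map t x) = path_class_map t (loop_class x).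
Proof.
by rewrite -[x]representativeK H1_map_class !loop_class_cycle path_class_map_chain.
Qed.

Lemma loop_classZ (a : laurent) (x : alexander_module R t) : loop_class (a *: x) = a *: loop_class x.
Proof.
have [[n q] /= aE] := laurent_repr a; apply/esym.
apply: (laurent_act_uniq tK tK' aE).
have it k y : iter k (path_class_map t) (loop_class y) = loop_class (iter k (H1_map t) y).
  by elim: k => //= k ->; rewrite loop_class_map.
rewrite it (laurent_actE (H1_homeoK t) (H1_homeo_invK t) _ aE) /poly_act raddf_sum.
by apply: eq_bigr => i _; rewrite raddfMz it.
Qed.

End PathModule.

(** * The deck group and the monodromy *)

Lemma int_step_ind (P : int -> Prop) : P 0 -> (forall n, P n -> P (n + 1)) ->
  (forall n, P n -> P (n - 1)) -> forall n, P n.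
Proof.
move=> P0 PS PP; elim/int_ind => // n IH.
  by rewrite -addn1 PoszD; apply: PS.
by rewrite -addn1 PoszD opprD; apply: PP.
Qed.

Section IntPowers.
Variables (A : Type) (f g : A -> A).
Hypotheses (fK : cancel f g) (gK : cancel g f).

Definition zpow (n : int) : A -> A :=
  match n with Posz k => iter k f | Negz k => iter k.+1 g end.

Lemma zpowS n a : zpow (n + 1) a = f (zpow n a).
Proof.
case: n => [n|[|n]]; first by rewrite -PoszD addn1.
  by rewrite /= gK.
by rewrite (_ : Negz n.+1 + 1 = Negz n) /= ?gK // !NegzE; lia.
Qed.

Lemma zpowP n a : zpow (n - 1) a = g (zpow n a).
Proof. by apply: (can_inj fK); rewrite -zpowS subrK gK. Qed.

Lemma zpowD m n a : zpow (m + n) a = zpow m (zpow n a).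
Proof.
elim/int_step_ind: m => [|m IH|m IH]; first by rewrite add0r.
  by rewrite addrAC !zpowS IH.
by rewrite addrAC !zpowP IH.
Qed.

End IntPowers.

Definition laurent_pow (n : int) : laurent :=
  zpow ( *%R laurentX) ( *%R laurentVX) n 1.

Lemma laurentVXK : cancel ( *%R laurentVX) ( *%R laurentX).
Proof. by move=> a; rewrite mulrA laurentXV mul1r. Qed.

Lemma laurentXK : cancel ( *%R laurentX) ( *%R laurentVX).
Proof. by move=> a; rewrite mulrA [laurentVX * _]mulrC laurentXV mul1r. Qed.

Lemma laurent_powS n : laurent_pow (n + 1) = laurentX * laurent_pow n.
Proof. exact: (zpowS laurentVXK). Qed.

Lemma laurent_powP n : laurent_pow (n - 1) = laurentVX * laurent_pow n.
Proof. exact: (zpowP laurentXK laurentVXK). Qed.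

Lemma laurent_pow0 : laurent_pow 0 = 1. Proof. by []. Qed.

Lemma laurent_powD m n : laurent_pow (m + n) = laurent_pow m * laurent_pow n.
Proof.
elim/int_step_ind: m => [|m IH|m IH]; first by rewrite add0r laurent_pow0 mul1r.
  by rewrite addrAC !laurent_powS IH mulrA.
by rewrite addrAC !laurent_powP IH mulrA.
Qed.

Section Bijections.
Variable A : Type.

Record bijection := Bijection {
  bij_fun :> A -> A;
  bij_inv : A -> A;
  bijK : cancel bij_fun bij_inv;
  bij_invK : cancel bij_inv bij_fun }.

Lemma bijection_ext (f g : bijection) : (forall a, f a = g a) -> f = g.
Proof.
case: f g => [f f' fK f'K] [g g' gK g'K] /= fg.
have {}fg : f = g by apply/funext.
subst g; have E : f' = g' by apply/funext => a; rewrite -{2}[a]f'K gK.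
by subst g'; congr Bijection; apply: Prop_irrelevance.
Qed.

Definition bij_one : bijection := @Bijection id id (fun=> erefl) (fun=> erefl).
Definition bij_mul (f g : bijection) : bijection :=
  @Bijection (f \o g) (bij_inv g \o bij_inv f) (can_comp (bijK f) (bijK g))
    (can_comp (bij_invK g) (bij_invK f)).
Definition bij_opp (f : bijection) : bijection :=
  @Bijection (bij_inv f) f (bij_invK f) (bijK f).

HB.instance Definition _ := gen_eqMixin bijection.
HB.instance Definition _ := gen_choiceMixin bijection.

Lemma bij_mulA : associative bij_mul.
Proof. by move=> f g h; apply: bijection_ext. Qed.
Lemma bij_mul1 : left_id bij_one bij_mul.
Proof. by move=> f; apply: bijection_ext. Qed.
Lemma bij_mulr1 : right_id bij_one bij_mul.
Proof. by move=> f; apply: bijection_ext. Qed.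
Lemma bij_mulV : left_inverse bij_one bij_opp bij_mul.
Proof. by move=> f; apply: bijection_ext => a /=; rewrite bijK. Qed.
Lemma bij_mulrV : right_inverse bij_one bij_opp bij_mul.
Proof. by move=> f; apply: bijection_ext => a /=; rewrite bij_invK. Qed.

HB.instance Definition _ := isGroup.Build bijection bij_mulA bij_mul1 bij_mulr1 bij_mulV bij_mulrV.

End Bijections.

Section Deck.
Variables (R : realType) (B E : topologicalType) (X : set B) (p : E -> B).
Variable t : homeomorphism E E.
Hypothesis hp : is_commutator_covering R X p.
Hypothesis ht : is_deck_generator R X p t.

Let ti : continuousType E E := homeo_inv t.
Let Q : lmodType laurent := path_module R t.
Let pc (f : R -> E) : Q := path_class f.

Let cov : is_covering X p. Proof. by case: hp. Qed.

Definition deck (n : int) : E -> E := zpow t ti n.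

Lemma deckS n e : deck (n + 1) e = t (deck n e).
Proof. exact: (zpowS (homeo_invK t)). Qed.

Lemma deckP n e : deck (n - 1) e = ti (deck n e).
Proof. exact: (zpowP (homeoK t) (homeo_invK t)). Qed.

Lemma deckD m n e : deck (m + n) e = deck m (deck n e).
Proof. exact: (zpowD (homeoK t) (homeo_invK t)). Qed.

Lemma deck_continuous n : continuous (deck n).
Proof.
have ct : continuous t by exact: cts_fun.
have cti : continuous ti by exact: cts_fun.
elim/int_step_ind: n => [|n IH|n IH].
- by move=> e; apply: cvg_id.
- have -> : deck (n + 1) = t \o deck n by apply/funext => e; exact: deckS.
  by move=> e; apply: continuous_comp; [exact: IH|exact: ct].
- have -> : deck (n - 1) = ti \o deck n by apply/funext => e; exact: deckP.
  by move=> e; apply: continuous_comp; [exact: IH|exact: cti].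
Qed.

Lemma p_deck n e : p (deck n e) = p e.
Proof.
have [pt _] := ht.
elim/int_step_ind: n => // n IH; first by rewrite deckS pt.
by rewrite deckP -IH -[in RHS](homeo_invK t (deck n e)) pt.
Qed.

Lemma deck_path n x y (f : R -> E) : is_path setT x y f ->
  is_path setT (deck n x) (deck n y) (deck n \o f).
Proof. by apply: is_path_comp => //; apply/continuous_subspaceT/deck_continuous. Qed.

Lemma path_class_deck n x y (f : R -> E) : is_path setT x y f ->
  pc (deck n \o f) = laurent_pow n *: pc f.
Proof.
move=> Pf.
have mapV (w : Q) : path_class_map ti w = laurentVX *: w.
  by rewrite -[w in RHS](@path_class_mapK R E ti t (homeo_invK t)) -path_scaleX scalerA
    [laurentVX * _]mulrC laurentXV scale1r.
elim/int_step_ind: n => [|n IH|n IH].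
- by rewrite laurent_pow0 scale1r.
- rewrite laurent_powS -scalerA -IH path_scaleX.
  rewrite (path_class_map_path _ (deck_path n Pf)); congr path_class.
  by apply/funext => s; exact: deckS.
- rewrite laurent_powP -scalerA -IH -mapV.
  rewrite (path_class_map_path _ (deck_path n Pf)); congr path_class.
  by apply/funext => s; exact: deckP.
Qed.

Lemma p_continuous : continuous p. Proof. by case: cov. Qed.

Lemma pX e : X (p e). Proof. by case: cov => _ <- _; exists e. Qed.

Lemma lifts_proj e e' (d : R -> E) : is_path setT e e' d -> lifts p (p \o d) e d e'.
Proof. by move=> Pd; split. Qed.

Lemma proj_path e e' (d : R -> E) : is_path setT e e' d -> is_path X (p e) (p e') (p \o d).
Proof.
apply: is_path_comp => [|a _]; last exact: pX.
exact/continuous_subspaceT/p_continuous.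
Qed.

Lemma lifts_path (f : R -> B) e d e' : lifts p f e d e' -> is_path X (p e) (p e') (f : R -> B).
Proof.
move=> [Pd pd]; have [c c0 c1 Xc] := proj_path Pd.
have H s : 0 <= s <= 1 -> (p \o d) s = f s by move=> s1; rewrite /= pd.
split; rewrite -?c0 -?c1 ?H ?lexx ?ler01 //.
  by apply: eq_within_continuous c => s; rewrite inE /= in_itv; apply: H.
by move=> s s1; rewrite -H -?in01 //; apply: Xc.
Qed.

Lemma lifts_concat (f g : R -> B) e d e1 d' e2 : lifts p f e d e1 -> lifts p g e1 d' e2 ->
  lifts p (concat f g) e (concat d d') (e2 : E).
Proof.
move=> [Pd pd] [Pd' pd']; split; first exact: is_path_concat Pd Pd'.
by move=> s s1; rewrite /concat; case: ifPn => s2; [apply: pd|apply: pd']; lra.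
Qed.

Lemma lifts_reverse (f : R -> B) e d e' : lifts p f e d e' -> lifts p (reverse f) e' (reverse d) e.
Proof.
move=> [Pd pd]; split; first exact: is_path_reverse.
by move=> s s1; apply: pd; lra.
Qed.

Lemma lifts_cst e : lifts p (cst (p e) : R -> B) e (cst e) e.
Proof. by split=> //; apply: is_path_cst. Qed.

Lemma lifts_deck n (f : R -> B) e d e' : lifts p f e d e' ->
  lifts p f (deck n e) (deck n \o d) (deck n e').
Proof. by move=> [Pd pd]; split; [exact: deck_path|move=> s s1; rewrite /= p_deck pd]. Qed.

Lemma covering_connected (e e' : E) : exists d : R -> E, is_path setT e e' d.
Proof. by have [_ cE _] := hp; apply: cE. Qed.

(** A path between two points over the origin of [g] projects to a loop that is a power g^n up to
    commutators. Commutators lift to loops and lifts of g^n move points by t^n. Other fibres are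
    carried to this one along a path. *)
Lemma deck_transitive e e' : p e = p e' -> exists n, e' = deck n e.
Proof.
have [pt [x [g [Xx [Pg gen] gt]]]] := ht.
have [cp rp loc] := cov.
have exp_lift n e1 : p e1 = x -> exists d, lifts p (loop_exp x g n) e1 d (deck n e1).
  have Lg e2 : p e2 = x -> exists d, lifts p g e2 d (t e2).
    move=> pe2; have [d [e3 Ld]] := path_lift cov Pg pe2.
    exists d; suff -> : t e2 = e3 by [].
    by apply: (gt _ _ d); [exact: Ld.1|move=> s; rewrite in01; exact: Ld.2].
  have Lg' e2 : p e2 = x -> exists d, lifts p (reverse g) e2 d (ti e2).
    move=> pe2; have [|d Ld] := Lg (ti e2).
      by rewrite -pe2 -[in RHS](homeo_invK t e2) pt.
    by rewrite homeo_invK in Ld; exists (reverse d); apply: lifts_reverse.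
  have pti e2 : p (ti e2) = p e2 by rewrite -[in RHS](homeo_invK t e2) pt.
  have iter_swap k (h : E -> E) e2 : h (iter k h e2) = iter k h (h e2) by rewrite -iterS iterSr.
  case: n => k pe1 /=.
    elim: k e1 pe1 => [|k IH] e1 pe1; first by exists (cst e1); rewrite -pe1; apply: lifts_cst.
    have [d Ld] := Lg _ pe1; have [|d' Ld'] := IH (t e1); first by rewrite pt.
    by exists (concat d d'); rewrite /= iter_swap; apply: lifts_concat Ld Ld'.
  have {}IH : forall k e1, p e1 = x -> exists d,
      lifts p (iter k (concat (reverse g)) (cst x)) e1 d (iter k ti e1).
    elim=> [|k' IH] e2 pe2; first by exists (cst e2); rewrite -pe2; apply: lifts_cst.
    have [d Ld] := Lg' _ pe2; have [|d' Ld'] := IH (ti e2); first by rewrite pti.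
    by exists (concat d d'); rewrite /= iter_swap; apply: lifts_concat Ld Ld'.
  exact: (IH k.+1).
have base e1 e2 : p e1 = x -> p e2 = x -> exists n, e2 = deck n e1.
  move=> p1 p2; have [d Pd] := covering_connected e1 e2.
  have Pf := proj_path Pd; rewrite p1 p2 in Pf.
  have [n Hn] := gen _ Pf.
  (* The lift of g^n starts at t^-n [e2], so that it ends at [e2] and its reverse can follow [d]. *)
  have [|d' Ld'] := exp_lift n (deck (- n) e2); first by rewrite p_deck.
  rewrite -deckD subrr in Ld'.
  have Lc := lifts_concat (lifts_proj Pd) (lifts_reverse Ld').
  have [_ _ comm] := hp.
  have Lp := lifts_path Lc; rewrite p_deck p2 -p1 in Lp.
  have [+ _] := comm e1 _ Lp; rewrite p1 => /(_ Hn)[d0 Pd0 homo].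
  have [E1 _] := homotopy_lift cov homo (lifts_proj Pd0) Lc.
  by exists n; rewrite E1 -deckD subrr.
move=> pe; have : range p x by rewrite rp.
move=> [e1 _ pe1]; have [h Ph] := covering_connected e e1.
have [h' [e1' Lh']] := path_lift cov (proj_path Ph) (esym pe).
have [|n e1E] := base e1 e1' pe1.
  have [_ _ <- _] := Lh'.1; rewrite Lh'.2 ?lexx ?ler01 //=.
  by case: Ph => _ _ -> _.
exists n; have L1 := lifts_reverse (lifts_deck n (lifts_proj Ph)).
rewrite -e1E in L1.
by have [-> _] := lifts_unique cov (lifts_reverse Lh') L1.
Qed.

Lemma deck_unique m n e : deck m e = deck n e -> deck m = deck n.
Proof.
move=> mn; apply/funext => e1; have [h Ph] := covering_connected e e1.
have L1 := lifts_deck m (lifts_proj Ph); have L2 := lifts_deck n (lifts_proj Ph).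
by rewrite mn in L1; have [] := lifts_unique cov L1 L2.
Qed.

(** Exponents of deck transformations are not shown to be unique; equal effect at one point already
    gives equal action on path classes, which makes [monodromy] well defined. *)
Lemma laurent_pow_unique m n e (w : Q) : deck m e = deck n e ->
  laurent_pow m *: w = laurent_pow n *: w.
Proof.
move=> /deck_unique mn; elim/path_class_ind: w => [|x y Hx Hy|x y f Pf].
- by rewrite !scaler0.
- by rewrite !scalerBr Hx Hy.
- by have := path_class_deck m Pf; rewrite mn (path_class_deck n Pf) => <-.
Qed.

End Deck.

(** * Affine bijections of a Laurent module and Nielsen moves *)

Section Affine.
Variable Q : lmodType laurent.

Lemma affK n (u : Q) : cancel (fun w => u + laurent_pow n *: w)
  (fun w => laurent_pow (- n) *: (w - u)).
Proof. by move=> w; rewrite addrC addKr scalerA -laurent_powD addNr laurent_pow0 scale1r. Qed.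

Lemma aff_invK n (u : Q) : cancel (fun w => laurent_pow (- n) *: (w - u))
  (fun w => u + laurent_pow n *: w).
Proof. by move=> w; rewrite scalerA -laurent_powD subrr laurent_pow0 scale1r addrC subrK. Qed.

Definition aff n (u : Q) : bijection Q := Bijection (affK n u) (aff_invK n u).

(** The composition law is the product rule of Fox calculus, and also that of classes of lifted
    paths. *)
Lemma affM i u j v : (aff i u * aff j v)%g = aff (i + j) (u + laurent_pow i *: v).
Proof.
by apply: bijection_ext => w /=; rewrite scalerDr scalerA laurent_powD addrA.
Qed.

Lemma affV i u : (aff i u)^-1%g = aff (- i) (- (laurent_pow (- i) *: u)).
Proof. by apply: bijection_ext => w /=; rewrite scalerBr addrC. Qed.

Section PowerCoset.
Variables (e : int) (c d : Q).

Let C k : Q -> Q := zpow (aff e c) (bij_inv (aff e c)) k.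

Let CD k l w : C (k + l) w = C k (C l w).
Proof. exact: (zpowD (bijK _) (bij_invK _)). Qed.

(** Powers of an affine map are affine, so multiples of [d] can be moved across them. *)
Lemma aff_pow_linear k : exists r, forall w x, C k (w + x) = C k w + r *: x.
Proof.
elim/int_step_ind: k => [|k [r IH]|k [r IH]]; first by exists 1 => w x; rewrite scale1r.
  exists (laurent_pow e * r) => w x; rewrite /C !(zpowS (bij_invK _)) -/(C k _) IH /=.
  by rewrite scalerDr scalerA addrA.
exists (laurent_pow (- e) * r) => w x; rewrite /C !(zpowP (bijK _) (bij_invK _)) -/(C k _) IH /=.
by rewrite addrAC scalerDr scalerA.
Qed.

(* g is the k-th power of w |-> c + t^e w up to a translation by a multiple    *)
(* of d.                                                                       *)
Definition power_coset k (g : bijection Q) : Prop :=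
  exists a, forall w, g w = a *: d + C k w.

Lemma power_cosetM k l g h : power_coset k g -> power_coset l h ->
  power_coset (k + l) (g * h)%g.
Proof.
move=> [a ga] [b hb]; have [r rP] := aff_pow_linear k.
exists (a + r * b) => w; rewrite [LHS]ga hb [b *: d + _]addrC rP CD scalerDl scalerA.
by rewrite -addrA [C k _ + _]addrC.
Qed.

Lemma power_cosetV k g : power_coset k g -> power_coset (- k) (g^-1)%g.
Proof.
move=> [a ga]; have [r rP] := aff_pow_linear (- k).
exists (- (r * a)) => w; have [z ->] : exists z, w = g z by exists (bij_inv g w); rewrite bij_invK.
transitivity z; first exact: bijK.
have C0 : C 0 z = z by [].
by rewrite ga [a *: d + _]addrC rP -CD addNr C0 scalerA scaleNr addrC addrK.
Qed.

Lemma power_coset1 : power_coset 0 1%g.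
Proof. by exists 0 => w; rewrite scale0r add0r. Qed.

Lemma power_coset_gen : power_coset 1 (aff e c).
Proof. by exists 0 => w; rewrite scale0r add0r. Qed.

Lemma power_coset_trans : power_coset 0 (aff 0 d).
Proof.
exists 1 => w; suff : d + laurent_pow 0 *: w = 1 *: d + w by [].
by rewrite laurent_pow0 !scale1r.
Qed.

Lemma power_coset_generated g h k l f : power_coset k g -> power_coset l h ->
  generated g h f -> exists m, power_coset m f.
Proof.
move=> Kg Kh; elim=> [|||x y _ [m Hm] _ [n Hn]|x _ [m Hm]].
- by exists 0; exact: power_coset1.
- by exists k.
- by exists l.
- by exists (m + n); exact: power_cosetM.
- by exists (- m); exact: power_cosetV.
Qed.

Lemma power_coset0 u n : power_coset 0 (aff n u) -> exists a, u = a *: d.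
Proof. by move=> [a /(_ 0)/=]; rewrite scaler0 !addr0; exists a. Qed.

End PowerCoset.

(* Euclid's algorithm on the exponents, by Nielsen moves on the pair.          *)
Lemma nielsen_reduction (P : int -> Q -> Prop) :
  (forall i u j v, P i u -> P j v -> P (i + j) (u + laurent_pow i *: v)) ->
  (forall i u, P i u -> P (- i) (- (laurent_pow (- i) *: u))) ->
  forall i u j v, P i u -> P j v -> exists e c d k l,
    [/\ P 0 d, power_coset e c d k (aff i u) & power_coset e c d l (aff j v)].
Proof.
move=> PM PV i u j v.
have [n] := ubnP (`|i| + `|j|)%N; elim: n i u j v => // n IH i u j v; rewrite ltnS => ijn Pi Pj.
have sym i' u' j' v' : (exists e c d k l,
    [/\ P 0 d, power_coset e c d k (aff j' v') & power_coset e c d l (aff i' u')]) ->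
    exists e c d k l, [/\ P 0 d, power_coset e c d k (aff i' u') & power_coset e c d l (aff j' v')].
  by move=> [e [c [d [k [l [? ? ?]]]]]]; exists e, c, d, l, k.
have [j0|j0] := eqVneq j 0.
  exists i, u, v, 1, 0; split; rewrite -?j0 // ?j0; first exact: power_coset_gen.
  exact: power_coset_trans.
have [i0|i0] := eqVneq i 0.
  exists j, v, u, 0, 1; split; rewrite -?i0 // ?i0; last exact: power_coset_gen.
  exact: power_coset_trans.
have step i1 u1 j1 v1 : P i1 u1 -> P j1 v1 -> (absz (i1 + j1)%R + `|j1| < n)%N ->
    exists e c d k l, [/\ P 0 d, power_coset e c d k (aff i1 u1) & power_coset e c d l (aff j1 v1)].
  move=> P1 P2 lt; have [e [c [d [k [l [Pd K1 K2]]]]]] := IH _ _ _ _ lt (PM _ _ _ _ P1 P2) P2.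
  (* The first map is the product times the inverse of the second, whence the index [k - l]. *)
  exists e, c, d, (k - l), l; split=> //.
  have := power_cosetM K1 (power_cosetV K2); rewrite -affM mulgK; exact.
have step' i1 u1 j1 v1 : P i1 u1 -> P j1 v1 -> (absz (i1 - j1)%R + `|j1| < n)%N ->
    exists e c d k l, [/\ P 0 d, power_coset e c d k (aff i1 u1) & power_coset e c d l (aff j1 v1)].
  move=> P1 P2 lt; have P2' := PV _ _ P2.
  have [|e [c [d [k [l [Pd K1 K2]]]]]] := step _ _ _ _ P1 P2'; first by rewrite abszN.
  exists e, c, d, k, (- l); split=> //.
  have := power_cosetV K2; rewrite -affV invgK; exact.
have [ij|ij] := leqP `|j| `|i|.
  have [s|s] : (absz (i + j)%R + `|j| < n)%N \/ (absz (i - j)%R + `|j| < n)%N by lia.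
    exact: step.
  exact: step'.
apply: sym; have [s|s] : (absz (j + i)%R + `|i| < n)%N \/ (absz (j - i)%R + `|i| < n)%N by lia.
  exact: step.
exact: step'.
Qed.

End Affine.

(** * Monodromy with affine values and the generator of the module *)

Section Monodromy.
Variables (R : realType) (B E : topologicalType) (X : set B) (p : E -> B).
Variable t : homeomorphism E E.
Hypothesis hp : is_commutator_covering R X p.
Hypothesis ht : is_deck_generator R X p t.
Variable sec : B -> E.
Hypothesis secP : forall q, X q -> p (sec q) = q.

Let Q : lmodType laurent := path_module R t.
Let pc (f : R -> E) : Q := path_class f.
Let cov : is_covering X p. Proof. by case: hp. Qed.

(** [sec] is a mere choice of a point in each fibre; it lets open paths be recorded too, by the
    class of the lift and the deck exponent at its end. *)
Definition lift_type (f : R -> B) n (u : Q) : Prop :=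
  exists d, lifts p f (sec (f 0)) d (deck t n (sec (f 1))) /\ u = pc d.

Lemma lift_type_exists x y f : is_path X x y f -> exists n u, lift_type f n u.
Proof.
move=> Pf; have [_ f0 f1 _] := Pf; have [Xx Xy] := is_path_ends Pf.
have [d [e' Ld]] := path_lift cov Pf (secP Xx).
have [|n nE] := @deck_transitive R B E X p t hp ht (sec y) e'.
  have [_ _ <- _] := Ld.1; rewrite Ld.2 ?lexx ?ler01 //= f1; exact: secP.
by exists n, (pc d), d; rewrite f0 f1 -nE.
Qed.

Definition monodromy (f : R -> B) : bijection Q :=
  if pselect (exists nu, lift_type f nu.1 nu.2) is left H
  then aff (sval (cid H)).1 (sval (cid H)).2 else 1%g.

Lemma monodromyE f n u : lift_type f n u -> monodromy f = aff n u.
Proof.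
move=> fnu; rewrite /monodromy; case: pselect => [H|[]]; last by exists (n, u).
case: cid => -[m v] /= [d [Ld ->]]; have [d' [Ld' ->]] := fnu.
have [E1 dd'] := lifts_unique cov Ld Ld'.
apply: bijection_ext => w /=; rewrite (laurent_pow_unique hp ht w E1); congr (_ + _).
exact: path_class_eq.
Qed.

Lemma monodromy_functor : path_functor X monodromy.
Proof.
split=> [x y f g fg|x y z f g Pf Pg].
  have [Pf Pg] := path_homotopic_path fg.
  have [_ f0 f1 _] := Pf; have [_ g0 g1 _] := Pg.
  have [n [u fnu]] := lift_type_exists Pf; rewrite (monodromyE fnu).
  have [m [v gmv]] := lift_type_exists Pg; rewrite (monodromyE gmv).
  have [d [Ld ->]] := fnu; have [d' [Ld' ->]] := gmv.
  rewrite g0 g1 in Ld'; rewrite f0 f1 in Ld.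
  have [E1 dd'] := homotopy_lift cov fg Ld Ld'.
  apply: bijection_ext => w /=; rewrite (laurent_pow_unique hp ht w E1); congr (_ + _).
  exact: path_class_homotopic dd'.
have [_ f0 f1 _] := Pf; have [_ g0 g1 _] := Pg.
have [_ c0 c1 _] := is_path_concat Pf Pg.
have [n [u fnu]] := lift_type_exists Pf; rewrite (monodromyE fnu).
have [m [v gmv]] := lift_type_exists Pg; rewrite (monodromyE gmv) affM.
apply: monodromyE; have [d [Ld ->]] := fnu; have [d' [Ld' ->]] := gmv.
(* The lift of [g] must be translated by t^n to begin where that of [f] ends, and this multiplies
   its class by t^n. *)
exists (concat d (deck t n \o d')); rewrite c0 c1.
have Ld2 := lifts_deck ht n Ld'.
rewrite f0 f1 in Ld; rewrite g0 g1 -deckD in Ld2; split; first exact: lifts_concat Ld Ld2.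
rewrite /pc (path_class_concat Ld.1 Ld2.1); congr (_ + _).
by rewrite -(path_class_deck t n Ld'.1).
Qed.

Variables (x0 : B) (a b : R -> B).
Hypotheses (Pa : is_loop X x0 a) (Pb : is_loop X x0 b).
Hypothesis gen : forall h, is_loop X x0 h ->
  generated (monodromy a) (monodromy b) (monodromy h).

Let e0 := sec x0.

(** Carrying actual paths through the Nielsen moves ensures that the final [d] is the class of a
    loop in the covering. *)
Let realized n (u : Q) := exists d, is_path setT e0 (deck t n e0) d /\ pc d = u.

Lemma realizedM i u j v : realized i u -> realized j v ->
  realized (i + j) (u + laurent_pow i *: v).
Proof.
move=> [d [Pd <-]] [d' [Pd' <-]]; exists (concat d (deck t i \o d')).
have P2 := deck_path t i Pd'; rewrite -deckD in P2.
split; first exact: is_path_concat Pd P2.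
by rewrite /pc (path_class_concat Pd P2) -(path_class_deck t i Pd').
Qed.

Lemma realizedV i u : realized i u -> realized (- i) (- (laurent_pow (- i) *: u)).
Proof.
move=> [d [Pd <-]]; exists (deck t (- i) \o reverse d).
have Pr := is_path_reverse Pd; have P2 := deck_path t (- i) Pr.
rewrite -deckD addNr in P2; split; first exact: P2.
by rewrite /pc (path_class_deck t (- i) Pr) -scalerN; congr (_ *: _); apply: path_class_reverse Pd.
Qed.

Lemma loop_realized f : is_loop X x0 f -> exists i u, realized i u /\ monodromy f = aff i u.
Proof.
move=> Pf; have [i [u fiu]] := lift_type_exists Pf; exists i, u; split; last exact: monodromyE.
have [_ f0 f1 _] := Pf; have [d [Ld ->]] := fiu.
by rewrite f0 f1 in Ld; exists d; split=> //; exact: Ld.1.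
Qed.

(** The index of [power_coset] is additive along concatenation, so it cancels in commutators. *)
Lemma commutator_coset e c d : (forall h, is_loop X x0 h -> exists k, power_coset e c d k (monodromy h)) ->
  forall f, in_commutator_subgroup X x0 f ->
    is_loop X x0 f /\ power_coset e c d 0 (monodromy f).
Proof.
move=> K f; have nuF := monodromy_functor.
have Xx0 : X x0 by have [] := is_path_ends Pa.
elim=> [|f1 f2 h P1 P2 _ [Ph Kh]|f1 f2 _ [P1 K1] f12].
- by split; [exact: is_path_cst|rewrite (functor_cst nuF) //; exact: power_coset1].
- have P12 := is_path_concat (is_path_concat P1 P2) 
    (is_path_concat (is_path_reverse P1) (is_path_reverse P2)).
  split; first exact: is_path_concat P12 Ph.
  rewrite (functor_concat nuF P12 Ph) (functor_concat nuF (is_path_concat P1 P2)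
    (is_path_concat (is_path_reverse P1) (is_path_reverse P2))).
  rewrite (functor_concat nuF P1 P2) (functor_concat nuF (is_path_reverse P1) (is_path_reverse P2)).
  rewrite (functor_reverse nuF P1) (functor_reverse nuF P2).
  have [k K1] := K _ P1; have [l K2] := K _ P2.
  have := power_cosetM (power_cosetM (power_cosetM K1 K2)
    (power_cosetM (power_cosetV K1) (power_cosetV K2))) Kh.
  have -> // : k + l + (- k - l) + 0 = 0 by lia.
- split; first by have [] := path_homotopic_path f12.
  by rewrite -(functor_homotopic nuF f12).
Qed.

Lemma deck0 e : deck t 0 e = e. Proof. by []. Qed.

(** A loop upstairs projects into the commutator subgroup, and its monodromy is the translation by
    its own class. Having index 0, this class is a multiple of that of [d]. *)
Theorem covering_loops_cyclic : exists2 d, is_loop setT e0 d &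
  forall f, is_loop setT e0 f -> exists c, pc f = c *: pc d.
Proof.
have [i [u [Ru aE]]] := loop_realized Pa; have [j [v [Rv bE]]] := loop_realized Pb.
have [e [c [d [k [l [Rd Ka Kb]]]]]] := nielsen_reduction realizedM realizedV Ru Rv.
have K h : is_loop X x0 h -> exists m, power_coset e c d m (monodromy h).
  by move=> /gen; rewrite aE bE => H; exact: power_coset_generated Ka Kb H.
have [g [Pg gE]] := Rd; rewrite deck0 in Pg; exists g => // f Pf.
have Xx0 : X x0 by have [] := is_path_ends Pa.
have pe0 : p e0 = x0 by exact: secP.
have Pc := proj_path hp Pf; rewrite pe0 in Pc.
have comm : in_commutator_subgroup X x0 (p \o f).
  have [_ _ C] := hp; have := C e0 (p \o f); rewrite pe0 => /(_ Pc)[_]; apply.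
  exists f => //; exists (fun z => p (f z.2)); split=> //.
  - have [cf _ _ _] := Pc.
    apply: (@within_continuous_comp_in (R * R)%type R B ([set` `[0, 1]] `*` [set` `[0, 1]]) [set` `[0, 1]]
      snd (p \o f) _ _ cf).
      by apply: continuous_subspaceT => z; apply: cvg_snd.
    by move=> z [].
  - by case: Pf => _ f0 f1 _ r _ /=; rewrite f0 f1.
  - by move=> r s _ s1; case: Pc => _ _ _; apply.
have [_ K0] := commutator_coset K comm.
have ft : lift_type (p \o f) 0 (pc f).
  exists f; split=> //; rewrite deck0; case: (Pf) => _ f0 f1 _.
  by rewrite /= f0 f1 pe0; apply: lifts_proj.
rewrite (monodromyE ft) in K0.
by rewrite gE; apply: power_coset0 K0.
Qed.

Lemma loop_cycle d e : is_loop setT e d -> exists z : alexander_module R t, loop_class z = pc d.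
Proof.
move=> [cd d0 d1 _]; have cf := path_fun_continuous cd.
have bd : << singular_of cf >> \in @is_cycle R E.
  apply/eqP; rewrite boundaryU big_ord_recl big_ord1 expr0 scale1r.
  have -> : (-1) ^+ fintype.lift ord0 (ord0 : 'I_1) = -1 :> int by [].
  rewrite scaleN1r; apply/eqP; rewrite subr_eq0; apply/eqP; congr << _ >>.
  apply/continuousEP => v; rewrite /= /simplex_map /path_fun.
  have [v0 v1] := set_mem (valP v); rewrite big_ord1 in v1.
  rewrite (@insert0_lift R 0 ord0 0 1); last by apply/val_inj.
  rewrite (@insert0_same R 0 (fintype.lift ord0 ord0) 1); last by apply/val_inj.
  have -> : (set_val v : 'rV[R]_1) 0 0 = 1 by rewrite -v1; congr (_ _ _); apply/val_inj.
  by rewrite !clamp_id ?lexx ?ler01 // d0 d1.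
exists (homology_class (Cycle bd)); rewrite loop_class_cycle /=.
by rewrite /pc (path_classE cf).
Qed.

Theorem alexander_cyclic : exists z0 : alexander_module R t, forall z, exists c, z = c *: z0.
Proof.
have [d Pd dP] := covering_loops_cyclic.
have [z0 z0E] := loop_cycle Pd; exists z0 => z.
pose tree e : R -> E := sval (cid (covering_connected hp e0 e)).
have treeP e : is_path setT e0 e (tree e) by rewrite /tree; case: cid.
have cT e : continuous (path_fun (tree e)).
  by apply: path_fun_continuous; case: (treeP e).
pose Th := cone (fun s => singular_of (cT (vertex s))).
have ThE s : chain_class (Th << s >>) = pc (tree (vertex s)).
  by rewrite /Th coneU /pc (path_classE (cT _)).
(* [Phi] turns each simplex into a loop at [e0] by means of the paths [tree], so its values are
   multiples of the class of [d]; on cycles it is the class itself. *)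
pose Phi (c : chain R 1 E) : Q := chain_class (c - Th (boundary c)).
have ThB x y : Th (x - y) = Th x - Th y by exact: (raddfB (cone _)).
have ccB x y : chain_class (x - y) = chain_class x - chain_class y :> Q by exact: raddfB.
have PhiB x y : Phi (x - y) = Phi x - Phi y.
  rewrite /Phi; have -> : boundary (x - y) = boundary x - boundary y by exact: raddfB.
  rewrite ThB -[RHS](raddfB (@chain_class R E)); congr chain_class.
  by rewrite !opprB addrACA [RHS]addrACA; congr (_ + _); exact: addrC.
have Phi_mult c : exists k, Phi c = k *: pc d.
  elim/chain_ind: c => [|x y [k kE] [l lE]|s].
  - by exists 0; rewrite -(subrr 0) PhiB subrr scale0r.
  - by exists (k - l); rewrite scalerBl -kE -lE PhiB.
  - have Ps := simplex_path_path s.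
    have P1 := treeP (simplex_path s 0); have P2 := treeP (simplex_path s 1).
    have [k kE] := dP _ (is_path_concat (is_path_concat P1 Ps) (is_path_reverse P2)).
    exists k; rewrite -kE /pc (path_class_concat (is_path_concat P1 Ps) (is_path_reverse P2)).
    rewrite (path_class_concat P1 Ps) (path_class_reverse P2).
    rewrite /Phi boundaryU big_ord_recl big_ord1 expr0 scale1r.
    have -> : (-1) ^+ fintype.lift ord0 (ord0 : 'I_1) = -1 :> int by [].
    rewrite scaleN1r ThB !ccB !ThE chain_class_simplex.
    have v0 : vertex (s \o @face R 0 ord0 : singular_simplex R 0 E) = simplex_path s 1.
      by rewrite /vertex /simplex_path -(@face_simplex0 R ord0 1).
    have v1 : vertex (s \o @face R 0 (fintype.lift ord0 ord0) : singular_simplex R 0 E) = simplex_path s 0.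
      by rewrite /vertex /simplex_path -(@face_simplex0 R (fintype.lift ord0 ord0) 0).
    rewrite v0 v1 opprB addrA /pc; congr (_ - _); exact: addrC.
have [k kE] := Phi_mult (val (representative z)).
exists k; apply: loop_class_inj; rewrite loop_classZ z0E -kE /Phi.
have /eqP-> := cycleP (representative z).
have -> : Th 0 = 0 by exact: (raddf0 (cone _)).
by rewrite subr0.
Qed.

End Monodromy.

Theorem mainTheorem6 (R : realType) (K : set (R3 R)) (E : topologicalType)
    (p : E -> R3 R) (t : homeomorphism E E)
    (hK : is_rational_knot K)
    (hp : is_commutator_covering R (~` K) p)
    (ht : is_deck_generator R (~` K) p t) :
  is_second_elementary_ideal (alexander_module R t) [set: laurent].
Proof.
have [_ [m [n [L [_ [a [_ _ LE]] [F [_ Fh _ FK]]]]]]] := hK.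
have [f fE] : exists h : homeomorphism (R3 R) (R3 R), forall x, h x = F (1, x).
  by apply: Fh; rewrite in01 lexx ler01.
(* The end of the isotopy exhibits [K] as the image of a plat under a homeomorphism of space. *)
have KE : K = f @` plat (rational_word true a).
  by rewrite -FK -LE; congr image; apply/funext => x; rewrite fE.
have [[_ rp _] _ _] := hp.
have [_ [x [g [Xx _ _]]]] := ht.
have [e _ pe] : range p x by rewrite rp.
(* The image of the covering is the complement of [K], so every point there has a preimage; on [K]
   itself the value [e] is a default. *)
have /choice[sec secP] q : exists e, (~` K) q -> p e = q.
  have [Xq|nXq] := pselect ((~` K) q); last by exists e.
  have [e' _ pe'] : range p q by rewrite rp.
  by exists e'.
have nuF := monodromy_functor hp ht secP.
have [x0 [al [be [Pal Pbe gen]]]] := plat_two_generators (rational_word_letters true a)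
  (@cts_fun _ _ f) (@cts_fun _ _ (homeo_inv f)) (homeoK f) (homeo_invK f) KE nuF.
have [z0 z0P] := alexander_cyclic hp ht secP Pal Pbe gen.
exact: cyclic_second_elementary_ideal z0P.
Qed.
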